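(* Suppose assumptions B1 (items 1–5) and B2 stated in the context hold, with constants $\gamma,\kappa,\xi,\nu$ as introduced there, and suppose $\boldsymbol\beta$ (hence $\boldsymbol\mu=\boldsymbol X\boldsymbol\beta$) is known. Let $\epsilon>0$ be such that $\xi>\epsilon>1+2\kappa-\nu$. Let $\{\lambda_{a,n}(\cdot)\}$, $\lambda_n$ and $t_n$ be as described in the context. If the truncation level satisfies $T_n\sim d_T\log n$ for some $d_T>0$, and $\lambda_n^{-1}=O(n^{(1-\epsilon)/2})$, then there exists $c>0$ such that $$P\big(\widehat E^{\lambda,\mathrm{ds}}=E\big)=1-O\big(\exp(-c(\log n)^2)\big)\qquad\text{as }n\to\infty,$$ where $\widehat E^{\lambda,\mathrm{ds}}$ denotes either of the edge set estimates $\widehat E^{\lambda,\wedge,\mathrm{ds}}$, $\widehat E^{\lambda,\vee,\mathrm{ds}}$ (with $T=T_n$) based on the thresholded Dantzig-type selector.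
   Context: **Model.** All quantities below may depend on the sample size $n$. There are $N$ nodes, $K=K(n)$ blocks, $\bar K=\{1,\dots,K\}$, and known block memberships $\boldsymbol z[i]\in\bar K$, $i=1,\dots,N$; $\mathcal A_k=\{i:\boldsymbol z[i]=k\}$, $m_k=|\mathcal A_k|(|\mathcal A_k|-1)/2$, $m_{\min}=\min_k m_k$. A network is undirected with adjacency entries $Y_{ij}\in\{0,1\}$, $i<j$. There is a random symmetric $K\times K$ matrix $\boldsymbol P=(p_{k,l})$ with entries in $(0,1)$; conditionally on $\boldsymbol P$, the $Y_{ij}$ ($i<j$) are independent with $Y_{ij}\sim\mathrm{Bernoulli}(p_{\boldsymbol z[i],\boldsymbol z[j]})$. With $\eta_k=\log(p_{k,k}/(1-p_{k,k}))$, the vector $\boldsymbol\eta=(\eta_1,\dots,\eta_K)^T$ is $N(\boldsymbol\mu,\boldsymbol\Sigma)$, $\boldsymbol\mu=\boldsymbol X\boldsymbol\beta$ with $\boldsymbol X$ a given design matrix, $\boldsymbol\Sigma=(\sigma_{kl})$ nonsingular; each off-diagonal $p_{k,l}$, $k\neq l$, is independent of all other elements of $\boldsymbol P$ (up to symmetry). Put $\mu_B=\max_k|\mu_k|$. One observes $n$ i.i.d. networks $\boldsymbol Y^{(t)}$, $t=1,\dots,n$, with corresponding unobserved $\boldsymbol P^{(t)},\boldsymbol\eta^{(t)}$. Let $S_k^{(t)}$ be the number of edges of $\boldsymbol Y^{(t)}$ within block $k$, $\tilde p_{k,k}^{(t)}=S_k^{(t)}/m_k$, $\tilde\eta_k^{(t)}=\log\big(\tilde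 p_{k,k}^{(t)}/(1-\tilde p_{k,k}^{(t)})\big)\in[-\infty,\infty]$, and, for a truncation level $T>0$, $\hat\eta_k^{(t)}=\max\{-T,\min\{T,\tilde\eta_k^{(t)}\}\}$. Let $\widehat{\boldsymbol H}=(\hat\eta_k^{(t)})$ be the $n\times K$ matrix (rows $t$, columns $k$), with columns $\hat{\boldsymbol\eta}_a$; $\boldsymbol 1_n$ is the all-ones vector in $\mathbb R^n$; subscript $-a$ on a matrix/vector means that column/entry $a$ is removed. $|\cdot|_\infty$ is the largest absolute entry of a vector or matrix, $\|\cdot\|_\infty$ of a matrix is the maximum absolute row sum. **Graph.** $\boldsymbol D=\boldsymbol\Sigma^{-1}=(d_{kl})$; $E=\{(a,b):a\ne b,\ d_{ab}\ne0\}$; $\mathrm{ne}_a=\{b\in\bar K\setminus\{a\}:d_{ab}\neq0\}$. $\boldsymbol\theta^a\in\mathbb R^K$ is defined by $\theta^a_a=0$ and $\eta_a-\mu_a=\sum_{b\ne a}\theta_b^a(\eta_b-\mu_b)+v_a$ with $v_a$ independent of $\{\eta_b:b\neq a\}$. $\pi_{ab}$ is the partial correlation of $\eta_a$ and $\eta_b$ given the remaining components of $\boldsymbol\eta$. **Dantzig-type selector.** For each $n$, $\{\lambda_{a,n}(\cdot):a\in\bar K\}$ are functions on $[0,\infty)$ such that: each $\lambda_{a,n}$ is increasing (in the weak sense; constants are allowed); there is a constant $\lambda_n>0$ with $\min_{a\in\bar K}\min_{\boldsymbol\theta\in\mathbb R^K:\theta_a=0}\lambda_{a,n}(\|\boldsymbol\theta\|_1)\ge\lambda_n$;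 and $\max_{a\in\bar K}\lambda_{a,n}(\|\boldsymbol\theta^a\|_1)=o\big(n^{-(1-\xi)/2}(\log n)^{-1}\big)$ with $\xi$ from B1.4. For $a\in\bar K$, $\tilde{\boldsymbol\theta}^{a,\lambda,\mathrm{ds}}$ is a solution of: minimize $\|\boldsymbol\theta\|_1$ over $\boldsymbol\theta\in\mathbb R^K$ with $\theta_a=0$ and $$\Big|\tfrac1n(\widehat{\boldsymbol H}_{-a}-\boldsymbol 1_n\boldsymbol\mu_{-a}^T)^T\big((\hat{\boldsymbol\eta}_a-\mu_a\boldsymbol 1_n)-(\widehat{\boldsymbol H}-\boldsymbol 1_n\boldsymbol\mu^T)\boldsymbol\theta\big)\Big|_\infty\le\lambda_{a,n}(\|\boldsymbol\theta\|_1).$$ The sequence $t_n$ satisfies $t_n^{-1}=o(1)$, $t_n=O(\log n)$. The thresholded version is $\hat\theta^{a,\lambda,\mathrm{ds}}_a=0$ and, for $b\ne a$, $\hat\theta^{a,\lambda,\mathrm{ds}}_b=\tilde\theta^{a,\lambda,\mathrm{ds}}_b$ if $|\tilde\theta^{a,\lambda,\mathrm{ds}}_b|>t_n\lambda_{a,n}(\|\tilde{\boldsymbol\theta}^{a,\lambda,\mathrm{ds}}\|_1)$ and $0$ otherwise. $\widehat{\mathrm{ne}}_a^{\lambda,\mathrm{ds}}=\{b:\hat\theta_b^{a,\lambda,\mathrm{ds}}\neq0\}$. $\widehat E^{\lambda,\wedge,\mathrm{ds}}$ (resp. $\widehat E^{\lambda,\vee,\mathrm{ds}}$) is the set of $(a,b)$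 with $a\in\widehat{\mathrm{ne}}_b^{\lambda,\mathrm{ds}}$ and (resp. or) $b\in\widehat{\mathrm{ne}}_a^{\lambda,\mathrm{ds}}$. **Assumption B1.** 1. There is $\gamma>0$ with $K(n)=O(n^\gamma)$. 2. For all $a\in\bar K$ and $n$, $\mathrm{Var}(\eta_a)=1$, and there is $\upsilon^2>0$ with $\mathrm{Var}(\eta_a\mid\boldsymbol\eta_{\bar K\setminus\{a\}})\ge\upsilon^2$. 3. (a) There is $0\le\kappa<1/2$ with $\max_a|\mathrm{ne}_a|=O(n^\kappa)$. (b) $\|\boldsymbol\Sigma^{-1}\|_\infty=O(1)$. 4. There are a constant $c>0$ and $1\ge\xi>\kappa$ with $|\pi_{ab}|\ge cn^{-(1-\xi)/2}$ for all $(a,b)\in E$. 5. $\mu_B(n)=o(\log n)$. **Assumption B2.** $m_{\min}^{-1}(n)=O(n^{-\nu})$ with some $\nu>1-\xi+2\kappa$. **Notation.** $a_n\sim b_n$ means $a_n/b_n\to c$ for some $0<c<\infty$. *)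

(* Defs.v *)
From HB Require Import structures.
From mathcomp Require Import all_boot all_order all_algebra.
From mathcomp Require Import all_classical all_reals all_analysis.

Set Implicit Arguments.
Unset Strict Implicit.
Unset Printing Implicit Defensive.

Import Order.TTheory GRing.Theory Num.Theory.
Import numFieldNormedType.Exports.

Local Open Scope classical_set_scope.
Local Open Scope ring_scope.

(* Sigma-algebra on [T] generated by the real functions [X i], [i] in [D]. *)
Definition sigma_rv (R : realType) (I T : Type) (D : set I) (X : I -> T -> R)
    : set (set T) :=
  <<s \bigcup_(i in D) preimage_set_system [set: T] (X i) measurable >>.

Definition independent_sigma (R : realType) (d : measure_display)
    (T : measurableType d) (P : probability T R) (F G : set (set T)) : Prop :=
  forall A B, F A -> G B -> P (A `&` B) = (P A * P B)%E.

Definition mutually_independent_sigma (R : realType) (d : measure_display)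
    (T : measurableType d) (P : probability T R) (I : finType)
    (F : I -> set (set T)) : Prop :=
  forall (J : {set I}) (A : I -> set T), (forall i, i \in J -> F i (A i)) ->
    P (\bigcap_(i in [set` J]) A i) = (\prod_(i in J) P (A i))%E.

(* Equality of the joint laws of two families of random variables.  The
   coordinate functions generate the product sigma-algebra on [I -> R]. *)
Definition same_law (R : realType) (d : measure_display)
    (T : measurableType d) (P : probability T R) (I : Type)
    (X X' : I -> T -> R) : Prop :=
  forall A : set (I -> R),
    sigma_rv [set: I] (fun i (x : I -> R) => x i) A ->
    P [set w | A (X ^~ w)] = P [set w | A (X' ^~ w)].

(* [Z] is a version of the conditional expectation of [X] given [G]. *)
Definition is_cond_exp (R : realType) (d : measure_display)
    (T : measurableType d) (P : probability T R) (G : set (set T))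
    (X Z : T -> R) : Prop :=
  [/\ forall B : set R, measurable B -> G (Z @^-1` B),
      P.-integrable [set: T] (EFin \o Z) &
      forall A, G A ->
        (\int[P]_(w in A) (Z w)%:E = \int[P]_(w in A) (X w)%:E)%E].

(* [V] is a version of the conditional variance of [X] given [G]. *)
Definition is_cond_var (R : realType) (d : measure_display)
    (T : measurableType d) (P : probability T R) (G : set (set T))
    (X V : T -> R) : Prop :=
  exists M : T -> R,
    is_cond_exp P G X M /\ is_cond_exp P G (fun w => (X w - M w) ^+ 2) V.

(* [e] is the residual of the linear regression of [X a], with intercept, on
   the variables [X c], [c] in [C]. *)
Definition is_linear_residual (R : realType) (d : measure_display)
    (T : measurableType d) (P : probability T R) (I : finType)
    (X : I -> T -> R) (C : {set I}) (a : I) (e : T -> R) : Prop :=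
  [/\ exists (b0 : R) (b : I -> R),
        e = fun w => X a w - (b0 + \sum_(c in C) b c * X c w),
      ('E_P[e] = 0)%E &
      forall c, c \in C -> covariance P e (X c) = 0%E].

(* [r] is the partial correlation of [X a] and [X b] given all other [X c]:
   the correlation of the two regression residuals. *)
Definition is_partial_corr (R : realType) (d : measure_display)
    (T : measurableType d) (P : probability T R) (I : finType)
    (X : I -> T -> R) (a b : I) (r : R) : Prop :=
  exists e f : T -> R,
    [/\ is_linear_residual P X (~: [set a; b])%SET a e,
        is_linear_residual P X (~: [set a; b])%SET b f &
        r = fine (covariance P e f)
            / (Num.sqrt (fine 'V_P[e]%E) * Num.sqrt (fine 'V_P[f]%E))].

(* [normal_prob] takes a standard deviation and is not the Dirac mass when that
   is zero, hence the case split. *)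
Definition normal_law (R : realType) (m v : R) : set R -> \bar R :=
  if v == 0 then dirac m else normal_prob m (Num.sqrt v).

(* [X] is N(mu, Sigma): every linear combination of its entries is univariate
   normal, with the corresponding mean and variance. *)
Definition is_multinormal (R : realType) (d : measure_display)
    (T : measurableType d) (P : probability T R) (K : nat)
    (X : T -> 'cV[R]_K) (mu : 'cV[R]_K) (Sigma : 'M[R]_K) : Prop :=
  [/\ Sigma^T = Sigma,
      forall u : 'cV[R]_K, 0 <= (u^T *m Sigma *m u) 0 0 &
      forall (u : 'cV[R]_K) (B : set R), measurable B ->
        P [set w | B ((u^T *m X w) 0 0)] =
        normal_law ((u^T *m mu) 0 0) ((u^T *m Sigma *m u) 0 0) B].

Definition logit (R : realType) (x : R) : R := ln (x / (1 - x)).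

Definition eta_of (R : realType) (K : nat) (p : 'M[R]_K) : 'cV[R]_K :=
  \col_k logit (p k k).

(* All entries of a probability matrix and of an adjacency matrix, as one
   family of real numbers. *)
Definition network_entry (R : realType) (K N : nat) (p : 'M[R]_K)
    (y : 'M[bool]_N) (i : ('I_K * 'I_K) + ('I_N * 'I_N)) : R :=
  match i with
  | inl kl => p kl.1 kl.2
  | inr ij => (y ij.1 ij.2)%:R
  end.

Record network_model (R : realType) (n : nat) := NetworkModel {
  nodes : nat;
  blocks : nat;
  membership : 'I_nodes -> 'I_blocks;
  covariates : nat;
  design : 'M[R]_(blocks, covariates);
  beta : 'cV[R]_covariates;
  Sigma : 'M[R]_blocks;
  disp : measure_display;
  Omega : measurableType disp;
  Pr : probability Omega R;
  pmat : 'I_n -> Omega -> 'M[R]_blocks;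
  adj : 'I_n -> Omega -> 'M[bool]_nodes;

  blocks_gt0 : (0 < blocks)%N;
  pmat_meas : forall t k l, measurable_fun [set: Omega] (fun w => pmat t w k l);
  pmat_sym : forall t w, (pmat t w)^T = pmat t w;
  pmat_itv : forall t w k l, 0 < pmat t w k l < 1;
  adj_meas : forall t i j, measurable [set w | adj t w i j];
  adj_sym : forall t w, (adj t w)^T = adj t w;
  adj_diag : forall t w i, adj t w i i = false;

  Sigma_nonsingular : Sigma \in unitmx;
  eta_normal : forall t,
    is_multinormal Pr (fun w => eta_of (pmat t w)) (design *m beta) Sigma;
  offdiag_indep : forall t (k l : 'I_blocks), k != l ->
    independent_sigma Pr
      (sigma_rv [set (k, l)] (fun kl w => pmat t w kl.1 kl.2))
      (sigma_rv [set kl | kl <> (k, l) /\ kl <> (l, k)]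
                (fun kl w => pmat t w kl.1 kl.2));

  (* Conditional law of the edges given [pmat t], through its defining integrals over events of sigma(pmat t). *)
  adj_cond_law : forall t (A : set Omega) (y : 'M[bool]_nodes),
    sigma_rv [set: 'I_blocks * 'I_blocks] (fun kl w => pmat t w kl.1 kl.2) A ->
    Pr (A `&` [set w | forall i j : 'I_nodes, (i < j)%N -> adj t w i j = y i j]) =
    (\int[Pr]_(w in A)
       (\prod_(ij : 'I_nodes * 'I_nodes | (ij.1 < ij.2)%N)
          bernoulli_pmf (pmat t w (membership ij.1) (membership ij.2))
                        (y ij.1 ij.2))%R%:E)%E;

  sample_indep : mutually_independent_sigma Pr (fun t =>
    sigma_rv setT (fun i w => network_entry (pmat t w) (adj t w) i));
  sample_ident : forall s t, same_law Pr
    (fun i w => network_entry (pmat s w) (adj s w) i)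
    (fun i w => network_entry (pmat t w) (adj t w) i)
}.

Section Model.
Variables (R : realType) (n : nat) (M : network_model R n).
Local Notation K := (blocks M).
Implicit Types (a b k : 'I_(blocks M)) (t : 'I_n) (w : Omega M).

Definition mu : 'cV[R]_K := design M *m beta M.
Definition mu_B : R := \big[Num.max/0]_k `|mu k 0|.

Definition block k : {set 'I_(nodes M)} := [set i | membership i == k]%SET.
Definition block_pairs k : nat := (#|block k| * (#|block k| - 1)) %/ 2.
(* The default value is irrelevant, as there is at least one block. *)
Definition block_pairs_min : nat :=
  \big[minn/(\max_k block_pairs k)%N]_k block_pairs k.

Definition eta t w : 'cV[R]_K := eta_of (pmat t w).
Definition eta_coord t k w : R := eta t w k 0.

Definition precision : 'M[R]_K := invmx (Sigma M).
Definition edges : {set 'I_K * 'I_K} :=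
  [set ab | (ab.1 != ab.2) && (precision ab.1 ab.2 != 0)]%SET.
Definition neighbours a : {set 'I_K} :=
  [set b | (b != a) && (precision a b != 0)]%SET.

Definition norm1 (th : 'cV[R]_K) : R := \sum_k `|th k 0|.
Definition max_abs (p q : nat) (A : 'M[R]_(p, q)) : R :=
  \big[Num.max/0]_i \big[Num.max/0]_j `|A i j|.
Definition max_row_sum (p q : nat) (A : 'M[R]_(p, q)) : R :=
  \big[Num.max/0]_i \sum_j `|A i j|.

(* [th] is the vector of coefficients of the regression of eta_a on the other
   components of eta, with an independent error. *)
Definition is_regression_coef a (th : 'cV[R]_K) : Prop :=
  th a 0 = 0 /\
  forall t, independent_sigma (Pr M)
    (preimage_set_system [set: Omega M]
       (fun w => eta t w a 0 - mu a 0
                 - \sum_(b | b != a) th b 0 * (eta t w b 0 - mu b 0))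
       measurable)
    (sigma_rv [set b | b != a] (eta_coord t)).

Definition edge_count t w k : nat :=
  #|[set ij : 'I_(nodes M) * 'I_(nodes M) |
      [&& (ij.1 < ij.2)%N, ij.1 \in block k, ij.2 \in block k
        & adj t w ij.1 ij.2]]%SET|.

Definition p_tilde t w k : R := (edge_count t w k)%:R / (block_pairs k)%:R.

(* Extended division and logarithm: -oo at frequency 0 and +oo at 1. *)
Definition eta_tilde t w k : \bar R :=
  lne ((p_tilde t w k)%:E / (1 - p_tilde t w k)%:E)%E.

Definition eta_hat (T : R) t w k : R :=
  fine (Order.max (- T)%:E (Order.min T%:E (eta_tilde t w k))).

Definition H_hat (T : R) w : 'M[R]_(n, K) := \matrix_(t, k) eta_hat T t w k.

Definition ones : 'cV[R]_n := const_mx 1.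

(* [col'], [row'] remove, and [col] extracts, the entries of index [a]. *)
Definition ds_feasible (T : R) (lam : 'I_K -> R -> R) a w (th : 'cV[R]_K)
    : Prop :=
  th a 0 = 0 /\
  max_abs (n%:R^-1 *:
    ((col' a (H_hat T w) - ones *m (row' a mu)^T)^T *m
     ((col a (H_hat T w) - mu a 0 *: ones)
      - (H_hat T w - ones *m mu^T) *m th)))
  <= lam a (norm1 th).

Definition is_dantzig (T : R) (lam : 'I_K -> R -> R) a w (th : 'cV[R]_K)
    : Prop :=
  ds_feasible T lam a w th /\
  forall th' : 'cV[R]_K, ds_feasible T lam a w th' -> norm1 th <= norm1 th'.

Definition threshold (tn : R) (lam : 'I_K -> R -> R) a (th : 'cV[R]_K)
    : 'cV[R]_K :=
  \col_b (if (b != a) && (tn * lam a (norm1 th) < `|th b 0|)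
          then th b 0 else 0).

(* Estimated neighbourhoods and edge sets from unthresholded selectors [th]. *)
Definition ne_hat (tn : R) (lam : 'I_K -> R -> R) (th : 'I_K -> 'cV[R]_K) a
    : {set 'I_K} :=
  [set b | threshold tn lam a (th a) b 0 != 0]%SET.

Definition E_hat_and tn lam th : {set 'I_K * 'I_K} :=
  [set ab | (ab.1 \in ne_hat tn lam th ab.2)
            && (ab.2 \in ne_hat tn lam th ab.1)]%SET.
Definition E_hat_or tn lam th : {set 'I_K * 'I_K} :=
  [set ab | (ab.1 \in ne_hat tn lam th ab.2)
            || (ab.2 \in ne_hat tn lam th ab.1)]%SET.

End Model.

Arguments eta_coord {R n} M t k w.
Arguments neighbours {R n} M a.
Arguments is_regression_coef {R n} M a th.
Arguments is_dantzig {R n} M T lam a w th.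

(* Main.v *)
(* On an event whose complement has probability O(exp(-c (log n)^2)), all three
   of the following hold: every centred eta_k^(t) is at most delta log n in
   absolute value, every block frequency is within n^(-nu/2) log n of p_kk, and
   the empirical covariance of the latent eta is entrywise within
   n^(-1/2) (log n)^2 of Sigma.  The first two make each truncated empirical
   logit differ from eta_k^(t) by at most n^(-nu/2 + 2 delta) log n up to a
   constant, so that the covariance S of the observed columns is entrywise
   within r of Sigma, where (1 + ||Sigma^-1||_oo) r <= lambda_n because
   nu > 1 - epsilon.

   The rest is deterministic.  Since theta^a_b = - d_ab / d_aa and d_aa >= 1,
   ||theta^a||_1 <= ||Sigma^-1||_oo, hence theta^a is feasible and the selector
   has no larger l1 norm.  The difference h of the two satisfies
   |(Sigma h)_b| <= 4 lambda_a(||selector||_1) for b != a, and h = Sigma^-1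
   (Sigma h) with h_a = 0 controls the remaining entry (Sigma h)_a; so h is
   bounded by a constant multiple of lambda_a(||selector||_1), eventually below
   the threshold t_n lambda_a(||selector||_1), while on edges
   |theta^a_b| >= |pi_ab| / ||Sigma^-1||_oo exceeds their sum. *)
Require Import Defs.
From HB Require Import structures.
From mathcomp Require Import all_boot all_order all_algebra.
From mathcomp Require Import all_classical all_reals all_analysis.
From mathcomp Require Import measurable_realfun ring lra.
Import Order.TTheory GRing.Theory Num.Theory.
Import numFieldNormedType.Exports.
Local Open Scope classical_set_scope.
Local Open Scope ring_scope.
Set Implicit Arguments.
Unset Strict Implicit.
Unset Printing Implicit Defensive.

(** * Transfer of weighted integrals *)

(** The cost of passing from frequencies to logits shapes the argument. The derivative of the logit
    is 1/(p(1-p)), of order exp|eta|, and |eta| is unbounded. Allowing |eta| up to 2 delta log n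
    (half for the centred part, half for mu_B = o(log n)) costs a factor n^(2 delta), while each
    excluded Gaussian event has probability at most 2 exp(-(delta log n)^2/4), small enough to
    absorb the polynomial number n K of variables. The constant delta must also keep 2 delta log n
    below T_n, so that truncation never moves an estimate away from its target.

    Multinormality is available only through the univariate laws of linear combinations. Variances
    and covariances are therefore recovered from Laplace transforms and polarization. Polarization
    also serves the empirical covariance: products of normal variables become squares of sums and
    differences, whose Laplace transforms are explicit. *)

Section weighted_transfer.
Local Open Scope ereal_scope.
Import HBNNSimple.
Context d1 d2 d (T1 : measurableType d1) (T2 : measurableType d2)
  (Z : measurableType d) (R : realType).

Lemma integral_nnsfun_comp_weight d0 (T0 : measurableType d0) (m : {measure set T0 -> \bar R})
    (X : T0 -> Z) (f : T0 -> \bar R) 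
    (h : {nnsfun Z >-> R}) :
  measurable_fun setT X -> measurable_fun setT f -> (forall x, 0 <= f x) ->
  \int[m]_x ((h (X x))%:E * f x) =
  \sum_(k \in range h) k%:E * \int[m]_(x in X @^-1` (h @^-1` [set k])) f x.
Proof.
move=> mX mf f0.
have mpre (r : R) : measurable (X @^-1` (h @^-1` [set r])).
  by rewrite -[X in measurable X]setTI; exact: mX.
have mind (k : R) :
    measurable_fun setT (fun x => (\1_(X @^-1` (h @^-1` [set k])) x)%:E * f x).
  by apply: emeasurable_funM => //; apply/measurable_EFinP.
have ind0 (k : R) x : 0 <= (\1_(X @^-1` (h @^-1` [set k])) x)%:E * f x.
  by rewrite mule_ge0// lee_fin.
transitivity (\int[m]_x \sum_(k \in range h)
    (k%:E * ((\1_(X @^-1` (h @^-1` [set k])) x)%:E * f x))).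
  apply: eq_integral => x _; rewrite fimfunE -fsumEFin//.
  rewrite ge0_mule_fsuml => [|r]; last by rewrite EFinM nnfun_muleindic_ge0.
  by apply: eq_fsbigr => k _; rewrite EFinM muleA.
rewrite ge0_integral_fsum//; last 2 first.
- by move=> k; apply: emeasurable_funM.
- move=> k x _; rewrite muleA mule_ge0// nnfun_muleindic_ge0//.
apply: eq_fsbigr => k /[!inE] -[z _ <-].
rewrite ge0_integralZl//; last by rewrite lee_fin.
congr (_ * _); rewrite [RHS]integral_mkcond.
apply: eq_integral => x _; rewrite patchE indicE.
by case: ifPn => _; rewrite ?mul1e ?mul0e.
Qed.

(** The hypothesis on preimages says that the measures with densities [f] and [g] have the same
    image on [Z]; simple approximation of [phi] from below does the rest. With [m2] Lebesgue measure
    and [g] a normal density this transfers a law; with equal measures and constant [g] it expresses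
    independence. *)
Lemma ge0_integral_comp_weight (m1 : {measure set T1 -> \bar R})
    (m2 : {measure set T2 -> \bar R}) (X : T1 -> Z) (Y : T2 -> Z)
    (f : T1 -> R) (g : T2 -> R) (phi : Z -> R) :
  measurable_fun setT X -> measurable_fun setT Y ->
  measurable_fun setT f -> measurable_fun setT g ->
  (forall x, 0 <= f x)%R -> (forall x, 0 <= g x)%R ->
  measurable_fun setT phi -> (forall z, 0 <= phi z)%R ->
  (forall B, measurable B ->
    \int[m1]_(x in X @^-1` B) (f x)%:E = \int[m2]_(x in Y @^-1` B) (g x)%:E) ->
  \int[m1]_x (phi (X x) * f x)%:E = \int[m2]_x (phi (Y x) * g x)%:E.
Proof.
move=> mX mY mf mg f0 g0 mphi phi0 fg.
have mphiE : measurable_fun setT (EFin \o phi) by exact/measurable_EFinP.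
pose p_ := nnsfun_approx measurableT mphiE.
have cvgp z : (p_ n z)%:E @[n --> \oo] --> (phi z)%:E.
  by apply: cvg_nnsfun_approx => // y _; rewrite lee_fin.
have lim d' (T : measurableType d') (m : {measure set T -> \bar R})
    (V : T -> Z) (u : T -> R) : measurable_fun setT V ->
    measurable_fun setT u -> (forall x, 0 <= u x)%R ->
    \int[m]_x (phi (V x) * u x)%:E =
    limn (fun n => \int[m]_x ((p_ n (V x))%:E * (u x)%:E)).
  move=> mV mu u0; rewrite -monotone_convergence//.
  - apply: eq_integral => x _; apply/esym/cvg_lim => //.
    by rewrite EFinM; apply: cvgeZr => //.
  - move=> n; apply: emeasurable_funM; last exact/measurable_EFinP.
    apply/measurable_EFinP; exact: measurableT_comp.
  - by move=> n x _; rewrite mule_ge0// lee_fin.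
  - move=> x _ a b ab; rewrite lee_wpmul2r// lee_fin//.
    exact/lefP/nd_nnsfun_approx.
rewrite !lim//; congr (limn _); apply/funext => n.
rewrite (integral_nnsfun_comp_weight _ _ mX (measurableT_comp _ mf))//.
rewrite (integral_nnsfun_comp_weight _ _ mY (measurableT_comp _ mg))//.
by apply: eq_fsbigr => k _; rewrite fg.
Qed.
End weighted_transfer.

(** * Moments of normal laws *)

(** [e] will be the mean of a centred normal of variance [v]. A line of slope [e] through (0,1) that
    stays below exp(k^2 v/2), a function flat at k = 0, is horizontal. *)
Lemma expR_quadratic_slope (R : realType) (v e : R) : 0 <= v ->
  (forall k, 1 + k * e <= expR (k ^+ 2 * v / 2)) -> e = 0.
Proof.
move=> v0 H; apply/eqP; apply/negPn/negP => e0.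
have e2 : 0 < e ^+ 2 by rewrite exprn_even_gt0.
(* The test point is k = t e with t = 1/D: both t v and t e^2 are below 1, so the linear gain t e^2
   beats the quadratic term (t e^2)(t v)/2. *)
pose D := (v + 1) * (e ^+ 2 + 1).
have D0 : 0 < D by rewrite mulr_gt0//; lra.
pose t := D^-1; have t0 : 0 < t by rewrite invr_gt0.
have tD : t * D = 1 by rewrite mulVf// gt_eqF.
have tv : t * v < 1 by rewrite -tD ltr_pM2l// /D; nra.
have te : t * e ^+ 2 < 1 by rewrite -tD ltr_pM2l// /D; nra.
have te0 : 0 < t * e ^+ 2 by rewrite mulr_gt0.
have tv0 : 0 <= t * v by rewrite mulr_ge0// ltW.
have := H (t * e).
set y := (t * e) ^+ 2 * v / 2.
have yE : y = (t * e ^+ 2) * (t * v) / 2 by rewrite /y; field.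
have := expR_ge1Dx (- y); rewrite expRN => yy h.
have E0 := expR_gt0 y.
have : (1 - y) * expR y <= 1 by rewrite -ler_pdivlMr// div1r.
have y1 : y < 1 by rewrite yE; nra.
have : (1 + t * e * e) * (1 - y) <= (1 - y) * expR y.
  by rewrite mulrC ler_pM2l//; lra.
rewrite -mulrA -expr2 yE; set s := t * e ^+ 2 in te te0 *; set u := t * v in tv tv0 *.
move=> h1 h2.
have : s * (1 - u / 2 - s * u / 2) <= 0 by nra.
rewrite pmulr_rle0//; nra.
Qed.

(* The right-hand side is the Laplace transform of a squared centred normal of
   variance v: the first-order terms at q = 0, for both signs of q, identify the
   second moment Q. *)
Lemma inv_sqrt_slope (R : realType) (v Q : R) : 0 <= v -> 0 <= Q ->
  (forall q, 2 * q * v < 1 -> 1 + q * Q <= (Num.sqrt (1 - 2 * q * v))^-1) ->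
  Q = v.
Proof.
move=> v0 Q0 H; apply/eqP; rewrite -subr_eq0; apply/negPn/negP => D0.
set D := Q - v in D0.
(* [q] has the sign of Q - v, and the size of [A] keeps q Q and q v within 1/4. The first-order term
   2 q D of the squared inequality then equals 8 q^2 A^2, which dominates the other terms. *)
pose A := 1 + Q + v; have A0 : 0 < A by rewrite /A; lra.
pose q := D / (4 * A ^+ 2).
have A20 : 0 < 4 * A ^+ 2 by rewrite mulr_gt0// exprn_gt0.
have DA : `|D| <= A by rewrite ler_norml /D /A; apply/andP; split; lra.
have qA : `|q| * A <= 1 / 4.
  rewrite /q normrM normfV (ger0_norm (ltW A20)) mulrAC ler_pdivrMr//.
  have -> : 1 / 4 * (4 * A ^+ 2) = A * A by field.
  by rewrite ler_pM2r.
have qQ : `|q * Q| <= 1 / 4.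
  rewrite normrM (ger0_norm Q0); apply: le_trans qA.
  by rewrite ler_wpM2l// /A; lra.
have qv : `|q * v| <= 1 / 4.
  rewrite normrM (ger0_norm v0); apply: le_trans qA.
  by rewrite ler_wpM2l// /A; lra.
move: qQ qv; rewrite !ler_norml => /andP[qQ1 qQ2] /andP[qv1 qv2].
have r0 : 0 < 1 - 2 * q * v by rewrite -mulrA; lra.
have := H q; rewrite -subr_gt0 => /(_ r0).
rewrite -[_^-1]div1r ler_pdivlMr ?sqrtr_gt0// => h.
have : ((1 + q * Q) * Num.sqrt (1 - 2 * q * v)) ^+ 2 <= 1.
  by rewrite expr_le1// mulr_ge0 ?sqrtr_ge0//; lra.
rewrite exprMn sqr_sqrtr ?(ltW r0)// => {}h.
have h2 : 2 * q * D + q ^+ 2 * (Q ^+ 2 - 4 * Q * v - 2 * (q * Q) * Q * v) <= 0.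
  by rewrite /D; move: h; set l := (X in X <= 1) => h;
    rewrite (_ : _ + _ = l - 1) ?subr_le0// /l; ring.
have qD : q * D = 4 * (q * A) ^+ 2 by rewrite /q; field; rewrite gt_eqF.
have q2 : 0 < q ^+ 2.
  rewrite exprn_even_gt0//= mulf_neq0// invr_eq0 gt_eqF//.
have : q ^+ 2 * (8 * A ^+ 2 + (Q ^+ 2 - 4 * Q * v - 2 * (q * Q) * Q * v)) <= 0.
  by rewrite mulrDr (_ : q ^+ 2 * (8 * _) = 2 * q * D) // -mulrA qD; ring.
rewrite pmulr_rle0// => h3.
have Qv : 0 <= Q * v by rewrite mulr_ge0.
have : (q * Q) * (Q * v) <= 1 / 4 * (Q * v) by rewrite ler_wpM2r.
have : 8 * A ^+ 2 >= 8 * (Q * v) + 8 by rewrite /A; nra.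
have : 0 <= Q ^+ 2 by rewrite sqr_ge0.
lra.
Qed.

Lemma integral_EFin1 d (T : measurableType d) (R : realType)
    (m : {measure set T -> \bar R}) (A : set T) : measurable A ->
  (\int[m]_(x in A) (cst 1%R x : R)%:E = m A)%E.
Proof. by move=> mA; rewrite /cst/= (@integral_cst _ _ _ _ _ mA 1%E) mul1e. Qed.

Section normal_moments.
Local Open Scope ereal_scope.
Context d (T : measurableType d) (R : realType) (P : probability T R).
Variables (X : T -> R) (m v : R).
Hypothesis mX : measurable_fun setT X.
Hypothesis v0 : (0 <= v)%R.
Hypothesis lawX : forall B, measurable B -> P (X @^-1` B) = normal_law m v B.

Lemma ge0_integral_normal_law (phi : R -> R) : v != 0%R ->
  measurable_fun setT phi -> (forall x, 0 <= phi x)%R ->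
  \int[P]_w (phi (X w))%:E =
  \int[lebesgue_measure]_x (phi x * normal_pdf m (Num.sqrt v) x)%:E.
Proof.
move=> vn0 mphi phi0.
rewrite -(@ge0_integral_comp_weight _ _ _ _ _ _ R P lebesgue_measure X id
    (cst 1%R) (normal_pdf m (Num.sqrt v)) phi)//.
- by apply: eq_integral => w _; rewrite /= mulr1.
- exact: measurable_normal_pdf.
- by move=> x; exact: normal_pdf_ge0.
- move=> B mB; rewrite integral_EFin1; last first.
    by rewrite -[X in measurable X]setTI; exact: mX.
  by rewrite [LHS]lawX// /normal_law (negbTE vn0).
Qed.

Lemma ge0_integral_normal_law0 (phi : R -> R) : v = 0%R ->
  measurable_fun setT phi -> (forall x, 0 <= phi x)%R ->
  \int[P]_w (phi (X w))%:E = (phi m)%:E.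
Proof.
move=> v_eq0 mphi phi0.
transitivity (\int[dirac m]_x (phi x * 1)%:E).
  rewrite -(@ge0_integral_comp_weight _ _ _ _ _ _ R P (dirac m) X id
      (cst 1%R) (cst 1%R) phi)//.
    by apply: eq_integral => w _; rewrite /= mulr1.
  move=> B mB; rewrite !integral_EFin1//; last first.
    by rewrite -[X in measurable X]setTI; exact: mX.
  by rewrite [LHS]lawX// /normal_law v_eq0 eqxx.
rewrite integral_dirac//; first by rewrite diracE mem_set// mul1e mulr1.
by apply/measurable_EFinP; apply: measurable_funM.
Qed.

(** Completing the square moves the mean of the density from m to m + k v. Variance zero is treated
    apart because [normal_law] is then a point mass. *)
Lemma mgf_normal (k : R) :
  \int[P]_w (expR (k * X w))%:E = (expR (k * m + k ^+ 2 * v / 2))%:E.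
Proof.
have mphi : measurable_fun setT (fun x : R => expR (k * x)).
  by apply: measurableT_comp => //; apply: measurable_funM.
have [v_eq0|vn0] := eqVneq v 0%R.
  rewrite (ge0_integral_normal_law0 v_eq0 mphi) => [|x]; last exact: expR_ge0.
  by rewrite v_eq0 mulr0 mul0r addr0.
rewrite (ge0_integral_normal_law vn0 mphi) => [|x]; last exact: expR_ge0.
set s := Num.sqrt v.
have sn0 : s != 0%R by rewrite gt_eqF// sqrtr_gt0 lt_neqAle eq_sym vn0.
have sv : (s ^+ 2)%R = v by rewrite sqr_sqrtr.
transitivity (\int[lebesgue_measure]_x ((expR (k * m + k ^+ 2 * v / 2))%:E *
   (normal_pdf (m + k * v) s x)%:E)).
  apply: eq_integral => x _; rewrite -EFinM; congr (_%:E).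
  rewrite !normal_pdfE// mulrCA [RHS]mulrCA; congr (_ * _)%R.
  rewrite /normal_fun -!expRD; congr expR; rewrite sv; field.
  by [].
rewrite ge0_integralZl//.
- by rewrite integral_normal_pdf mule1.
- apply/measurable_EFinP; exact: measurable_normal_pdf.
- by move=> x _; rewrite lee_fin normal_pdf_ge0.
Qed.

(** The factor exp(q (x - m)^2) turns the density of variance v into a multiple of the one of
    variance v/(1 - 2 q v); the ratio of the normalising constants is the inverse square root. *)
Lemma mgf_sqr_normal (q : R) : (2 * q * v < 1)%R ->
  \int[P]_w (expR (q * (X w - m) ^+ 2))%:E = ((Num.sqrt (1 - 2 * q * v))^-1)%:E.
Proof.
move=> qv.
have mphi : measurable_fun setT (fun x : R => expR (q * (x - m) ^+ 2)).
  apply: measurableT_comp => //; apply: measurable_funM => //.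
  by apply: measurable_funX; apply: measurable_funB.
have [v_eq0|vn0] := eqVneq v 0%R.
  rewrite (ge0_integral_normal_law0 v_eq0 mphi) => [|x]; last exact: expR_ge0.
  by rewrite v_eq0 subrr expr0n/= !mulr0 expR0 subr0 sqrtr1 invr1.
rewrite (ge0_integral_normal_law vn0 mphi) => [|x]; last exact: expR_ge0.
set s := Num.sqrt v.
have vgt0 : (0 < v)%R by rewrite lt_neqAle eq_sym vn0.
have sn0 : s != 0%R by rewrite gt_eqF// sqrtr_gt0.
have sv : (s ^+ 2)%R = v by rewrite sqr_sqrtr.
set r := (1 - 2 * q * v)%R; have r0 : (0 < r)%R by rewrite subr_gt0.
have rn0 : Num.sqrt r != 0%R by rewrite gt_eqF// sqrtr_gt0.
pose s' := (s / Num.sqrt r)%R.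
have s'n0 : s' != 0%R by rewrite mulf_neq0// invr_eq0.
have sv' : (s' ^+ 2)%R = (v / r)%R.
  by rewrite expr_div_n sv sqr_sqrtr// ltW.
transitivity (\int[lebesgue_measure]_x ((Num.sqrt r)^-1%:E *
   (normal_pdf m s' x)%:E)).
  apply: eq_integral => x _; rewrite -EFinM; congr (_%:E).
  rewrite !normal_pdfE// mulrCA [RHS]mulrA; congr (_ * _)%R.
    rewrite /normal_peak sv sv' -invfM; congr (_^-1)%R.
    rewrite -sqrtrM ?ltW//; congr Num.sqrt.
    by rewrite -[(_ *+ 2)%R]mulr_natr -[in RHS]mulr_natr; field; rewrite gt_eqF.
  rewrite /normal_fun -!expRD; congr expR; rewrite sv sv' /r; field.
  by rewrite vn0 gt_eqF.
rewrite ge0_integralZl//.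
- by rewrite integral_normal_pdf mule1.
- apply/measurable_EFinP; exact: measurable_normal_pdf.
- by move=> x _; rewrite lee_fin normal_pdf_ge0.
Qed.

Lemma integrable_expR_normal (k : R) :
  P.-integrable setT (fun w => (expR (k * (X w - m)))%:E).
Proof.
have mf : measurable_fun setT (fun w => expR (k * (X w - m))).
  by apply: measurableT_comp => //; apply: measurable_funM => //;
    apply: measurable_funB.
apply/integrableP; split; first exact/measurable_EFinP.
under eq_integral do rewrite gee0_abs ?lee_fin ?expR_ge0//.
under eq_integral do rewrite mulrBr expRD EFinM.
rewrite ge0_integralZr//.
- by rewrite mgf_normal -EFinM ltry.
- apply/measurable_EFinP; apply: measurableT_comp => //.
  exact: measurable_funM.
Qed.

Lemma integrable_expR_sqr_normal (q : R) : (2 * q * v < 1)%R ->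
  P.-integrable setT (fun w => (expR (q * (X w - m) ^+ 2))%:E).
Proof.
move=> qv; have mf : measurable_fun setT (fun w => expR (q * (X w - m) ^+ 2)).
  apply: measurableT_comp => //; apply: measurable_funM => //.
  by apply: measurable_funX; apply: measurable_funB.
apply/integrableP; split; first exact/measurable_EFinP.
under eq_integral do rewrite gee0_abs ?lee_fin ?expR_ge0//.
by rewrite mgf_sqr_normal// ltry.
Qed.

Lemma integrable_sqr_normal :
  P.-integrable setT (fun w => ((X w - m) ^+ 2)%:E).
Proof.
(* Any such q gives a domination, by y <= exp y at y = q (X - m)^2. *)
have [q q0 qv] : exists2 q : R, (0 < q)%R & (2 * q * v < 1)%R.
  have w0 : (0 < 4 * (v + 1))%R by have v0' := v0; lra.
  exists ((4 * (v + 1))^-1)%R; first by rewrite invr_gt0.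
  rewrite mulrAC ltr_pdivrMr//; have v0' := v0; lra.
apply: (@le_integrable _ _ _ _ _ measurableT _
    (fun w => q^-1%:E * (expR (q * (X w - m) ^+ 2))%:E)).
- apply/measurable_EFinP; apply: measurable_funX; exact: measurable_funB.
- move=> w _ /=; rewrite lee_fin !ger0_norm ?sqr_ge0 ?mulr_ge0 ?invr_ge0 ?expR_ge0 ?(ltW q0)//.
  rewrite ler_pdivlMl//; apply: le_trans (expR_ge1Dx _).
  by rewrite lerDr.
- by apply: integrableZl => //; exact: integrable_expR_sqr_normal.
Qed.

Lemma normal_Lfun2_centered : (fun w => X w - m)%R \in Lfun P 2%:E.
Proof.
have mf : measurable_fun setT (fun w => X w - m)%R by apply: measurable_funB.
rewrite inE; apply/andP; split; rewrite inE//=.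
rewrite /finite_norm unlock /Lnorm.
rewrite poweR_lty//.
have /integrableP[_] := integrable_sqr_normal.
congr (_ < _); apply: eq_integral => w _.
by rewrite gee0_abs ?lee_fin ?sqr_ge0//= powR_mulrn// real_normK ?num_real.
Qed.

Lemma normal_Lfun2 : X \in Lfun P 2%:E.
Proof.
rewrite (_ : X = ((fun w => X w - m) + cst m)%R); last first.
  by apply/funext => w; rewrite /= -[RHS]/(X w - m + m)%R subrK.
by apply: rpredD => [|?|?]; [rewrite lee1n | exact: normal_Lfun2_centered | exact: Lfun_cst].
Qed.

(** Integrating 1 + k Y <= exp(k Y), with Y centred, puts a line of slope E Y below the Laplace
    transform for every k; no integral of x against the density is computed. *)
Lemma normal_expectation_centered : 'E_P[(fun w => X w - m)%R] = 0.
Proof.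
have L1 := Lfun_subset12 (fin_num_measure P _ measurableT) normal_Lfun2_centered.
have i1 : P.-integrable setT (EFin \o (fun w => X w - m)%R).
  exact/Lfun1_integrable.
have Ef := expectation_fin_num L1.
set e := fine 'E_P[(fun w => X w - m)%R].
have Ee : 'E_P[(fun w => X w - m)%R] = e%:E by rewrite fineK.
have H (k : R) : (1 + k * e <= expR (k ^+ 2 * v / 2))%R.
  rewrite -lee_fin.
  have -> : (1 + k * e)%:E = \int[P]_w (1 + k * (X w - m))%:E.
    under eq_integral do rewrite EFinD.
    rewrite integralD//=; last 2 first.
    - exact: finite_measure_integrable_cst.
    - by under eq_fun do rewrite EFinM; exact: integrableZl.
    under [X in _ + X]eq_integral do rewrite EFinM.
    rewrite integralZl// integral_cst//= probability_setT mule1 EFinD EFinM -Ee.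
    by rewrite [in LHS]unlock.
  have -> : (expR (k ^+ 2 * v / 2))%:E = \int[P]_w (expR (k * (X w - m)))%:E.
    under eq_integral do rewrite mulrBr expRD EFinM.
    rewrite ge0_integralZr//.
    - by rewrite mgf_normal -EFinM -expRD; congr ((expR _)%:E); lra.
    - apply/measurable_EFinP; apply: measurableT_comp => //.
      exact: measurable_funM.
  apply: le_integral => //.
  - under eq_fun do rewrite EFinD; apply: integrableD => //.
      exact: finite_measure_integrable_cst.
    by under eq_fun do rewrite EFinM; exact: integrableZl.
  - exact: integrable_expR_normal.
  - by move=> w _; rewrite lee_fin expR_ge1Dx.
by rewrite Ee (expR_quadratic_slope v0 H).
Qed.

(** The same tangent argument for exp(q Y^2): E Y^2 must be the slope of (1 - 2 q v)^(-1/2) at q =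
    0, which is v. *)
Lemma normal_variance : 'V_P[X] = v%:E.
Proof.
rewrite (_ : X = ((fun w => X w - m) \+ cst m)%R); last first.
  by apply/funext => w; rewrite /= subrK.
rewrite varianceD_cst_r ?normal_Lfun2_centered//.
rewrite varianceE ?normal_Lfun2_centered// normal_expectation_centered.
rewrite expe2 mule0 sube0.
have isq := integrable_sqr_normal.
have Qf : \int[P]_w ((X w - m) ^+ 2)%:E \is a fin_num.
  exact: integrable_fin_num.
set Q := fine (\int[P]_w ((X w - m) ^+ 2)%:E).
have QE : \int[P]_w ((X w - m) ^+ 2)%:E = Q%:E by rewrite fineK.
have Q0 : (0 <= Q)%R.
  by apply: fine_ge0; apply: integral_ge0 => w _; rewrite lee_fin sqr_ge0.
suff QV : Q = v.
  by rewrite unlock -QV -QE; apply: eq_integral => w _.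
apply: inv_sqrt_slope => // q qv; rewrite -lee_fin -mgf_sqr_normal//.
have -> : (1 + q * Q)%:E = \int[P]_w (1 + q * (X w - m) ^+ 2)%:E.
  under eq_integral do rewrite EFinD.
  rewrite integralD//=; last 2 first.
  - exact: finite_measure_integrable_cst.
  - by under eq_fun do rewrite EFinM; exact: integrableZl.
  under [X in _ + X]eq_integral do rewrite EFinM.
  by rewrite integralZl// integral_cst//= probability_setT mule1 EFinD EFinM -QE.
apply: le_integral => //.
- under eq_fun do rewrite EFinD; apply: integrableD => //.
    exact: finite_measure_integrable_cst.
  by under eq_fun do rewrite EFinM; exact: integrableZl.
- exact: integrable_expR_sqr_normal.
- by move=> w _; rewrite lee_fin expR_ge1Dx.
Qed.

End normal_moments.

(** * Independence *)

Section independent_products.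
Local Open Scope ereal_scope.
Context d (T : measurableType d) (R : realType) (P : probability T R).

Lemma measurable_fun_bigprod (J : Type) (s : seq J) (f : J -> T -> R) :
  (forall j, measurable_fun setT (f j)) ->
  measurable_fun setT (fun w => \prod_(j <- s) f j w)%R.
Proof.
move=> mf; elim: s => [|j s IH]; [under eq_fun do rewrite big_nil|].
  exact: measurable_cst.
by under eq_fun do rewrite big_cons; exact: measurable_funM.
Qed.

Lemma measurable_preimage_rv (X : T -> R) (B : set R) :
  measurable_fun setT X -> measurable B -> measurable (X @^-1` B).
Proof. by move=> mX mB; rewrite -[X in measurable X]setTI; exact: mX. Qed.

Lemma integral_EFin_cst (c : R) (A : set T) : measurable A ->
  \int[P]_(w in A) (cst c w : R)%:E = c%:E * P A.
Proof. by move=> mA; rewrite /cst/= (integral_cst _ mA). Qed.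

(** The hypothesis says that [f] has conditional expectation [c] given [X], tested on events; it
    extends to nonnegative functions of [X]. *)
Lemma integral_comp_weight_cst (X f : T -> R) (c : R) (phi : R -> R) :
  measurable_fun setT X -> measurable_fun setT f ->
  (forall w, 0 <= f w)%R -> (0 <= c)%R ->
  measurable_fun setT phi -> (forall x, 0 <= phi x)%R ->
  (forall B, measurable B ->
    \int[P]_(w in X @^-1` B) (f w)%:E = c%:E * P (X @^-1` B)) ->
  \int[P]_w (phi (X w) * f w)%:E = c%:E * \int[P]_w (phi (X w))%:E.
Proof.
move=> mX mf f0 c0 mphi phi0 H.
rewrite (@ge0_integral_comp_weight _ _ _ _ _ _ R P P X X f (cst c) phi)//.
- rewrite -ge0_integralZl//.
  + by apply: eq_integral => w _; rewrite /= mulrC EFinM.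
  + by apply/measurable_EFinP; exact: measurableT_comp.
- by move=> w _; rewrite lee_fin.
- move=> B mB; rewrite H// integral_EFin_cst//.
  exact: measurable_preimage_rv.
Qed.

(** Two one-sided extensions from indicators: a function of [X] against the weight psi(Y), whose
    hypothesis is in turn a function of [Y] against the indicator of an event of [X]. *)
Lemma independent_integralM (X Y : T -> R) (phi psi : R -> R) (a b : R) :
  measurable_fun setT X -> measurable_fun setT Y ->
  measurable_fun setT phi -> (forall x, 0 <= phi x)%R ->
  measurable_fun setT psi -> (forall x, 0 <= psi x)%R ->
  (forall A B, measurable A -> measurable B ->
    P (X @^-1` A `&` Y @^-1` B) = P (X @^-1` A) * P (Y @^-1` B)) ->
  \int[P]_w (phi (X w))%:E = a%:E -> \int[P]_w (psi (Y w))%:E = b%:E ->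
  \int[P]_w (phi (X w) * psi (Y w))%:E = (a * b)%:E.
Proof.
move=> mX mY mphi phi0 mpsi psi0 ind Ea Eb.
have b0 : (0 <= b)%R.
  by rewrite -lee_fin -Eb; apply: integral_ge0 => w _; rewrite lee_fin.
rewrite (@integral_comp_weight_cst X (psi \o Y) b phi)//.
- by rewrite Ea -EFinM mulrC.
- exact: measurableT_comp.
- by move=> w; exact: psi0.
move=> A mA; have mXA := measurable_preimage_rv mX mA.
rewrite integral_mkcond.
transitivity (\int[P]_w (psi (Y w) * \1_(X @^-1` A) w)%:E).
  apply: eq_integral => w _; rewrite patchE indicE; case: ifPn => _ /=.
    by rewrite mulr1.
  by rewrite mulr0.
have PA : P (X @^-1` A) = (fine (P (X @^-1` A)))%:E.
  by rewrite fineK// fin_num_measure.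
rewrite (@integral_comp_weight_cst Y _ (fine (P (X @^-1` A))) psi)//.
- by rewrite Eb -PA muleC.
- by rewrite fine_ge0.
- move=> B mB; rewrite -PA -ind// integral_indic//.
  exact: measurable_preimage_rv.
Qed.

Variables (I : finType) (Z : I -> T -> R) (e : I -> R).
Hypothesis mZ : forall i, measurable_fun setT (Z i).
Hypothesis Z0 : forall i w, (0 <= Z i w)%R.
Hypothesis EZ : forall i, \int[P]_w (Z i w)%:E = (e i)%:E.
Hypothesis indZ : forall (J : {set I}) (B : I -> set R),
  (forall i, measurable (B i)) ->
  P (\bigcap_(i in [set` J]) (Z i @^-1` B i)) = \prod_(i in J) P (Z i @^-1` B i).

(** The event on the variables in [J] is what makes the induction on [L] work: to take the factor
    Z_i out, its value is constrained to a set, which moves [i] from [L] to [J]. *)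
Lemma independent_integral_prod_cond (L : seq I) (J : {set I}) (B : I -> set R) :
  uniq L -> (forall i, i \in L -> i \notin J) -> (forall i, measurable (B i)) ->
  \int[P]_(w in \bigcap_(i in [set` J]) (Z i @^-1` B i)) (\prod_(i <- L) Z i w)%:E =
  (\prod_(i <- L) e i)%:E * \prod_(i in J) P (Z i @^-1` B i).
Proof.
have mcap (J' : {set I}) (B' : I -> set R) : (forall i, measurable (B' i)) ->
    measurable (\bigcap_(i in [set` J']) (Z i @^-1` B' i)).
  move=> mB'; apply: fin_bigcap_measurable => [|i _]; first exact: finite_finset.
  exact: measurable_preimage_rv.
elim: L J B => [|i L IH] J B /= uL dis mB.
  under eq_integral do rewrite big_nil.
  by rewrite (integral_EFin_cst 1%R (mcap J B mB)) indZ// big_nil.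
move: uL => /andP[iL uL].
set A := \bigcap_(i in _) _; have mA : measurable A by exact: mcap.
have e0 j : (0 <= e j)%R.
  by rewrite -lee_fin -EZ; apply: integral_ge0 => w _; rewrite lee_fin.
pose c := fine ((\prod_(i <- L) e i)%:E * \prod_(i in J) P (Z i @^-1` B i)).
have PA : P A = \prod_(i in J) P (Z i @^-1` B i) by exact: indZ.
have cE : c%:E = (\prod_(i <- L) e i)%:E * \prod_(i in J) P (Z i @^-1` B i).
  by rewrite fineK// -PA fin_numM// fin_num_measure.
rewrite integral_mkcond.
(* The absolute value makes the function applied to Z_i nonnegative on all of R, as the weighted
   transfer demands. *)
transitivity (\int[P]_w (`|Z i w| * ((\prod_(j <- L) Z j w) * \1_A w))%:E).
  apply: eq_integral => w _; rewrite patchE indicE; case: ifPn => _ /=.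
    by rewrite mulr1 big_cons ger0_norm.
  by rewrite !mulr0.
rewrite (@integral_comp_weight_cst (Z i) _ c (fun x : R => `|x|%R))//.
- under eq_integral do rewrite ger0_norm//.
  by rewrite cE EZ big_cons EFinM muleC muleA.
- apply: measurable_funM => //.
  exact: measurable_fun_bigprod.
- by move=> w; rewrite mulr_ge0//; apply: prodr_ge0 => j _.
- by rewrite fine_ge0// mule_ge0// -?PA// lee_fin; apply: prodr_ge0.
move=> B' mB'.
pose B1 j := if j == i then B' else B j.
have mB1 j : measurable (B1 j) by rewrite /B1; case: ifP.
have iJ : i \notin J by apply: dis; rewrite inE eqxx.
have capE : \bigcap_(j in [set` (i |: J)%SET]) (Z j @^-1` B1 j) =
    (Z i @^-1` B') `&` A.
  rewrite /A; apply/seteqP; split=> w /= H.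
    split=> [|j jJ].
      by have := H i; rewrite /= /B1 eqxx; apply; rewrite /= !inE eqxx.
    have := H j; rewrite /= /B1; case: eqP => [ji|_].
      by move: iJ; rewrite -ji jJ.
    by apply; rewrite /= !inE jJ orbT.
  move=> j /=; rewrite !inE /B1; case: eqP => [->|_ /= jJ]; first by case: H.
  by case: H => _; exact.
transitivity (\int[P]_(w in \bigcap_(j in [set` (i |: J)%SET]) (Z j @^-1` B1 j))
    (\prod_(j <- L) Z j w)%:E).
  rewrite capE integral_mkcondr; apply: eq_integral => w _.
  by rewrite patchE indicE; case: ifPn => _ /=; rewrite ?mulr1 ?mulr0.
rewrite IH//.
- rewrite cE -muleA; congr (_ * _); rewrite big_setU1//= muleC.
  congr (_ * _); last by rewrite /B1 eqxx.
  apply: eq_bigr => j jJ; rewrite /B1; case: eqP => // ji.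
  by move: iJ; rewrite -ji jJ.
- move=> j jL; rewrite !inE negb_or dis ?inE ?jL ?orbT// andbT.
  by apply: contraNneq iL => <-.
Qed.

Lemma independent_integral_prod :
  \int[P]_w (\prod_i Z i w)%:E = (\prod_i e i)%:E.
Proof.
have := @independent_integral_prod_cond (index_enum I) finset.set0 (fun=> setT).
rewrite big_set0 mule1 => <-//.
- congr (integral _ _ _); apply/seteqP; split=> w // _ i.
- exact: index_enum_uniq.
- by move=> i _; rewrite inE.
Qed.

End independent_products.

(** * Gaussian and chi-square tails *)

(** After squaring and bounding exp y below by 1 + y, it remains that (1 + z + 2 z^2)(1 - z) = 1 +
    z^2 (1 - 2 z) is at least 1. *)
Lemma inv_sqrt_le_expR (R : realType) (z : R) : z <= 1 / 2 ->
  (Num.sqrt (1 - z))^-1 <= expR (z / 2 + z ^+ 2).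
Proof.
move=> z2; have r0 : 0 < 1 - z by lra.
have s0 : 0 < Num.sqrt (1 - z) by rewrite sqrtr_gt0.
rewrite -[_^-1]div1r ler_pdivrMr// -[1 in leLHS]sqrtr1.
rewrite -[expR _]ger0_norm ?expR_ge0// -sqrtr_sqr -sqrtrM ?sqr_ge0//.
apply: ler_wsqrtr; rewrite -expRM_natr.
have h := expR_ge1Dx ((z / 2 + z ^+ 2) * 2).
apply: (@le_trans _ _ ((1 + (z / 2 + z ^+ 2) * 2) * (1 - z))).
  have : 0 <= z ^+ 2 * (1 - 2 * z) by rewrite mulr_ge0 ?sqr_ge0//; lra.
  by move=> h2; rewrite -subr_ge0; apply: le_trans h2 _; rewrite le_eqVlt; apply/orP; left; apply/eqP; field.
by rewrite ler_pM2r.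
Qed.

Section tail_bounds.
Local Open Scope ereal_scope.
Context d (T : measurableType d) (R : realType) (P : probability T R).

Lemma probability_le_integral (A : set T) (f : T -> R) :
  measurable A -> measurable_fun setT f -> (forall w, 0 <= f w)%R ->
  (forall w, A w -> 1 <= f w)%R -> P A <= \int[P]_w (f w)%:E.
Proof.
move=> mA mf f0 f1; rewrite -[A]setIT -(integral_indic _ _ mA)//.
apply: ge0_le_integral => //.
- exact/measurable_EFinP.
- exact/measurable_EFinP.
- move=> w _; rewrite lee_fin indicE; case: (boolP (w \in A)) => // wA.
  by rewrite f1//; exact: set_mem.
Qed.

(** Markov's inequality for exp((X - m)^2/4), whose mean is sqrt 2. *)
Lemma normal_tail (X : T -> R) (m u : R) : measurable_fun setT X ->
  (forall B, measurable B -> P (X @^-1` B) = normal_law m 1%R B) ->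
  (0 <= u)%R ->
  P [set w | (u < `|X w - m|)%R] <= (2 * expR (- (u ^+ 2 / 4)))%:E.
Proof.
move=> mX lawX u0.
have mXm : measurable_fun setT (fun w => X w - m)%R by exact: measurable_funB.
pose f w := (expR (- (u ^+ 2 / 4)) * expR (4^-1 * (X w - m) ^+ 2))%R.
have mf : measurable_fun setT f.
  apply: measurable_funM => //; apply: measurableT_comp => //.
  by apply: measurable_funM => //; exact: measurable_funX.
apply: (@le_trans _ _ (\int[P]_w (f w)%:E)).
  apply: probability_le_integral => //.
  - rewrite (_ : mkset _ = (fun w => `|X w - m|)%R @^-1` `]u, +oo[%classic).
      apply: measurable_preimage_rv; last exact: measurable_itv.
      exact: (measurableT_comp (@normr_measurable R setT) mXm).
    by apply/seteqP; split=> w /=; rewrite in_itv/= andbT.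
  - by move=> w; rewrite mulr_ge0 ?expR_ge0.
  - move=> w /= uw; rewrite /f -expRD -[leLHS]expR0 ler_expR.
    have : (u ^+ 2 <= (X w - m) ^+ 2)%R.
      rewrite -[leRHS]real_normK ?num_real//.
      by apply: lerXn2r; rewrite ?nnegrE//; exact: ltW.
    lra.
rewrite /f; under eq_integral do rewrite EFinM.
rewrite ge0_integralZl//; last first.
  apply/measurable_EFinP; apply: measurableT_comp => //.
  by apply: measurable_funM => //; exact: measurable_funX.
rewrite (mgf_sqr_normal mX ler01 lawX); last by lra.
rewrite -EFinM lee_fin mulrC ler_wpM2r ?expR_ge0//.
have -> : (1 - 2 * 4^-1 * 1 = 2^-1 :> R)%R by field.
rewrite sqrtrV// invrK -[leRHS]ger0_norm// -sqrtr_sqr.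
by apply: ler_wsqrtr; lra.
Qed.

Context (I : finType) (X : I -> T -> R) (m v : R).
Hypothesis mX : forall i, measurable_fun setT (X i).
Hypothesis v0 : (0 <= v)%R.
Hypothesis lawX : forall i B, measurable B ->
  P (X i @^-1` B) = normal_law m v B.
Hypothesis indX : forall (J : {set I}) (B : I -> set R),
  (forall i, measurable (B i)) ->
  P (\bigcap_(i in [set` J]) (X i @^-1` B i)) = \prod_(i in J) P (X i @^-1` B i).

(** Subtracting v cancels the first-order term: each factor exp(-q v) (1 - 2 q v)^(-1/2) is at most
    exp((2 q v)^2). *)
Lemma chi2_mgf (q : R) : (2 * q * v <= 1 / 2)%R ->
  \int[P]_w (expR (q * \sum_i ((X i w - m) ^+ 2 - v)))%:E <=
  (expR (4 * (q * v) ^+ 2 * #|I|%:R))%:E.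
Proof.
move=> qv.
pose g x : R := expR (q * (x - m) ^+ 2 - q * v)%R.
have mg : measurable_fun setT g.
  apply: measurableT_comp => //; apply: measurable_funB => //.
  apply: measurable_funM => //; apply: measurable_funX.
  exact: measurable_funB.
pose e : R := (expR (- (q * v)) * (Num.sqrt (1 - 2 * q * v))^-1)%R.
have -> : \int[P]_w (expR (q * \sum_i ((X i w - m) ^+ 2 - v)))%:E =
    \int[P]_w (\prod_i g (X i w))%:E.
  apply: eq_integral => w _; congr (_%:E).
  by rewrite -expR_sum mulr_sumr; congr expR; apply: eq_bigr => i _;
    rewrite mulrBr.
have -> : \int[P]_w (\prod_i g (X i w))%:E = (\prod_(i : I) e)%:E.
  apply: independent_integral_prod.
  - by move=> i; exact: measurableT_comp.
  - by move=> i w; exact: expR_ge0.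
  - move=> i; rewrite /g; under eq_integral do rewrite addrC expRD EFinM.
    rewrite ge0_integralZl//; last first.
      apply/measurable_EFinP; apply: measurableT_comp => //.
      apply: measurable_funM => //; apply: measurable_funX.
      exact: measurable_funB.
    rewrite (mgf_sqr_normal (mX i) v0 (lawX i)) ?EFinM//; lra.
  - move=> J B mB.
    have := @indX J (fun i => g @^-1` B i); apply.
    by move=> i; exact: measurable_preimage_rv.
rewrite lee_fin prodr_const expRM_natr.
apply: lerXn2r; rewrite ?nnegrE ?expR_ge0 ?mulr_ge0 ?invr_ge0 ?sqrtr_ge0 ?expR_ge0//.
apply: (@le_trans _ _ (expR (- (q * v)) *
    expR ((2 * q * v) / 2 + (2 * q * v) ^+ 2))%R).
  by rewrite ler_wpM2l ?expR_ge0// inv_sqrt_le_expR.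
by rewrite -expRD ler_expR; lra.
Qed.

(** The sign of [q] is free, so the lower tail is the same bound at -q. *)
Lemma chi2_tail_onesided (q y : R) : (2 * q * v <= 1 / 2)%R ->
  P [set w | (y <= q * \sum_i ((X i w - m) ^+ 2 - v))%R] <=
  (expR (- y + 4 * (q * v) ^+ 2 * #|I|%:R))%:E.
Proof.
move=> qv; pose S w : R := (q * \sum_i ((X i w - m) ^+ 2 - v))%R.
have mS : measurable_fun setT S.
  apply: measurable_funM => //; apply: measurable_sum => i.
  by apply: measurable_funB => //; apply: measurable_funX; exact: measurable_funB.
apply: (@le_trans _ _ (\int[P]_w (expR (- y) * expR (S w))%:E)).
  apply: (@probability_le_integral _ (fun w => expR (- y) * expR (S w))%R).
  - rewrite (_ : mkset _ = S @^-1` `[y, +oo[%classic).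
      exact: measurable_preimage_rv.
    by apply/seteqP; split=> w /=; rewrite in_itv/= andbT.
  - by apply: measurable_funM => //; exact: measurableT_comp.
  - by move=> w; rewrite mulr_ge0 ?expR_ge0.
  - by move=> w /= yw; rewrite -expRD -[leLHS]expR0 ler_expR addrC subr_ge0.
under eq_integral do rewrite EFinM.
rewrite ge0_integralZl//; last first.
  by apply/measurable_EFinP; exact: measurableT_comp.
by rewrite expRD EFinM lee_wpmul2l ?lee_fin ?expR_ge0//; exact: chi2_mgf.
Qed.

Lemma chi2_tail (q y : R) : (0 < q)%R -> (2 * q * v <= 1 / 2)%R ->
  P [set w | (y < `|\sum_i ((X i w - m) ^+ 2 - v)|)%R] <=
  (2 * expR (- (q * y) + 4 * (q * v) ^+ 2 * #|I|%:R))%:E.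
Proof.
move=> q0 qv; pose S w : R := (\sum_i ((X i w - m) ^+ 2 - v))%R.
have mS : measurable_fun setT S.
  apply: measurable_sum => i.
  by apply: measurable_funB => //; apply: measurable_funX; exact: measurable_funB.
have mA a : measurable [set w | (q * y <= a * S w)%R].
  rewrite (_ : mkset _ = (fun w => a * S w)%R @^-1` `[(q * y)%R, +oo[%classic).
    by apply: measurable_preimage_rv => //; exact: measurable_funM.
  by apply/seteqP; split=> w /=; rewrite in_itv/= andbT.
apply: (@le_trans _ _ (P ([set w | (q * y <= q * S w)%R] `|`
    [set w | (q * y <= (- q) * S w)%R]))).
  apply: le_measure; rewrite ?inE.
  - rewrite (_ : mkset _ = (fun w => `|S w|)%R @^-1` `]y, +oo[%classic).
      apply: measurable_preimage_rv; last exact: measurable_itv.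
      exact: (measurableT_comp (@normr_measurable R setT) mS).
    by apply/seteqP; split=> w /=; rewrite in_itv/= andbT.
  - exact: measurableU.
  - move=> w /=; rewrite -/(S w) => yS; rewrite mulNr -mulrN !ler_pM2l//.
    have [S0|S0] := leP 0%R (S w).
      by left; move: yS; rewrite ger0_norm// => /ltW.
    by right; move: yS; rewrite ltr0_norm// => /ltW.
apply: (le_trans (measureU2 _ _ _)) => //.
rewrite mulrDl mul1r EFinD; apply: leeD.
  exact: chi2_tail_onesided.
have := @chi2_tail_onesided (- q) (q * y); rewrite mulNr sqrrN; apply.
have : (0 <= q * v)%R by rewrite mulr_ge0// ltW.
by rewrite mulrN mulNr -mulrA; have v0' := v0; nra.
Qed.

End tail_bounds.

(** * Multivariate normal vectors and the precision matrix *)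

Section quadratic_form.
Context (R : realType) (K : nat) (Sigma : 'M[R]_K).
Hypothesis symS : Sigma^T = Sigma.
Implicit Types u v : 'cV[R]_K.

(** The covariance of the linear combinations with coefficients [u] and [v] when [Sigma] is the
    covariance matrix. *)
Definition bform u v : R := (u^T *m Sigma *m v) 0 0.

Lemma bformC u v : bform u v = bform v u.
Proof.
rewrite /bform -[RHS]/((v^T *m Sigma *m u) 0 0).
by rewrite -[u^T *m Sigma *m v]trmxK mxE !trmx_mul trmxK symS mulmxA.
Qed.

Lemma bformDl u1 u2 v : bform (u1 + u2) v = bform u1 v + bform u2 v.
Proof. by rewrite /bform linearD/= !mulmxDl mxE. Qed.

Lemma bformDr u v1 v2 : bform u (v1 + v2) = bform u v1 + bform u v2.
Proof. by rewrite /bform mulmxDr mxE. Qed.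

Lemma bformNr u v : bform u (- v) = - bform u v.
Proof. by rewrite /bform mulmxN mxE. Qed.

Lemma bform_delta_r u k : bform u (delta_mx k 0) = (Sigma *m u) k 0.
Proof.
rewrite bformC /bform trmx_delta -mulmxA.
by rewrite -rowE mxE.
Qed.

Lemma bformE u v : bform u v = \sum_k (Sigma *m u) k 0 * v k 0.
Proof.
by rewrite bformC /bform -mulmxA mxE; apply: eq_bigr => k _; rewrite mxE mulrC.
Qed.

Hypothesis posS : forall u, 0 <= bform u u.
Hypothesis unitS : Sigma \in unitmx.
Let D := invmx Sigma.

Lemma invmx_symE a b : D a b = D b a.
Proof.
have DT : D^T = D by rewrite /D trmx_inv symS.
by rewrite -[in LHS]DT mxE.
Qed.

(** The conditional variance 1/D_aa cannot exceed the variance 1: nonnegativity of the form at D e_a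
    - e_a reads D_aa - 2 + 1 >= 0. *)
Lemma invmx_diag_ge1 a : Sigma a a = 1 -> 1 <= D a a.
Proof.
move=> Saa; pose x : 'cV[R]_K := delta_mx a 0; pose y := D *m x.
have Sy : Sigma *m y = x by rewrite /y /D mulKVmx.
have yx : bform y x = 1 by rewrite bform_delta_r Sy mxE !eqxx.
have xx : bform x x = 1 by rewrite bform_delta_r /x -colE mxE.
have yy : bform y y = D a a.
  rewrite bformE Sy (bigD1 a)//= big1 => [|k ka].
    by rewrite addr0 [x a 0]mxE !eqxx mul1r /y /x -colE mxE.
  by rewrite mxE (negbTE ka) mul0r.
have := posS (y - x).
rewrite bformDr bformNr bformDl [X in _ - X]bformDl.
rewrite [bform (- x) y]bformC bformNr [bform (- x) x]bformC bformNr.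
by rewrite yy yx xx; lra.
Qed.

Section two_coordinates.
Variables (a b : 'I_K) (u : 'cV[R]_K).
Hypothesis ab : a != b.
Hypothesis Su : forall c, c != a -> c != b -> (Sigma *m u) c 0 = 0.

Lemma bform_two v :
  bform u v = (Sigma *m u) a 0 * v a 0 + (Sigma *m u) b 0 * v b 0.
Proof.
rewrite bformE (bigD1 a)//= (bigD1 b) 1?eq_sym//= big1 ?addr0// => c.
by move=> /andP[ca cb]; rewrite Su// mul0r.
Qed.

Lemma invmx_two k : u k 0 = D k a * (Sigma *m u) a 0 + D k b * (Sigma *m u) b 0.
Proof.
rewrite -[in LHS](mulKmx unitS u) mxE (bigD1 a)//= (bigD1 b) 1?eq_sym//=.
rewrite big1 ?addr0// => c /andP[ca cb]; by rewrite Su// mulr0.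
Qed.
End two_coordinates.

(** [u] and [w] are the coefficient vectors of the two regression residuals. Their images under
    [Sigma] live on {a, b}, so reading u = D (Sigma u) at a and b gives a 2 x 2 system: the
    covariance matrix of the residuals is the inverse of the {a, b} block of D. The squared,
    multiplied form avoids square roots and the sign of the partial correlation. *)
Lemma bform_partial_corr a b (u w : 'cV[R]_K) (r : R) : a != b ->
  0 < D a a -> 0 < D b b ->
  (forall c, c != a -> c != b -> (Sigma *m u) c 0 = 0) ->
  (forall c, c != a -> c != b -> (Sigma *m w) c 0 = 0) ->
  u a 0 = 1 -> u b 0 = 0 -> w a 0 = 0 -> w b 0 = 1 ->
  r = bform u w / (Num.sqrt (bform u u) * Num.sqrt (bform w w)) ->
  r ^+ 2 * (D a a * D b b) = D a b ^+ 2.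
Proof.
move=> ab Da Db Su Sw ua ub wa wb rE.
set al := (Sigma *m u) a 0; set be := (Sigma *m u) b 0.
set al' := (Sigma *m w) a 0; set be' := (Sigma *m w) b 0.
have e1 := invmx_two ab Su a; have e2 := invmx_two ab Su b.
have e3 := invmx_two ab Sw a; have e4 := invmx_two ab Sw b.
rewrite -/al -/be ua in e1; rewrite -/al -/be ub (invmx_symE b a) in e2.
rewrite -/al' -/be' wa in e3; rewrite -/al' -/be' wb (invmx_symE b a) in e4.
have uu : bform u u = al by rewrite (bform_two ab Su) ua ub mulr1 mulr0 addr0.
have ww : bform w w = be' by rewrite (bform_two ab Sw) wa wb mulr1 mulr0 add0r.
have uw : bform u w = be by rewrite (bform_two ab Su) wa wb mulr1 mulr0 add0r.
have al0 : 0 <= al by rewrite -uu.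
have be0 : 0 <= be' by rewrite -ww.
set x := D a a in Da e1 e2 e3 e4 *; set y := D b b in Db e2 e3 e4 *.
set z := D a b in e1 e2 e3 e4 *.
(* Cramer's rule without dividing by the determinant [De]; as al De = D_bb and be' De = D_aa are
   positive, neither residual variance vanishes. *)
pose De := x * y - z ^+ 2.
have alD : al * De = y.
  transitivity (y * (x * al + z * be) - z * (z * al + y * be)); last first.
    by rewrite -e1 -e2; ring.
  by rewrite /De; ring.
have beD : be * De = - z.
  transitivity (x * (z * al + y * be) - z * (x * al + z * be)); last first.
    by rewrite -e1 -e2; ring.
  by rewrite /De; ring.
have be'D : be' * De = x.
  transitivity (x * (z * al' + y * be') - z * (x * al' + z * be')); last first.
    by rewrite -e3 -e4; ring.
  by rewrite /De; ring.
have aln0 : al != 0 by apply/eqP => h; move: alD Db; rewrite h mul0r => <-; rewrite ltxx.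
have be'n0 : be' != 0 by apply/eqP => h; move: be'D Da; rewrite h mul0r => <-; rewrite ltxx.
rewrite rE uu ww uw expr_div_n exprMn !sqr_sqrtr//.
rewrite -be'D -alD -[z ^+ 2]sqrrN -beD; field.
by rewrite aln0 be'n0.
Qed.

(** [Sigma] maps e_a - th to a multiple of e_a, so e_a - th is a multiple of column a of D; its
    entry 1 at a fixes the factor 1/D_aa. *)
Lemma bform_regression a (th : 'cV[R]_K) b : D a a != 0 -> th a 0 = 0 ->
  (forall c, c != a -> (Sigma *m (delta_mx a 0 - th)) c 0 = 0) ->
  b != a -> th b 0 = - (D a b / D a a).
Proof.
move=> Da tha H ba; set u := delta_mx a 0 - th in H *.
have e k : u k 0 = D k a * (Sigma *m u) a 0.
  rewrite -[in LHS](mulKmx unitS u) mxE (bigD1 a)//= big1 ?addr0// => c ca.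
  by rewrite H// mulr0.
have ua := e a; have ub := e b.
rewrite [LHS]mxE mxE !eqxx mxE tha subr0 in ua.
rewrite [LHS]mxE mxE (negbTE ba) mxE sub0r (invmx_symE b a) in ub.
have -> : th b 0 = - (D a b * (Sigma *m u) a 0) by rewrite -ub opprK.
congr (- (_ * _)); apply: (mulfI Da); rewrite mulfV//.
Qed.

End quadratic_form.

(** * Moments and partial correlations of a multivariate normal vector *)

Section multinormal.
Context d (T : measurableType d) (R : realType) (P : probability T R).
Context (K : nat) (X : T -> 'cV[R]_K) (mu : 'cV[R]_K) (Sigma : 'M[R]_K).
Hypothesis mX : forall k, measurable_fun setT (fun w => X w k 0).
Hypothesis normalX : is_multinormal P X mu Sigma.
Local Notation bf := (bform Sigma).

Definition lin_comb (u : 'cV[R]_K) (w : T) : R := (u^T *m X w) 0 0.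

Lemma lin_combE u w : lin_comb u w = \sum_k u k 0 * X w k 0.
Proof. by rewrite /lin_comb mxE; apply: eq_bigr => k _; rewrite mxE. Qed.

Lemma lin_combD u v : lin_comb (u + v) = (lin_comb u \+ lin_comb v)%R.
Proof. by apply/funext => w; rewrite /lin_comb linearD/= mulmxDl mxE. Qed.

Lemma lin_comb_delta k : lin_comb (delta_mx k 0) = (fun w => X w k 0).
Proof. by apply/funext => w; rewrite /lin_comb trmx_delta -rowE mxE. Qed.

Lemma measurable_lin_comb u : measurable_fun setT (lin_comb u).
Proof.
rewrite (_ : lin_comb u = fun w => \sum_k u k 0 * X w k 0); last first.
  by apply/funext => w; exact: lin_combE.
by apply: measurable_sum => k; exact: measurable_funM.
Qed.

Lemma multinormal_sym : Sigma^T = Sigma.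
Proof. by case: normalX. Qed.

Lemma multinormal_ge0 u : 0 <= bf u u.
Proof. by case: normalX => _ + _; exact. Qed.

Lemma lin_comb_law u (B : set R) : measurable B ->
  P (lin_comb u @^-1` B) = normal_law ((u^T *m mu) 0 0) (bf u u) B.
Proof. by move=> mB; case: normalX => _ _; exact. Qed.

Lemma lin_comb_Lfun2 u : lin_comb u \in Lfun P 2%:E.
Proof.
by apply: normal_Lfun2 (lin_comb_law u); [exact: measurable_lin_comb | exact: multinormal_ge0].
Qed.

Lemma lin_comb_variance u : ('V_P[lin_comb u] = (bf u u)%:E)%E.
Proof.
by apply: normal_variance (lin_comb_law u); [exact: measurable_lin_comb | exact: multinormal_ge0].
Qed.

Lemma lin_comb_mgf u : (\int[P]_w (expR (lin_comb u w))%:E =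
  (expR ((u^T *m mu) 0 0 + bf u u / 2))%:E)%E.
Proof.
have := mgf_normal (measurable_lin_comb u) (multinormal_ge0 u) (lin_comb_law u) 1.
under eq_integral do rewrite mul1r.
by move=> ->; rewrite mul1r expr1n mul1r.
Qed.

(** Only univariate laws are known, so the covariance is extracted from the variance of the
    combination with coefficients u + v. *)
Lemma lin_comb_covariance u v :
  covariance P (lin_comb u) (lin_comb v) = (bf u v)%:E.
Proof.
have Lu := lin_comb_Lfun2 u; have Lv := lin_comb_Lfun2 v.
have sub := Lfun_subset12 (fin_num_measure P _ measurableT).
have cf : covariance P (lin_comb u) (lin_comb v) \is a fin_num.
  by apply: covariance_fin_num; [exact: sub|exact: sub|exact: Lfun2_mul_Lfun1].
have := varianceD Lu Lv; rewrite -lin_combD !lin_comb_variance.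
rewrite -(fineK cf); set c := fine _ => hV.
have : bf (u + v) (u + v) = bf u u + bf v v + 2 * c by exact: EFin_inj hV.
rewrite bformDr !bformDl (bformC multinormal_sym v u) => h.
congr (_%:E); lra.
Qed.

Lemma lin_comb_covarianceB u v (a : R) :
  covariance P (fun w => lin_comb u w - a) (lin_comb v) = (bf u v)%:E.
Proof.
have := @covarianceBl _ _ _ P (lin_comb u) (cst a) (lin_comb v).
rewrite covariance_cst_l sube0 lin_comb_covariance => -> //;
  rewrite ?lin_comb_Lfun2 ?Lfun_cst//.
Qed.

Lemma lin_comb_covarianceBB u v (a b : R) :
  covariance P (fun w => lin_comb u w - a) (fun w => lin_comb v w - b) =
  (bf u v)%:E.
Proof.
have := @covarianceBr _ _ _ P (fun w => lin_comb u w - a) (lin_comb v) (cst b).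
rewrite covariance_cst_r sube0 lin_comb_covarianceB => -> //;
  rewrite ?lin_comb_Lfun2 ?Lfun_cst//.
have -> : (fun w => lin_comb u w - a) = (lin_comb u \- cst a) by [].
by apply: rpredB => [|?|?]; [rewrite lee1n | exact: lin_comb_Lfun2 | exact: Lfun_cst].
Qed.

Lemma multinormal_partial_corr (a b : 'I_K) (r : R) : a != b ->
  Sigma \in unitmx -> 0 < invmx Sigma a a -> 0 < invmx Sigma b b ->
  is_partial_corr P (fun k w => X w k 0) a b r ->
  r ^+ 2 * (invmx Sigma a a * invmx Sigma b b) = invmx Sigma a b ^+ 2.
Proof.
move=> ab uS Da Db [e [f [[[a0 [ca eE]] _ eC] [[b0 [cb fE]] _ fC] rE]]].
set C := (~: [set a; b])%SET in eE eC fE fC.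
pose res i (c : 'I_K -> R) := delta_mx i 0 - \col_k (if k \in C then c k else 0)
  : 'cV[R]_K.
have resE i c w : lin_comb (res i c) w =
    X w i 0 - \sum_(k in C) c k * X w k 0.
  rewrite lin_combE; under eq_bigr do rewrite mxE [X in _ + X]mxE mulrDl mulNr.
  rewrite big_split/= sumrN -lin_combE lin_comb_delta; congr (_ - _).
  rewrite [RHS]big_mkcond/=; apply: eq_bigr => k _; rewrite mxE.
  by case: ifP => _; rewrite ?mul0r.
have eE' : e = fun w => lin_comb (res a ca) w - a0.
  by rewrite eE; apply/funext => w; rewrite resE; ring.
have fE' : f = fun w => lin_comb (res b cb) w - b0.
  by rewrite fE; apply/funext => w; rewrite resE; ring.
have inC c : c != a -> c != b -> c \in C.
  by move=> ca' cb'; rewrite !inE negb_or ca' cb'.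
have aC : a \notin C by rewrite !inE eqxx.
have bC : b \notin C by rewrite !inE eqxx orbT.
apply: (@bform_partial_corr _ _ _ multinormal_sym multinormal_ge0 uS a b (res a ca) (res b cb)) => //.
- move=> c ca' cb'; have := eC c (inC _ ca' cb').
  rewrite eE' -lin_comb_delta lin_comb_covarianceB => -[].
  by rewrite bform_delta_r// multinormal_sym.
- move=> c ca' cb'; have := fC c (inC _ ca' cb').
  rewrite fE' -lin_comb_delta lin_comb_covarianceB => -[].
  by rewrite bform_delta_r// multinormal_sym.
- by rewrite !mxE (negbTE aC) !eqxx subr0.
- by rewrite !mxE (negbTE bC) eq_sym (negbTE ab) subr0.
- by rewrite !mxE (negbTE aC) (negbTE ab) subr0.
- by rewrite !mxE (negbTE bC) !eqxx subr0.
- by rewrite rE eE' fE' lin_comb_covarianceBB /variance !lin_comb_covarianceBB.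
Qed.

(* Independence factorises E exp (v + X_b), which for normal variables forces
   the covariance to vanish. *)
Lemma multinormal_indep_bform0 (u : 'cV[R]_K) (b : 'I_K) :
  (forall A B, measurable A -> measurable B ->
     (P ((fun w => lin_comb u w - (u^T *m mu) 0 0)%R @^-1` A `&` (fun w => X w b 0)%R @^-1` B) =
     P ((fun w => lin_comb u w - (u^T *m mu) 0 0)%R @^-1` A) * P ((fun w => X w b 0)%R @^-1` B))%E) ->
  bf u (delta_mx b 0) = 0.
Proof.
set c := (u^T *m mu) 0 0 => ind.
have mY : measurable_fun setT (fun w => lin_comb u w - c).
  by apply: measurable_funB => //; exact: measurable_lin_comb.
have E1 : (\int[P]_w (expR (lin_comb u w - c))%:E = (expR (bf u u / 2))%:E)%E.
  under eq_integral do rewrite expRD EFinM.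
  rewrite ge0_integralZr//; last first.
    apply/measurable_EFinP; apply: measurableT_comp => //.
    exact: measurable_lin_comb.
  by rewrite lin_comb_mgf -EFinM -expRD; congr ((expR _)%:E); rewrite /c; lra.
have E2 := lin_comb_mgf (delta_mx b 0); rewrite lin_comb_delta in E2.
have mE : measurable_fun setT (@expR R) by [].
have := independent_integralM mY (mX b) mE (@expR_ge0 R) mE (@expR_ge0 R) ind E1 E2.
under eq_integral => w _.
  rewrite -expRD addrAC.
  rewrite (_ : lin_comb u w + X w b 0 = lin_comb (u + delta_mx b 0) w); last first.
    by rewrite lin_combD lin_comb_delta.
  rewrite expRD EFinM; over.
rewrite ge0_integralZr//; last first.
  apply/measurable_EFinP; apply: measurableT_comp => //.
  exact: measurable_lin_comb.
rewrite lin_comb_mgf -!EFinM -!expRD => -[] /expR_inj.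
rewrite linearD/= mulmxDl mxE bformDr !bformDl (bformC multinormal_sym (delta_mx b 0) u) /c.
lra.
Qed.

End multinormal.

(** * Deterministic analysis of the Dantzig selector *)

Section dantzig_error.
Context (R : realType) (K : nat) (Sigma S : 'M[R]_K) (a : 'I_K).
Context (th : 'cV[R]_K) (C r : R).
Let D := invmx Sigma.
Hypothesis unitS : Sigma \in unitmx.
Hypothesis D_row : forall i, \sum_j `|D i j| <= C.
Hypothesis Da : 1 <= D a a.
Hypothesis r_ge0 : 0 <= r.
Hypothesis SSigma : forall i j, `|S i j - Sigma i j| <= r.
Hypothesis tha : th a 0 = 0.
Hypothesis normal_eq : forall b, b != a -> Sigma b a = \sum_j Sigma b j * th j 0.
Hypothesis norm_th : \sum_j `|th j 0| <= C.

(** Entry [b] of the vector constrained by the selector, expressed through the covariance matrix [S]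
    of the observed columns instead of the data. *)
Definition ds_residual (x : 'cV[R]_K) (b : 'I_K) : R :=
  S b a - \sum_j S b j * x j 0.

Lemma sum_perturb (x : 'I_K -> R) b :
  `|\sum_j (S b j - Sigma b j) * x j| <= r * \sum_j `|x j|.
Proof.
apply: le_trans (ler_norm_sum _ _ _) _; rewrite mulr_sumr; apply: ler_sum => j _.
by rewrite normrM ler_wpM2r.
Qed.

Lemma ds_residual_true b : b != a -> `|ds_residual th b| <= r * (1 + C).
Proof.
move=> ba; rewrite /ds_residual.
have -> : S b a - \sum_j S b j * th j 0 =
    (S b a - Sigma b a) - \sum_j (S b j - Sigma b j) * th j 0.
  under [X in _ = _ - X]eq_bigr do rewrite mulrBl.
  rewrite sumrB -(normal_eq ba); ring.
apply: le_trans (ler_normB _ _) _; rewrite mulrDr mulr1; apply: lerD => //.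
by apply: le_trans (sum_perturb _ _) _; rewrite ler_wpM2l.
Qed.

Lemma row_bound_ge1 : 1 <= C.
Proof.
apply: le_trans Da _; apply: le_trans (D_row a).
rewrite (bigD1 a)//= -[leLHS]addr0 lerD ?ler_norm//.
by apply: sumr_ge0 => j _.
Qed.

(** Origin of 4 C^2: off a, the entries of Sigma h collect l from the selector, r (1 + C) from the
    true coefficients and 2 C r from replacing [S] by [Sigma], at most 4 l in total. One factor C
    pays for the entry at a, the other for multiplying by D. *)
Lemma dantzig_error (th' : 'cV[R]_K) (l : R) :
  th' a 0 = 0 -> \sum_j `|th' j 0| <= \sum_j `|th j 0| -> r * (1 + C) <= l ->
  (forall b, b != a -> `|ds_residual th' b| <= l) ->
  forall b, `|th' b 0 - th b 0| <= 4 * C ^+ 2 * l.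
Proof.
move=> tha' norm_th' rl res b0.
have C1 := row_bound_ge1.
have l0 : 0 <= l by apply: le_trans rl; rewrite mulr_ge0//; lra.
pose h := th' - th; pose rho := Sigma *m h.
have hE b : h b 0 = th' b 0 - th b 0 by rewrite !mxE.
have rhoE b : rho b 0 = \sum_j Sigma b j * h j 0 by rewrite mxE.
have norm_h : \sum_j `|h j 0| <= 2 * C.
  apply: (@le_trans _ _ (\sum_j (`|th' j 0| + `|th j 0|))).
    by apply: ler_sum => j _; rewrite hE; exact: ler_normB.
  by rewrite big_split/=; have := norm_th; have := norm_th'; lra.
have rho_le b : b != a -> `|rho b 0| <= 4 * l.
  move=> ba.
  have -> : rho b 0 = ds_residual th b - ds_residual th' b
      - \sum_j (S b j - Sigma b j) * h j 0.
    rewrite /ds_residual rhoE.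
    under [X in _ - X]eq_bigr do rewrite mulrBl.
    rewrite sumrB.
    under [X in _ - (X - _)]eq_bigr do rewrite hE mulrBr.
    rewrite sumrB; ring.
  apply: le_trans (ler_normB _ _) _.
  have h1 := le_trans (ler_normB (ds_residual th b) (ds_residual th' b))
    (lerD (ds_residual_true ba) (res b ba)).
  have h2 := le_trans (sum_perturb (fun j => h j 0) b) (ler_wpM2l r_ge0 norm_h).
  have rC := r_ge0; have rl' := rl; rewrite mulrDr mulr1 in rl' h1.
  have h12 := lerD h1 h2.
  apply: le_trans h12 _; lra.
have hD k : h k 0 = \sum_j D k j * rho j 0.
  by rewrite -[in LHS](mulKmx unitS h) mxE.
have rho_a : `|rho a 0| <= 4 * C * l.
  have ha : h a 0 = 0 by rewrite hE tha' tha subrr.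
  have : D a a * rho a 0 = - \sum_(j | j != a) D a j * rho j 0.
    by move: ha; rewrite hD (bigD1 a)//= => /eqP; rewrite addr_eq0 => /eqP.
  move=> e; apply: (@le_trans _ _ `|D a a * rho a 0|).
    by rewrite normrM ler_peMl// (le_trans Da)// ler_norm.
  rewrite e normrN; apply: le_trans (ler_norm_sum _ _ _) _.
  apply: (@le_trans _ _ (\sum_(j | j != a) `|D a j| * (4 * l))).
    by apply: ler_sum => j ja; rewrite normrM ler_wpM2l// rho_le.
  rewrite -mulr_suml -mulrA (mulrCA 4) ler_wpM2r ?mulr_ge0//.
  apply: le_trans (D_row a); rewrite [leRHS](bigD1 a)//= lerDr//.
have rho_all k : `|rho k 0| <= 4 * C * l.
  have [->//|ka] := eqVneq k a; apply: le_trans (rho_le _ ka) _.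
  by rewrite ler_wpM2r// ler_peMr.
rewrite -hE hD; apply: le_trans (ler_norm_sum _ _ _) _.
apply: (@le_trans _ _ (\sum_j `|D b0 j| * (4 * C * l))).
  by apply: ler_sum => j _; rewrite normrM ler_wpM2l.
rewrite -mulr_suml.
have -> : 4 * C ^+ 2 * l = C * (4 * C * l) by ring.
by rewrite ler_wpM2r// !mulr_ge0//; lra.
Qed.

End dantzig_error.

Section dantzig_model.
Context (R : realType) (n : nat) (M : network_model R n) (T tn : R)
  (lam : 'I_(blocks M) -> R -> R) (w : Omega M).
Local Notation K := (blocks M).
Implicit Types (a b : 'I_K) (th : 'cV[R]_K).

Definition sample_cov : 'M[R]_K := \matrix_(i, j)
  (n%:R^-1 * \sum_t (eta_hat T t w i - mu M i 0) * (eta_hat T t w j - mu M j 0)).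

(** The sign of [l] matters because the maxima start from 0, also over an empty index set (a single
    block). *)
Lemma max_abs_le (p q : nat) (A : 'M[R]_(p, q)) (l : R) : 0 <= l ->
  (max_abs A <= l) <-> (forall i j, `|A i j| <= l).
Proof.
move=> l0; split=> [Al i j|Al].
  apply: le_trans Al; rewrite /max_abs.
  apply: le_trans (le_bigmax _ _ i).
  exact: (le_bigmax _ (fun j => `|A i j|) j).
by apply: bigmax_le => // i _; apply: bigmax_le => // j _.
Qed.

(** The indices that survive the removal of [a] are the [lift a j]; expanding the matrix product
    there turns the data into [sample_cov]. *)
Lemma ds_feasibleE a th : th a 0 = 0 -> 0 <= lam a (norm1 th) ->
  ds_feasible T lam a w th <->
  (forall b, b != a -> `|ds_residual sample_cov a th b| <= lam a (norm1 th)).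
Proof.
move=> tha l0; rewrite /ds_feasible.
set A := (X in max_abs X).
have onesE p (v : 'cV[R]_p) t j : (ones R n *m v^T) t j = v j 0.
  by rewrite mxE big_ord1 !mxE mul1r.
have e1 t j : (col' a (H_hat T w) - ones R n *m (row' a (mu M))^T) t j =
    eta_hat T t w (lift a j) - mu M (lift a j) 0.
  by rewrite mxE [X in _ + X]mxE onesE !mxE.
have e2 t : ((col a (H_hat T w) - mu M a 0 *: ones R n)
      - (H_hat T w - ones R n *m (mu M)^T) *m th) t 0 =
    (eta_hat T t w a - mu M a 0) -
    \sum_k (eta_hat T t w k - mu M k 0) * th k 0.
  rewrite mxE [X in _ + X]mxE; congr (_ - _); first by rewrite !mxE mulr1.
  rewrite mxE; apply: eq_bigr => k _; congr (_ * _).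
  by rewrite mxE [X in _ + X]mxE onesE !mxE.
have AE j : A j 0 = ds_residual sample_cov a th (lift a j).
  rewrite /A /ds_residual mxE [X in _ * X]mxE.
  under eq_bigr => t _ do rewrite [X in X * _]mxE e1 e2 mulrBr.
  rewrite sumrB mulrBr; congr (_ - _); first by rewrite [RHS]mxE.
  under [RHS]eq_bigr => k _ do rewrite [X in X * _]mxE -mulrA mulr_suml.
  rewrite -mulr_sumr exchange_big/=; congr (_ * _).
  by apply: eq_bigr => t _; rewrite mulr_sumr; apply: eq_bigr => k _; rewrite mulrA.
split=> [[_ /(max_abs_le _ l0) H] b ba|H].
  by rewrite eq_sym in ba; have [j -> _] := unlift_some ba; rewrite -AE.
split=> //; apply/(max_abs_le _ l0) => i j; rewrite ord1 AE.
by apply: H; rewrite eq_sym neq_lift.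
Qed.

(** Error and threshold are both multiples of [lam] at the random norm of the selector. Minimality
    and monotonicity bound it by [lam] at the norm of [th], so the signal condition on the
    neighbours involves no random quantity. *)
Lemma ne_hat_recovers (thh : 'I_K -> 'cV[R]_K) a th (C r lmin : R) :
  Sigma M \in unitmx ->
  (forall i, \sum_j `|precision M i j| <= C) -> 1 <= precision M a a ->
  0 <= r -> (forall i j, `|sample_cov i j - Sigma M i j| <= r) ->
  th a 0 = 0 ->
  (forall b, b != a -> Sigma M b a = \sum_j Sigma M b j * th j 0) ->
  (forall b, b != a -> th b 0 = - (precision M a b / precision M a a)) ->
  (forall x y, 0 <= x -> x <= y -> lam a x <= lam a y) ->
  (forall x : 'cV[R]_K, x a 0 = 0 -> lmin <= lam a (norm1 x)) ->
  0 < lmin -> r * (1 + C) <= lmin -> 4 * C ^+ 2 <= tn ->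
  (forall b, b \in neighbours M a ->
     (4 * C ^+ 2 + tn) * lam a (norm1 th) < `|th b 0|) ->
  is_dantzig M T lam a w (thh a) ->
  ne_hat tn lam thh a = neighbours M a.
Proof.
move=> uS DC Da r0 SS tha neq thE lam_incr lam_ge lmin0 rl Ct beta_min [].
have norm_th : \sum_j `|th j 0| <= C.
  apply: le_trans (DC a); apply: ler_sum => j _.
  have [->|ja] := eqVneq j a; first by rewrite tha normr0.
  rewrite (thE _ ja) normrN normrM normfV (@ger0_norm _ (precision M a a)); last lra.
  by rewrite ler_pdivrMr ?ler_peMr//; lra.
move=> feas opt.
have tha' : thh a a 0 = 0 by case: feas.
have l0 (x : 'cV[R]_K) : x a 0 = 0 -> 0 < lam a (norm1 x) by move/lam_ge; exact: lt_le_trans.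
have th_feas : ds_feasible T lam a w th.
  apply/ds_feasibleE => // [|b ba]; first by rewrite ltW ?l0.
  apply: le_trans (ds_residual_true r0 SS neq norm_th ba) _.
  by apply: le_trans rl _; exact: lam_ge.
have norm_le : norm1 (thh a) <= norm1 th by exact: opt.
set l := lam a (norm1 (thh a)).
have ll : l <= lam a (norm1 th).
  by apply: lam_incr => //; apply: sumr_ge0.
have lgt0 : 0 < l by exact: l0.
have err b : `|thh a b 0 - th b 0| <= 4 * C ^+ 2 * l.
  apply: (dantzig_error uS DC Da r0 SS tha neq norm_th tha' norm_le).
    by apply: le_trans rl _; exact: lam_ge.
  exact: (proj1 (ds_feasibleE tha' (ltW lgt0)) feas).
have C2 : 0 <= 4 * C ^+ 2 by rewrite mulr_ge0// sqr_ge0.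
have tn0 : 0 <= tn by apply: le_trans Ct.
apply/setP => b; rewrite !inE mxE -/l.
have [->|ba] /= := eqVneq b a; first by rewrite eqxx.
have [Dab|Dab] /= := eqVneq (precision M a b) 0.
  rewrite ifF ?eqxx//; apply/negbTE; rewrite -leNgt.
  have := err b; rewrite (thE _ ba) Dab mul0r oppr0 subr0 => /le_trans; apply.
  by rewrite ler_wpM2r// ltW.
have bn : b \in neighbours M a by rewrite inE ba Dab.
have big : tn * l < `|thh a b 0|.
  have h1 := err b; rewrite distrC in h1.
  have h2 := le_trans (lerB_dist _ _) h1.
  have h3 : (4 * C ^+ 2 + tn) * l < `|th b 0|.
    apply: le_lt_trans (beta_min _ bn); rewrite ler_wpM2l// addr_ge0//.
  rewrite mulrDl in h3; lra.
rewrite big; rewrite -normr_gt0; apply: le_lt_trans big.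
by rewrite mulr_ge0// ltW.
Qed.

Lemma E_hat_recovers (thh : 'I_K -> 'cV[R]_K) :
  (forall a b, precision M a b = precision M b a) ->
  (forall a, ne_hat tn lam thh a = neighbours M a) ->
  E_hat_and tn lam thh = edges M /\ E_hat_or tn lam thh = edges M.
Proof.
move=> Dsym H; split; apply/setP => -[a b]; rewrite [LHS]inE [RHS]inE/= !H !inE (Dsym b a) (eq_sym b a).
  by rewrite andbb.
by rewrite orbb.
Qed.

End dantzig_model.

(** * Empirical logits *)

Section logit_bounds.
Context (R : realType).
Implicit Types p q x : R.

Lemma ln_le_subr1 x : 0 < x -> ln x <= x - 1.
Proof.
move=> x0; have := expR_ge1Dx (ln x); rewrite lnK ?posrE//; lra.
Qed.

(** Both directions come from ln y <= y - 1, at p/q and at q/p. The condition on [x] keeps q >= p/2,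
    whence the factor 2. *)
Lemma ln_perturb p q x : 0 < p -> `|q - p| <= x -> 2 * x <= p ->
  0 < q /\ `|ln q - ln p| <= 2 * x / p.
Proof.
move=> p0; rewrite ler_norml => /andP[h1 h2] h3.
have q2 : p / 2 <= q by lra.
have q0 : 0 < q by lra.
split=> //; rewrite ler_norml; apply/andP; split.
  have : ln p - ln q <= p / q - 1.
    by rewrite -ln_div ?posrE// ln_le_subr1// divr_gt0.
  have : p / q - 1 <= 2 * x / p.
    have -> : p / q - 1 = (p - q) / q by field; rewrite gt_eqF.
    rewrite ler_pdivrMr// mulrAC ler_pdivlMr//.
    have : 0 <= x by lra.
    nra.
  lra.
have : ln q - ln p <= q / p - 1.
  by rewrite -ln_div ?posrE// ln_le_subr1// divr_gt0.
have : q / p - 1 <= 2 * x / p.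
  have -> : q / p - 1 = (q - p) / p by field; rewrite gt_eqF.
  by rewrite ler_pM2r ?invr_gt0//; lra.
lra.
Qed.

(** The bounds for p and 1 - p add up because 1/p + 1/(1 - p) = 1/(p(1 - p)), the derivative of the
    logit. *)
Lemma logit_perturb p q x : 0 < p < 1 -> `|q - p| <= x ->
  2 * x <= p * (1 - p) ->
  [/\ 0 < q, q < 1 & `|logit q - logit p| <= 2 * x / (p * (1 - p))].
Proof.
move=> /andP[p0 p1] qp xp.
have x0 : 0 <= x by apply: le_trans qp.
have [q0 h1] := @ln_perturb p q x p0 qp (ltac:(nra)).
have qp' : `|(1 - q) - (1 - p)| <= x.
  by rewrite (_ : _ - _ = p - q); [rewrite distrC | ring].
have [q1 h2] := @ln_perturb (1 - p) (1 - q) x (ltac:(lra)) qp' (ltac:(nra)).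
split=> //; first lra.
rewrite /logit !ln_div ?posrE ?subr_gt0//; last lra.
have -> : 2 * x / (p * (1 - p)) = 2 * x / p + 2 * x / (1 - p).
  by field; rewrite !gt_eqF//; lra.
have -> : ln q - ln (1 - q) - (ln p - ln (1 - p)) =
  (ln q - ln p) - (ln (1 - q) - ln (1 - p)) by ring.
by apply: le_trans (ler_normB _ _) _; exact: lerD.
Qed.

(** The larger of p and 1 - p is at least 1/2, and the smaller is at least the larger divided by
    exp|logit p|. *)
Lemma logit_variance p : 0 < p < 1 ->
  (4 * expR `|logit p|)^-1 <= p * (1 - p).
Proof.
move=> /andP[p0 p1]; have q0 : 0 < 1 - p by lra.
have E : expR (logit p) = p / (1 - p).
  by rewrite /logit lnK// posrE divr_gt0.
have E' : expR (- logit p) = (1 - p) / p by rewrite expRN E invf_div.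
have n1 := expR_ge1Dx `|logit p|; have n0 := normr_ge0 (logit p).
have h1 : p / (1 - p) <= expR `|logit p| by rewrite -E ler_expR ler_norm.
have h2 : (1 - p) / p <= expR `|logit p|.
  by rewrite -E' ler_expR -normrN ler_norm.
set e := expR _ in n1 h1 h2 *.
have e0 : 0 < e by lra.
rewrite -div1r ler_pdivrMr ?mulr_gt0//.
move: h1 h2; rewrite !ler_pdivrMr// => h1 h2.
have [ph|ph] := leP p (1 / 2); nra.
Qed.

End logit_bounds.

Section eta_hat_bound.
Context (R : realType) (n : nat) (M : network_model R n).
Implicit Types (t : 'I_n) (k : 'I_(blocks M)) (w : Omega M).

(** Truncation is the projection onto [-T, T]: it fixes [e] and does not increase distances. *)
Lemma clip_close (T y e : R) : - T <= e <= T ->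
  `|Num.max (- T) (Num.min T y) - e| <= `|y - e|.
Proof.
move=> /andP[e1 e2]; have h1 := ler_norm (y - e).
have h2 := ler_norm (- (y - e)); rewrite normrN in h2.
have [Ty|/ltW yT] := leP T y.
  by rewrite (elimT max_idPr _) ?ler_norml//; [apply/andP; split|]; lra.
have [Ty|/ltW yT'] := leP (- T) y; first by [].
by rewrite ler_norml; apply/andP; split; lra.
Qed.

(** Since p(1 - p) >= 1/(4 exp U), the perturbation bound 2 x/(p(1 - p)) is at most 8 x exp U. The
    condition that this be at most 1 also keeps the frequency strictly between 0 and 1, so the
    extended logarithm is finite. *)
Lemma eta_hat_close (T x U : R) t w k :
  `|p_tilde t w k - pmat t w k k| <= x -> `|Defs.eta t w k 0| <= U -> U <= T ->
  8 * x * expR U <= 1 -> `|eta_hat T t w k - Defs.eta t w k 0| <= 8 * x * expR U.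
Proof.
move=> px; rewrite mxE; set p := pmat t w k k => etaU UT xU.
have pp : 0 < p < 1 by exact: pmat_itv.
have e0 := expR_gt0 U.
have eU : expR `|logit p| <= expR U by rewrite ler_expR.
have x0 : 0 <= x by apply: le_trans px.
have var := logit_variance pp.
have e1 := expR_gt0 `|logit p|.
have var' : (4 * expR U)^-1 <= p * (1 - p).
  by apply: le_trans var; rewrite lef_pV2 ?posrE ?mulr_gt0// ler_pM2l.
have v0 : 0 < (4 * expR U)^-1 by rewrite invr_gt0 mulr_gt0.
have x2 : 2 * x <= (4 * expR U)^-1.
  by rewrite -div1r ler_pdivlMr ?mulr_gt0//; lra.
have [q0 q1 h] := logit_perturb pp px (le_trans x2 var').
have tildeE : eta_tilde t w k = (logit (p_tilde t w k))%:E.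
  rewrite /eta_tilde inver gt_eqF ?subr_gt0// -EFinM lne_EFin//.
  by rewrite divr_gt0// subr_gt0.
rewrite /eta_hat tildeE -EFin_min -EFin_max/=.
set y := logit (p_tilde t w k) in h *.
apply: (@le_trans _ _ `|y - logit p|).
  apply: clip_close; move: etaU; rewrite ler_norml => /andP[l1 l2].
  by apply/andP; split; lra.
apply: le_trans h _; rewrite ler_pdivrMr; last by lra.
apply: (@le_trans _ _ (8 * x * expR U * (4 * expR U)^-1)).
  rewrite le_eqVlt; apply/orP; left; apply/eqP; field.
  by rewrite gt_eqF.
by rewrite ler_wpM2l// !mulr_ge0// ltW.
Qed.

Definition latent_cov w : 'M[R]_(blocks M) := \matrix_(i, j)
  (n%:R^-1 * \sum_t (Defs.eta t w i 0 - mu M i 0) * (Defs.eta t w j 0 - mu M j 0)).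

Lemma sample_cov_close (T V De : R) w : (0 < n)%N ->
  (forall t k, `|Defs.eta t w k 0 - mu M k 0| <= V) ->
  (forall t k, `|eta_hat T t w k - Defs.eta t w k 0| <= De) ->
  forall i j, `|sample_cov T w i j - latent_cov w i j| <= De * (2 * V + De).
Proof.
move=> n0 HV HD i j; rewrite [sample_cov _ _ _ _]mxE [latent_cov _ _ _]mxE -mulrBr -sumrB normrM.
have n0' : (0 : R) < n%:R by rewrite ltr0n.
rewrite (@ger0_norm _ n%:R^-1) ?invr_ge0// ler_pdivrMl//.
apply: le_trans (ler_norm_sum _ _ _) _.
apply: (@le_trans _ _ (\sum_(t < n) De * (2 * V + De))); last first.
  by rewrite sumr_const card_ord -[_ *+ n]mulr_natl.
apply: ler_sum => t _.
have := HV t i; have := HV t j; have := HD t i; have := HD t j.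
set ai := Defs.eta t w i 0 - _; set aj := Defs.eta t w j 0 - _.
set di := eta_hat T t w i - _; set dj := eta_hat T t w j - _ => hdj hdi hvj hvi.
rewrite [X in `|X|](_ : _ = di * dj + (di * aj + ai * dj)); last by rewrite /di /dj /ai /aj; ring.
have V0 : 0 <= V by apply: le_trans hvj.
have D0 : 0 <= De by apply: le_trans hdj.
apply: le_trans (ler_normD _ _) _.
have m1 : `|di * dj| <= De * De by rewrite normrM ler_pM.
have m2 : `|di * aj| <= De * V by rewrite normrM ler_pM.
have m3 : `|ai * dj| <= V * De by rewrite normrM ler_pM.
have := ler_normD (di * aj) (ai * dj); lra.
Qed.

End eta_hat_bound.

(** * Edge frequencies *)

(** The square of A splits into the pairs below, above and on the diagonal. This identifies the
    integer quotient defining [block_pairs] with a number of Bernoulli variables. *)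
Lemma card_ordered_pairs (N : nat) (A : {set 'I_N}) :
  #|[set ij : 'I_N * 'I_N | [&& (ij.1 < ij.2)%N, ij.1 \in A & ij.2 \in A]]%SET| =
  ((#|A| * (#|A| - 1)) %/ 2)%N.
Proof.
set L := [set ij | _]%SET.
pose G := [set ij : 'I_N * 'I_N | [&& (ij.2 < ij.1)%N, ij.1 \in A & ij.2 \in A]]%SET.
pose Dg := [set (i, i) | i in A]%SET.
have GL : #|G| = #|L|.
  pose sw (ij : 'I_N * 'I_N) := (ij.2, ij.1).
  have swI : injective sw by move=> [i j] [i' j'] [-> ->].
  rewrite -(card_imset L swI); congr #|pred_of_set _|.
  apply/setP => -[i j]; rewrite inE/=.
  apply/idP/imsetP => [h|[[i' j']]].
    by exists (j, i) => //; rewrite inE/=; move: h => /and3P[-> -> ->].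
  by rewrite inE/= => /and3P[h1 h2 h3] [-> ->]; apply/and3P.
have cD : #|Dg| = #|A| by rewrite card_imset// => i j [].
have disj1 : (L :&: G)%SET = finset.set0.
  by apply/setP => -[i j]; rewrite !inE/=; case: ltngtP => _; rewrite /= ?andbF.
have disj2 : ((L :|: G) :&: Dg)%SET = finset.set0.
  apply/setP => -[i j]; rewrite !inE/=.
  apply/negP => /andP[h /imsetP[k _ [ik jk]]].
  by move: h; rewrite ik jk ltnn.
have E : finset.setX A A = ((L :|: G) :|: Dg)%SET.
  apply/setP => -[i j]; rewrite !inE/=.
  case: (ltngtP i j) => ij /=.
  - rewrite orbF; apply/idP/orP => [->|[//|/imsetP[k kA [ik jk]]]]; first by left.
    by move: ij; rewrite ik jk ltnn.
  - apply/idP/orP => [->|[//|/imsetP[k kA [ik jk]]]]; first by left.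
    by move: ij; rewrite ik jk ltnn.
  - have {ij}-> : i = j by exact: val_inj.
    rewrite andbb; apply/idP/imsetP => [jA|[k kA [-> _]]//].
    by exists j.
have := finset.cardsX A A; rewrite E.
have := cardsUI (L :|: G)%SET Dg; rewrite disj2 cards0 addn0 => ->.
have := cardsUI L G; rewrite disj1 cards0 addn0 => ->.
rewrite GL cD => h.
have -> : (#|A| * (#|A| - 1) = #|L| * 2)%N by rewrite mulnBr muln1 -h addnK muln2 addnn.
by rewrite mulnK.
Qed.

(** * Union bound over a finite family *)

Section finite_union.
Local Open Scope ereal_scope.
Context d (T : measurableType d) (R : realType) (P : probability T R).

Lemma probability_exists_le (I : finType) (Q : pred I) (A : I -> set T) :
  (forall i, measurable (A i)) ->
  measurable [set w | exists2 i, Q i & A i w] /\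
  P [set w | exists2 i, Q i & A i w] <= \sum_(i | Q i) P (A i).
Proof.
move=> mA.
have -> : [set w | exists2 i, Q i & A i w] = \big[setU/set0]_(i | Q i) A i.
  apply/seteqP; split=> w /=.
    by move=> [i Qi Aiw]; rewrite (bigD1 i)//=; left.
  elim/big_ind : _ => //.
    by move=> U V HU HV [/HU|/HV].
  by move=> i Qi Aiw; exists i.
split; first exact: bigsetU_measurable.
have mbig (s : seq I) : measurable (\big[setU/set0]_(i <- s | Q i) A i).
  exact: bigsetU_measurable.
elim: (index_enum I) => [|i s IH]; first by rewrite !big_nil measure0.
rewrite !big_cons; case: ifP => // Qi.
by apply: le_trans (measureU2 _ _ _) _ => //; exact: leeD.
Qed.

End finite_union.

(** * Measurability with respect to generated sigma-algebras *)

Section generated_sigma_algebra.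
Context d (T : measurableType d) (R : realType) (I : Type) (D : set I)
  (X : I -> T -> R).

(** With the generators of [sigma_rv] named, membership in it becomes ordinary measurability on a
    [g_sigma_algebraType]. *)
Definition rv_generators : set (set T) :=
  \bigcup_(i in D) preimage_set_system [set: T] (X i) measurable.

Lemma measurable_generator i : D i ->
  measurable_fun setT (X i : g_sigma_algebraType rv_generators -> R).
Proof.
move=> Di _ B mB; apply: sub_sigma_algebra; exists i => //.
by exists B.
Qed.

Lemma sigma_rv_measurable_fun (f : g_sigma_algebraType rv_generators -> R)
    (B : set R) : measurable_fun setT f -> measurable B ->
  sigma_rv D X (f @^-1` B).
Proof. by move=> mf mB; rewrite -[_ @^-1` _]setTI; exact: mf. Qed.

Lemma sigma_rv_preimage i (B : set R) : D i -> measurable B ->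
  sigma_rv D X (X i @^-1` B).
Proof.
by move=> Di mB; apply: sigma_rv_measurable_fun => //; exact: measurable_generator.
Qed.

End generated_sigma_algebra.

Lemma measurable_fun_logit d (T : measurableType d) (R : realType) (f : T -> R) :
  measurable_fun setT f -> (forall w, 0 < f w < 1) ->
  measurable_fun setT (fun w => logit (f w)).
Proof.
move=> mf f01.
have -> : (fun w => logit (f w)) = (fun w => ln (f w) - ln (1 - f w)).
  apply/funext => w; have /andP[f0 f1] := f01 w.
  by rewrite /logit ln_div ?posrE ?subr_gt0.
apply: measurable_funB; first exact: measurableT_comp.
by apply: measurableT_comp => //; exact: measurable_funB.
Qed.

(** * Chernoff bound for Bernoulli sums *)

Section bernoulli_chernoff.
Context (R : realType).
Implicit Types (p q s y : R).

Lemma expR_le_quadratic y : y <= 1 / 2 -> expR y <= 1 + y + 2 * y ^+ 2.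
Proof.
move=> y2; have h := expR_ge1Dx (- y).
have e0 := expR_gt0 y; rewrite expRN in h.
have h2 : (1 - y) * expR y <= 1 by rewrite -ler_pdivlMr// div1r.
have y1 : 0 < 1 - y by lra.
rewrite -(ler_pM2l y1); apply: le_trans h2 _.
have : 0 <= y ^+ 2 * (1 - 2 * y) by rewrite mulr_ge0 ?sqr_ge0//; lra.
by move=> h3; rewrite -subr_ge0 (_ : _ - 1 = y ^+ 2 * (1 - 2 * y))//; ring.
Qed.

(** Centering cancels the linear terms of the quadratic bound on exp, and the quadratic ones add up
    to 2 s^2 p(1 - p) <= s^2. *)
Lemma bernoulli_mgf p s : 0 <= p <= 1 -> `|s| <= 1 / 2 ->
  \sum_(b : bool) bernoulli_pmf p b * expR (s * (b%:R - p)) <= expR (s ^+ 2).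
Proof.
move=> /andP[p0 p1]; rewrite ler_norml => /andP[s1 s2].
rewrite big_bool /bernoulli_pmf /= sub0r.
have h1 := @expR_le_quadratic (s * (1 - p)) (ltac:(nra)).
have h2 := @expR_le_quadratic (s * - p) (ltac:(nra)).
have h3 : p * expR (s * (1 - p)) <= p * (1 + s * (1 - p) + 2 * (s * (1 - p)) ^+ 2).
  by rewrite ler_wpM2l.
have h4 : (1 - p) * expR (s * - p) <= (1 - p) * (1 + s * - p + 2 * (s * - p) ^+ 2).
  by rewrite ler_wpM2l//; lra.
have h5 := expR_ge1Dx (s ^+ 2).
have s20 : 0 <= s ^+ 2 by exact: sqr_ge0.
have pq : 2 * (p * (1 - p)) <= 1 by have := sqr_ge0 (p - 1 / 2); nra.
have h6 : s ^+ 2 * (2 * (p * (1 - p))) <= s ^+ 2 * 1 by rewrite ler_wpM2l.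
nra.
Qed.

(** [E] will be the upper triangle and [B] the pairs inside a block. Functions that are false off
    [E] list each pattern on [E] once. The indicator is bounded by an exponential, the sum over
    patterns factorises, and the entries outside [B] sum to 1. *)
Lemma bernoulli_chernoff (J : finType) (E B : pred J) (p : J -> R) q s y :
  (forall j, 0 <= p j <= 1) -> (forall j, E j -> B j -> p j = q) ->
  `|s| <= 1 / 2 ->
  \sum_(f in pffun_on false E predT)
    (y <= s * (\sum_(j | E j && B j) (f j)%:R - #|[pred j | E j && B j]|%:R * q))%R%:R *
    \prod_(j | E j) bernoulli_pmf (p j) (f j) <=
  expR (- y + #|[pred j | E j && B j]|%:R * s ^+ 2).
Proof.
move=> p01 pq s2; set m := #|_|.
have bern0 j b : 0 <= bernoulli_pmf (p j) b by exact: bernoulli_pmf_ge0.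
pose F j (b : bool) := bernoulli_pmf (p j) b *
  (if B j then expR (s * (b%:R - q)) else 1).
apply: (@le_trans _ _ (\sum_(f in pffun_on false E predT)
    expR (- y) * \prod_(j | E j) F j (f j))).
  apply: ler_sum => f _.
  rewrite big_split/= mulrCA mulrC ler_wpM2l ?prodr_ge0//.
  have -> : \prod_(j | E j) (if B j then expR (s * ((f j)%:R - q)) else 1) =
      expR (s * (\sum_(j | E j && B j) (f j)%:R - m%:R * q)).
    rewrite -big_mkcondr/= -expR_sum -mulr_sumr sumrB sumr_const -[q *+ _]mulr_natl.
    by [].
  rewrite -expRD; case: (leP y _) => h /=; last exact: expR_ge0.
  by rewrite -[leLHS]expR0 ler_expR addrC subr_ge0.
rewrite -mulr_sumr -(big_distr_big false E predT F) expRD ler_wpM2l ?expR_ge0//.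
apply: (@le_trans _ _ (\prod_(j | E j) (if B j then expR (s ^+ 2) else 1))).
  apply: ler_prod => j Ej; apply/andP; split.
    apply: sumr_ge0 => b _; rewrite mulr_ge0//.
    by case: ifP => _; rewrite ?expR_ge0.
  rewrite /F; case: ifP => Bj.
    by rewrite -(pq j Ej Bj); exact: (bernoulli_mgf (p01 j) s2).
  under eq_bigr do rewrite mulr1.
  by rewrite big_bool /bernoulli_pmf/= subrKC.
rewrite -big_mkcondr/= prodr_const -/m expRM_natl//.
Qed.

End bernoulli_chernoff.

(** * Deviation of the edge frequencies *)

Section edge_frequency.
Context (R : realType) (n : nat) (M : network_model R n).
Local Notation N := (nodes M).
Local Notation P := (Pr M).
Implicit Types (t : 'I_n) (k : 'I_(blocks M)) (w : Omega M).

Lemma block_pairsE k : block_pairs k =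
  #|[pred ij : 'I_N * 'I_N | (ij.1 < ij.2)%N && ((ij.1 \in block k) && (ij.2 \in block k))]|.
Proof.
rewrite /block_pairs -card_ordered_pairs; apply: eq_card => ij.
by rewrite !inE.
Qed.

Lemma edge_countE t w k : (edge_count t w k)%:R = \sum_(ij : 'I_N * 'I_N |
    (ij.1 < ij.2)%N && ((ij.1 \in block k) && (ij.2 \in block k)))
    (adj t w ij.1 ij.2)%:R :> R.
Proof.
rewrite /edge_count -sum1_card natr_sum.
under eq_bigl => ij do rewrite inE !andbA.
rewrite big_mkcondr/=; apply: eq_big => [ij|ij _]; first by rewrite !andbA.
by case: (adj _ _ _ _).
Qed.

Lemma measurable_edge_count t k :
  measurable_fun setT (fun w => (edge_count t w k)%:R : R).
Proof.
rewrite (_ : (fun w => _) = fun w => \sum_(ij : 'I_N * 'I_N)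
    if (ij.1 < ij.2)%N && ((ij.1 \in block k) && (ij.2 \in block k))
    then (adj t w ij.1 ij.2)%:R else 0); last first.
  by apply/funext => w; rewrite edge_countE big_mkcond.
apply: measurable_sum => ij; case: (_ && _); last exact: measurable_cst.
rewrite (_ : (fun w => _) = \1_[set w | adj t w ij.1 ij.2]).
  by apply: measurable_indic; exact: adj_meas.
apply/funext => w; rewrite indicE; congr (_%:R); congr nat_of_bool.
by apply/idP/idP; rewrite inE.
Qed.

(* The event splits over the finitely many upper-triangular adjacency patterns
   f; on each of them it is an event about p_kk alone, to which the conditional
   law of the edges applies. *)
Lemma edge_count_chernoff t k (s y : R) : `|s| <= 1 / 2 ->
  (P [set w | (y <= s * ((edge_count t w k)%:R -
      (block_pairs k)%:R * pmat t w k k))%R] <=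
   (expR (- y + (block_pairs k)%:R * s ^+ 2))%:E)%E.
Proof.
move=> s2.
pose E (ij : 'I_N * 'I_N) := (ij.1 < ij.2)%N.
pose B (ij : 'I_N * 'I_N) := (ij.1 \in block k) && (ij.2 \in block k).
pose cnt (f : {ffun 'I_N * 'I_N -> bool}) : R := \sum_(ij | E ij && B ij) (f ij)%:R.
pose m : R := (block_pairs k)%:R.
pose A f := [set w | (y <= s * (cnt f - m * pmat t w k k))%R].
pose Y (f : {ffun 'I_N * 'I_N -> bool}) :=
  [set w | forall i j : 'I_N, (i < j)%N -> adj t w i j = f (i, j)].
pose pf (f : {ffun 'I_N * 'I_N -> bool}) w : R := \prod_(ij | E ij)
  bernoulli_pmf (pmat t w (membership ij.1) (membership ij.2)) (f ij).
have mp l l' : measurable_fun setT (fun w => pmat t w l l') by exact: pmat_meas.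
have mbern l l' b : measurable_fun setT (fun w => bernoulli_pmf (pmat t w l l') b).
  by rewrite /bernoulli_pmf; case: b => //; exact: measurable_funB.
have mpf f : measurable_fun setT (pf f).
  rewrite (_ : pf f = fun w => \prod_(ij <- enum E) bernoulli_pmf
      (pmat t w (membership ij.1) (membership ij.2)) (f ij)).
    by apply: measurable_fun_bigprod => ij; exact: mbern.
  by apply/funext => w; rewrite big_enum.
have mgA f : measurable [set x : R | (y <= s * (cnt f - m * x))%R].
  rewrite (_ : mkset _ = (fun x => s * (cnt f - m * x)) @^-1` `[y, +oo[%classic).
    apply: measurable_preimage_rv; last exact: measurable_itv.
    by apply: measurable_funM => //; apply: measurable_funB => //; exact: measurable_funM.
  by apply/seteqP; split=> x /=; rewrite in_itv/= andbT.
have mA f : measurable (A f).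
  exact: (measurable_preimage_rv (mp k k) (mgA f)).
have sA f : sigma_rv [set: 'I_(blocks M) * 'I_(blocks M)]
    (fun kl w => pmat t w kl.1 kl.2) (A f).
  exact: (@sigma_rv_preimage _ _ _ _ setT (fun kl w => pmat t w kl.1 kl.2) (k, k) _ I (mgA f)).
have mY f : measurable (Y f).
  rewrite (_ : Y f = \bigcap_(ij in [set ij | E ij])
      [set w | adj t w ij.1 ij.2 = f ij]).
    apply: fin_bigcap_measurable => [|[i j] _ /=]; first exact: finite_finset.
    have [fij|fij] := boolP (f (i, j)); first exact: adj_meas.
    rewrite (_ : mkset _ = ~` [set w | adj t w i j]).
      by apply: measurableC; exact: adj_meas.
    by apply/seteqP; split=> w /= => [->//|/negP/negbTE].
  apply/seteqP; split=> w /= H; first by move=> [i j] /= ij; exact: H.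
  by move=> i j ij; exact: (H (i, j)).
have pf0 f w : 0 <= pf f w.
  apply: prodr_ge0 => ij _; apply: bernoulli_pmf_ge0.
  by have /andP[h1 h2] := pmat_itv t w (membership ij.1) (membership ij.2); rewrite !ltW.
have law f : P (A f `&` Y f) = (\int[P]_(w in A f) (pf f w)%:E)%E.
  have := adj_cond_law (\matrix_(i, j) f (i, j)) (sA f).
  have -> : [set w | forall i j : 'I_N, (i < j)%N ->
      adj t w i j = (\matrix_(i, j) f (i, j)) i j] = Y f.
    by apply/seteqP; split=> w /= H i j ij; rewrite H// mxE.
  move=> ->; apply: eq_integral => w _; congr (_%:E).
  by apply: eq_bigr => -[i j] _; rewrite mxE.
set Bad := [set w | _].
have mBad : measurable Bad.
  pose g w := s * ((edge_count t w k)%:R - m * pmat t w k k).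
  rewrite (_ : Bad = g @^-1` `[y, +oo[%classic).
    apply: measurable_preimage_rv; last exact: measurable_itv.
    apply: measurable_funM => //; apply: measurable_funB; last exact: measurable_funM.
    exact: measurable_edge_count.
  by apply/seteqP; split=> w /=; rewrite in_itv/= andbT.
pose F : pred {ffun 'I_N * 'I_N -> bool} := [in pffun_on false E predT].
have [mU PU] := probability_exists_le P F (fun f => measurableI _ _ (mA f) (mY f)).
apply: (@le_trans _ _ (\sum_(f | F f) P (A f `&` Y f))%E).
  apply: le_trans PU; apply: le_measure; rewrite ?inE//.
  (* The pattern of [w] is its adjacency matrix cut to the upper triangle, as patterns are false
     elsewhere. *)
  move=> w /= yw; exists [ffun ij => E ij && adj t w ij.1 ij.2].
    apply/pffun_onP; split=> [|b _ //].
    apply/fintype.subsetP => ij; rewrite inE/= ffunE => h.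
    by rewrite -[_ \in _]/(E ij); move: h; case: (E ij).
  split; rewrite /A/Y/=; last by move=> i j ij; rewrite ffunE /E/= ij.
  apply: le_trans yw _; rewrite le_eqVlt; apply/orP; left; apply/eqP.
  rewrite edge_countE /cnt; congr (s * (_ - _)); apply: eq_bigr => ij.
  by move=> /andP[Eij _]; rewrite ffunE /E Eij.
under eq_bigr do rewrite law integral_mkcond.
have mterm f : measurable_fun setT ((fun w => (pf f w)%:E) \_ (A f)).
  by apply/(measurable_restrictT _ (mA f)); apply/measurable_EFinP; exact: measurable_funTS.
rewrite -big_filter.
rewrite -ge0_integral_sum//; last first.
  by move=> f w _; rewrite patchE; case: ifP => // _; rewrite lee_fin.
rewrite (_ : (expR _)%:E = \int[P]_w (expR (- y + m * s ^+ 2))%:E)%E; last first.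
  by rewrite (integral_EFin_cst _ _ measurableT) probability_setT mule1.
apply: ge0_le_integral => //.
- by move=> w _; apply: sume_ge0 => f _; rewrite patchE; case: ifP => // _; rewrite lee_fin.
- exact: emeasurable_sum.
move=> w _; rewrite big_filter.
have := @bernoulli_chernoff R _ E B
   (fun ij => pmat t w (membership ij.1) (membership ij.2)) (pmat t w k k) s y.
rewrite -block_pairsE -/m => H.
have {H} := H _ _ s2; rewrite -lee_fin => H; apply: le_trans (H _ _); last 2 first.
- move=> ij; have /andP[h1 h2] := pmat_itv t w (membership ij.1) (membership ij.2).
  by rewrite !ltW.
- by move=> ij _; rewrite /B !inE => /andP[/eqP -> /eqP ->].
rewrite -sumEFin; apply: lee_sum => f _.
rewrite patchE; case: ifPn => wA; last first.
  by rewrite lee_fin mulr_ge0// prodr_ge0// => ij _; apply: bernoulli_pmf_ge0;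
    have /andP[h1 h2] := pmat_itv t w (membership ij.1) (membership ij.2); rewrite !ltW.
have := set_mem wA; rewrite /A/= => ->.
by rewrite mul1r.
Qed.

Lemma measurable_p_tilde t k : measurable_fun setT (fun w => p_tilde t w k).
Proof.
by apply: measurable_funM => //; exact: measurable_edge_count.
Qed.

(** The Chernoff parameter is s = x/2 for the upper and -x/2 for the lower tail; the exponent is
    then -m x^2/2 + m x^2/4, and x <= 1 gives |s| <= 1/2. *)
Lemma p_tilde_tail t k (x : R) : 0 < x <= 1 -> (0 < block_pairs k)%N ->
  (P [set w | (x < `|p_tilde t w k - pmat t w k k|)%R] <=
   (2 * expR (- ((block_pairs k)%:R * x ^+ 2 / 4)))%:E)%E.
Proof.
move=> /andP[x0 x1] m0; set m : R := (block_pairs k)%:R.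
have m0' : 0 < m by rewrite ltr0n.
pose A (b : bool) := [set w | (m * x ^+ 2 / 2 <= (if b then x / 2 else - (x / 2)) *
  ((edge_count t w k)%:R - m * pmat t w k k))%R].
have mA b : measurable (A b).
  pose g w := (if b then x / 2 else - (x / 2)) *
    ((edge_count t w k)%:R - m * pmat t w k k).
  rewrite (_ : A b = g @^-1` `[m * x ^+ 2 / 2, +oo[%classic).
    apply: measurable_preimage_rv; last exact: measurable_itv.
    apply: measurable_funM => //; apply: measurable_funB.
      exact: measurable_edge_count.
    by apply: measurable_funM => //; exact: pmat_meas.
  by apply/seteqP; split=> w /=; rewrite in_itv/= andbT.
have PA b : (P (A b) <= (expR (- (m * x ^+ 2 / 4)))%:E)%E.
  apply: le_trans (edge_count_chernoff t k _ _) _.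
    by case: b; rewrite ?normrN ger0_norm; lra.
  by rewrite lee_fin ler_expR -/m; case: b; rewrite ?sqrrN expr_div_n; lra.
apply: (@le_trans _ _ (P (A true `|` A false))); last first.
  apply: (le_trans (measureU2 _ _ _)) => //.
  by rewrite mulrDl mul1r EFinD; apply: leeD; exact: PA.
apply: le_measure; rewrite ?inE; last 2 first.
- exact: measurableU.
- move=> w /=; have -> : p_tilde t w k - pmat t w k k =
      ((edge_count t w k)%:R - m * pmat t w k k) / m.
    by rewrite /p_tilde -/m; field; rewrite gt_eqF.
  rewrite normrM [`|m^-1|]ger0_norm ?invr_ge0 ?ler0n// ltr_pdivlMr//.
  set c := _ - _ => /ltW h.
  have [c0|c0] := leP 0 c.
    left; rewrite /A/= -/c; move: h; rewrite ger0_norm// => h.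
    have : x / 2 * (x * m) <= x / 2 * c by rewrite ler_wpM2l//; lra.
    lra.
  right; rewrite /A/= -/c; move: h; rewrite ltr0_norm// => h.
  have : x / 2 * (x * m) <= x / 2 * - c by rewrite ler_wpM2l//; lra.
  lra.
rewrite (_ : mkset _ = (fun w => `|p_tilde t w k - pmat t w k k|) @^-1` `]x, +oo[%classic).
  apply: measurable_preimage_rv; last exact: measurable_itv.
  apply: (measurableT_comp (@normr_measurable R setT)).
  by apply: measurable_funB; [exact: measurable_p_tilde|exact: pmat_meas].
by apply/seteqP; split=> w /=; rewrite in_itv/= andbT.
Qed.

End edge_frequency.

(** * Concentration in the network model *)

Section model_concentration.
Context (R : realType) (n : nat) (M : network_model R n).
Local Notation K := (blocks M).
Local Notation P := (Pr M).
Local Notation etav t := (@Defs.eta R n M t).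
Local Notation S := (Sigma M).
Implicit Types (t : 'I_n) (k : 'I_K) (w : Omega M).

Lemma block_pairs_min_le k : (block_pairs_min M <= block_pairs k)%N.
Proof.
suff gen d0 (s : seq 'I_K) : k \in s ->
    (\big[minn/d0]_(j <- s) block_pairs j <= block_pairs k)%N.
  exact: gen (mem_index_enum k).
elim: s => // i s IH; rewrite inE big_cons => /orP[/eqP <-|/IH h].
  exact: geq_minl.
exact: leq_trans (geq_minr _ _) h.
Qed.

Lemma etaE t w k : etav t w k 0 = logit (pmat t w k k).
Proof. by rewrite mxE. Qed.

Lemma measurable_eta t k : measurable_fun setT (fun w => etav t w k 0).
Proof.
under eq_fun do rewrite etaE.
by apply: measurable_fun_logit => [|w]; [exact: pmat_meas|exact: pmat_itv].
Qed.

(** A combination of the logits is measurable with respect to the diagonal entries of the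
    probability matrix, hence inherits the independence of the networks. *)
Lemma eta_lin_indep (u : 'cV[R]_K) (J : {set 'I_n}) (B : 'I_n -> set R) :
  (forall t, measurable (B t)) ->
  (P (\bigcap_(t in [set` J]) (lin_comb (etav t) u @^-1` B t)) =
   \prod_(t in J) P (lin_comb (etav t) u @^-1` B t))%E.
Proof.
move=> mB; apply: (@sample_indep R n M) => t _.
pose X (i : ('I_K * 'I_K) + ('I_(nodes M) * 'I_(nodes M))) w :=
  network_entry (pmat t w) (adj t w) i.
apply: (sigma_rv_measurable_fun (X := X)) => //.
rewrite (_ : lin_comb (etav t) u = fun w => \sum_k u k 0 * logit (X (inl (k, k)) w)); last first.
  by apply/funext => w; rewrite lin_combE; apply: eq_bigr => k _; rewrite etaE.
apply: measurable_sum => k; apply: measurable_funM => //.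
apply: measurable_fun_logit => [|w]; last exact: pmat_itv.
exact: measurable_generator.
Qed.

Hypothesis n_gt0 : (0 < n)%N.
Hypothesis S_diag : forall k, S k k = 1.
Let t0 := Ordinal n_gt0.

(** The signed unit vectors e_j and -e_j: 4 X_i X_j is the difference of the squares of X_i + X_j
    and X_i - X_j, so chi-square bounds along e_i + e_j and e_i - e_j control the empirical
    covariance. *)
Let dsgn (b : bool) (j : 'I_K) : 'cV[R]_K :=
  if b then delta_mx j 0 else - delta_mx j 0.

Let v (i j : 'I_K) (b : bool) : R :=
  bform S (delta_mx i 0 + dsgn b j) (delta_mx i 0 + dsgn b j).

Let vE i j b : v i j b = 2 + (if b then 2 else - 2) * S i j.
Proof.
have sS := multinormal_sym (@eta_normal R n M t0).
have dd (i' j' : 'I_K) : bform S (delta_mx i' 0) (delta_mx j' 0) = S j' i'.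
  by rewrite (bform_delta_r sS) -colE mxE.
have sE : S j i = S i j by rewrite -[in LHS]sS mxE.
have Nl u u' : bform S (- u) u' = - bform S u u'.
  by rewrite (bformC sS) bformNr (bformC sS).
rewrite /v /dsgn; case: b; rewrite !bformDr !bformDl ?bformNr ?Nl ?opprK !dd !S_diag sE; lra.
Qed.

Let v0 i j b : 0 <= v i j b.
Proof. exact: multinormal_ge0 (@eta_normal R n M t0) _. Qed.

(** The variances for the two signs are nonnegative and sum to 4. *)
Let v4 i j b : v i j b <= 4.
Proof. have := v0 i j true; have := v0 i j false; rewrite !vE; case: b; lra. Qed.

Let etalin u t w : R := lin_comb (etav t) u w.
Let meanlin (u : 'cV[R]_K) : R := (u^T *m mu M) 0 0.

Let chi2_sum i j b w : R := \sum_t ((etalin (delta_mx i 0 + dsgn b j) t w -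
  meanlin (delta_mx i 0 + dsgn b j)) ^+ 2 - v i j b).

Let dsgnE i j b t w : etalin (delta_mx i 0 + dsgn b j) t w -
    meanlin (delta_mx i 0 + dsgn b j) =
  (etav t w i 0 - mu M i 0) + (if b then 1 else - 1) * (etav t w j 0 - mu M j 0).
Proof.
have md k : meanlin (delta_mx k 0) = mu M k 0.
  by rewrite /meanlin trmx_delta -rowE mxE.
rewrite /etalin lin_combD /=.
have -> : meanlin (delta_mx i 0 + dsgn b j) = mu M i 0 + (if b then 1 else -1) * mu M j 0.
  rewrite -!md /meanlin linearD/= mulmxDl mxE /dsgn; case: b; rewrite ?mul1r//.
  by rewrite linearN/= mulNmx [X in _ + X = _]mxE mulN1r.
have -> : lin_comb (etav t) (dsgn b j) w = (if b then 1 else -1) * etav t w j 0.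
  rewrite /dsgn; case: b; rewrite ?mul1r ?mulN1r.
    by rewrite lin_comb_delta.
  by rewrite /lin_comb linearN/= mulNmx mxE -[X in - X = _]/(lin_comb (etav t) _ w) lin_comb_delta.
by rewrite lin_comb_delta /=; case: (b); ring.
Qed.

Lemma latent_cov_polarization (y : R) w i j :
  (forall b, `|chi2_sum i j b w| <= y) ->
  `|latent_cov w i j - S i j| <= y / (2 * n%:R).
Proof.
move=> H; have n0' : (0 : R) < n%:R by rewrite ltr0n.
have E : latent_cov w i j - S i j =
    (chi2_sum i j true w - chi2_sum i j false w) / (4 * n%:R).
  rewrite mxE /chi2_sum -sumrB.
  under [in RHS]eq_bigr do rewrite !dsgnE !vE.
  set a := fun t => etav t w i 0 - mu M i 0; set c := fun t => etav t w j 0 - mu M j 0.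
  have -> : \sum_t ((a t + 1 * c t) ^+ 2 - (2 + 2 * S i j) -
       ((a t + -1 * c t) ^+ 2 - (2 + - 2 * S i j))) =
      \sum_t (4 * (a t * c t)) - n%:R * (4 * S i j).
    have -> : n%:R * (4 * S i j) = \sum_(t < n) (4 * S i j).
      by rewrite sumr_const card_ord -[RHS]mulr_natl.
    rewrite -sumrB.
    by apply: eq_bigr => t _; ring.
  rewrite -mulr_sumr; field; rewrite gt_eqF//.
rewrite E normrM [`|(_ * _)^-1|]ger0_norm; last by rewrite invr_ge0; lra.
have := ler_normB (chi2_sum i j true w) (chi2_sum i j false w).
have := H true; have := H false => h1 h2 h3.
rewrite ler_pdivrMr; last by lra.
have -> : y / (2 * n%:R) * (4 * n%:R) = 2 * y by field; rewrite gt_eqF.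
lra.
Qed.

(** As the variance is at most 4, q <= 1/16 ensures 2 q v <= 1/2, and 4 (q v)^2 is at most 64
    q^2. *)
Lemma chi2_sum_tail (q y : R) i j b : 0 < q <= 1 / 16 ->
  measurable [set w | y < `|chi2_sum i j b w|] /\
  (P [set w | (y < `|chi2_sum i j b w|)%R] <=
   (2 * expR (- (q * y) + 64 * q ^+ 2 * n%:R))%:E)%E.
Proof.
move=> /andP[q0 q1].
set u := delta_mx i 0 + dsgn b j.
have mX t : measurable_fun setT (etalin u t).
  by apply: measurable_lin_comb => k; exact: measurable_eta.
have mS : measurable_fun setT (chi2_sum i j b).
  apply: measurable_sum => t; apply: measurable_funB => //.
  by apply: measurable_funX; exact: measurable_funB.
split.
  rewrite (_ : mkset _ = (fun w => `|chi2_sum i j b w|) @^-1` `]y, +oo[%classic).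
    apply: measurable_preimage_rv; last exact: measurable_itv.
    exact: (measurableT_comp (@normr_measurable R setT) mS).
  by apply/seteqP; split=> w /=; rewrite in_itv/= andbT.
have v00 := v0 i j b; have v44 := v4 i j b.
have qv : q * v i j b <= q * 4 by rewrite ler_wpM2l// ltW.
have qv0 : 0 <= q * v i j b by rewrite mulr_ge0// ltW.
have := @chi2_tail _ _ R P 'I_n (etalin u) (meanlin u) (v i j b) mX v00 _ _ q y q0.
move=> /(_ _ _ _) H; apply: le_trans (H _ _ _) _.
- by move=> t B mB; exact: (lin_comb_law (@eta_normal R n M t) u mB).
- by move=> J B mB; exact: eta_lin_indep.
- by rewrite -mulrA; lra.
rewrite lee_fin ler_wpM2l// ler_expR lerD2l card_ord.
rewrite ler_wpM2r//.
have : (q * v i j b) ^+ 2 <= (q * 4) ^+ 2.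
  by apply: lerXn2r; rewrite ?nnegrE//; lra.
lra.
Qed.

Lemma eta_law t k (B : set R) : measurable B ->
  P ((fun w => etav t w k 0) @^-1` B) = normal_law (mu M k 0) 1 B.
Proof.
move=> mB; have nrm := @eta_normal R n M t.
have e1 : ((delta_mx k 0 : 'cV[R]_K)^T *m (design M *m beta M)) 0 0 = mu M k 0.
  by rewrite trmx_delta -rowE mxE.
have e2 : bform S (delta_mx k 0) (delta_mx k 0) = 1.
  by rewrite (bform_delta_r (multinormal_sym nrm)) -colE mxE S_diag.
have := lin_comb_law nrm (delta_mx k 0) mB.
by rewrite lin_comb_delta e1 e2.
Qed.

(** The prefactors count the union bounds: n K logits, n K frequencies, and K^2 pairs of blocks with
    two signs each. *)
Lemma concentration_event (V x q y : R) :
  0 <= V -> 0 < x <= 1 -> 0 < q <= 1 / 16 -> (0 < block_pairs_min M)%N ->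
  exists Bad : set (Omega M), [/\ measurable Bad,
    (P Bad <= (n%:R * K%:R * (2 * expR (- (V ^+ 2 / 4))) +
      n%:R * K%:R * (2 * expR (- ((block_pairs_min M)%:R * x ^+ 2 / 4))) +
      2 * K%:R ^+ 2 * (2 * expR (- (q * y) + 64 * q ^+ 2 * n%:R)))%:E)%E &
    forall w, ~ Bad w ->
      [/\ forall t k, `|etav t w k 0 - mu M k 0| <= V,
          forall t k, `|p_tilde t w k - pmat t w k k| <= x &
          forall i j, `|latent_cov w i j - S i j| <= y / (2 * n%:R)]].
Proof.
move=> V0 x01 q01 m0.
pose A1 (tk : 'I_n * 'I_K) := [set w | V < `|etav tk.1 w tk.2 0 - mu M tk.2 0|].
pose A2 (tk : 'I_n * 'I_K) := [set w | x < `|p_tilde tk.1 w tk.2 - pmat tk.1 w tk.2 tk.2|].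
pose A3 (ijb : ('I_K * 'I_K) * bool) := [set w | y < `|chi2_sum ijb.1.1 ijb.1.2 ijb.2 w|].
have mgt (f : Omega M -> R) c : measurable_fun setT f ->
    measurable [set w | c < `|f w|].
  move=> mf; rewrite (_ : mkset _ = (fun w => `|f w|) @^-1` `]c, +oo[%classic).
    apply: measurable_preimage_rv; last exact: measurable_itv.
    exact: (measurableT_comp (@normr_measurable R setT) mf).
  by apply/seteqP; split=> w /=; rewrite in_itv/= andbT.
have mA1 tk : measurable (A1 tk).
  by apply: mgt; apply: measurable_funB => //; exact: measurable_eta.
have mA2 tk : measurable (A2 tk).
  by apply: mgt; apply: measurable_funB; [exact: measurable_p_tilde|exact: pmat_meas].
have mA3 ijb : measurable (A3 ijb) by case: (chi2_sum_tail y ijb.1.1 ijb.1.2 ijb.2 q01).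
have [m1 P1] := probability_exists_le P predT mA1.
have [m2 P2] := probability_exists_le P predT mA2.
have [m3 P3] := probability_exists_le P predT mA3.
set B1 := [set w | _] in m1 P1; set B2 := [set w | _] in m2 P2.
set B3 := [set w | _] in m3 P3.
exists (B1 `|` B2 `|` B3); split.
- by apply: measurableU => //; exact: measurableU.
- apply: (le_trans (measureU2 _ _ _)) => //; first exact: measurableU.
  rewrite EFinD; apply: leeD.
    apply: (le_trans (measureU2 _ _ _)) => //.
    rewrite EFinD; apply: leeD.
      apply: (le_trans P1); apply: (@le_trans _ _ (\sum_(tk : 'I_n * 'I_K) (2 * expR (- (V ^+ 2 / 4)))%:E)%E).
        apply: lee_sum => -[t k] _; rewrite /A1/=.
        apply: normal_tail => //; first exact: measurable_eta.
        exact: eta_law.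
      by rewrite sumEFin sumr_const card_prod !card_ord -[_ *+ (_ * _)]mulr_natl natrM.
    apply: (le_trans P2); apply: (@le_trans _ _ (\sum_(tk : 'I_n * 'I_K)
        (2 * expR (- ((block_pairs_min M)%:R * x ^+ 2 / 4)))%:E)%E).
      apply: lee_sum => -[t k] _; rewrite /A2/=.
      have mk : (0 < block_pairs k)%N by apply: leq_trans m0 _; exact: block_pairs_min_le.
      apply: le_trans (p_tilde_tail t x01 mk) _.
      rewrite lee_fin ler_wpM2l// ler_expR lerN2 -!mulrA ler_wpM2r//.
        by rewrite mulrA divr_ge0// -expr2 sqr_ge0.
      by rewrite ler_nat block_pairs_min_le.
    by rewrite sumEFin sumr_const card_prod !card_ord -[_ *+ (_ * _)]mulr_natl natrM.
  apply: (le_trans P3); apply: (@le_trans _ _ (\sum_(ijb : ('I_K * 'I_K) * bool)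
      (2 * expR (- (q * y) + 64 * q ^+ 2 * n%:R))%:E)%E).
    by apply: lee_sum => -[[i j] b] _; case: (chi2_sum_tail y i j b q01).
  rewrite sumEFin sumr_const !card_prod !card_ord card_bool lee_fin.
  rewrite -[leLHS]mulr_natl !natrM le_eqVlt; apply/orP; left; apply/eqP; ring.
- move=> w nB; split=> [t k|t k|i j].
  + by rewrite leNgt; apply/negP => h; apply: nB; left; left; exists (t, k).
  + by rewrite leNgt; apply/negP => h; apply: nB; left; right; exists (t, k).
  + apply: latent_cov_polarization => b.
    by rewrite leNgt; apply/negP => h; apply: nB; right; exists ((i, j), b).
Qed.

End model_concentration.

(** * Recovery of the edge set *)

Section edge_set_measurable.
Context (R : realType) (n : nat) (M : network_model R n) (tn : R)
  (lam : 'I_(blocks M) -> R -> R)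
  (thh : 'I_(blocks M) -> Omega M -> 'cV[R]_(blocks M)).
Local Notation K := (blocks M).
Hypothesis lam_incr : forall a x y, 0 <= x -> x <= y -> lam a x <= lam a y.
Hypothesis mthh : forall a b, measurable_fun setT (fun w => thh a w b 0).

(** Monotone functions are Borel, but [lam a] is monotone only on [0, +oo[; composing with the
    maximum with 0 extends it without changing its values at norms. *)
Lemma measurable_lam_norm1 a :
  measurable_fun setT (fun w => lam a (norm1 (thh a w))).
Proof.
pose f x := lam a (Num.max 0 x).
have mf : measurable_fun setT f.
  apply: nondecreasing_measurable => // x y xy; apply: lam_incr.
    by rewrite le_max lexx.
  by rewrite ge_max !le_max lexx xy orbT.
have mn : measurable_fun setT (fun w => norm1 (thh a w)).
  by apply: measurable_sum => k; apply: (measurableT_comp (@normr_measurable R setT)).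
have -> : (fun w => lam a (norm1 (thh a w))) = f \o (fun w => norm1 (thh a w)).
  apply/funext => w; rewrite /f/= (elimT max_idPr _)//.
  by apply: sumr_ge0.
exact: measurableT_comp.
Qed.

Lemma measurable_mem_ne_hat a b :
  measurable [set w | b \in ne_hat tn lam (thh ^~ w) a].
Proof.
have [->|ba] := eqVneq b a.
  rewrite (_ : mkset _ = set0) //; apply/seteqP; split=> // w /=.
  by rewrite inE mxE eqxx/= eqxx.
pose g w := `|thh a w b 0| - tn * lam a (norm1 (thh a w)).
have mg : measurable_fun setT g.
  apply: measurable_funB.
    exact: (measurableT_comp (@normr_measurable R setT) (mthh a b)).
  by apply: measurable_funM => //; exact: measurable_lam_norm1.
rewrite (_ : mkset _ = (g @^-1` `]0, +oo[%classic) `&` (fun w => thh a w b 0) @^-1` (~` [set 0])).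
  apply: measurableI; apply: measurable_preimage_rv => //.
  exact: measurableC.
have e w : (b \in ne_hat tn lam (thh ^~ w) a) =
    (tn * lam a (norm1 (thh a w)) < `|thh a w b 0|) && (thh a w b 0 != 0).
  by rewrite inE mxE ba/=; case: ifP; rewrite ?eqxx.
apply/seteqP; split=> w /=; rewrite e in_itv/= andbT subr_gt0.
  by move=> /andP[-> /eqP].
by move=> [-> /eqP].
Qed.

(** The Boolean operation [op] covers both estimators; the event is a finite intersection over pairs
    of finite unions over truth values. *)
Lemma measurable_edge_set_eq (op : bool -> bool -> bool) (E : {set 'I_K * 'I_K}) :
  measurable [set w | [set ab | op (ab.1 \in ne_hat tn lam (thh ^~ w) ab.2)
    (ab.2 \in ne_hat tn lam (thh ^~ w) ab.1)]%SET = E].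
Proof.
have mb a b (c : bool) : measurable [set w | (b \in ne_hat tn lam (thh ^~ w) a) = c].
  case: c; first exact: measurable_mem_ne_hat.
  rewrite (_ : mkset _ = ~` [set w | b \in ne_hat tn lam (thh ^~ w) a]).
    by apply: measurableC; exact: measurable_mem_ne_hat.
  by apply/seteqP; split=> w /= => [->//|/negP/negbTE].
pose A (ab : 'I_K * 'I_K) (c : bool * bool) : set (Omega M) :=
  [set w | (ab.1 \in ne_hat tn lam (thh ^~ w) ab.2) = c.1] `&`
  [set w | (ab.2 \in ne_hat tn lam (thh ^~ w) ab.1) = c.2].
have mA ab c : measurable (A ab c) by exact: measurableI.
rewrite (_ : mkset _ = \bigcap_(ab in [set` [set: 'I_K * 'I_K]%SET])
  [set w | exists2 c : bool * bool, op c.1 c.2 == (ab \in E) & A ab c w]).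
  apply: fin_bigcap_measurable => [|ab _]; first exact: finite_finset.
  by case: (probability_exists_le (Pr M) (fun c => op c.1 c.2 == (ab \in E)) (mA ab)).
apply/seteqP; split=> w /=.
  move=> <- [a b] _ /=.
  exists (a \in ne_hat tn lam (thh ^~ w) b, b \in ne_hat tn lam (thh ^~ w) a) => //=.
  by rewrite [X in _ == X]finset.in_set.
move=> H; apply/setP => -[a b]; rewrite inE/=.
have := H (a, b); rewrite /= inE => /(_ isT) [[c1 c2] /= /eqP <- [/= h1 h2]].
by rewrite -h1 -h2.
Qed.

End edge_set_measurable.

Section edge_recovery.
Context (R : realType) (n : nat) (M : network_model R n).
Local Notation K := (blocks M).
Local Notation P := (Pr M).
Local Notation D := (precision M).
Context (lam : 'I_K -> R -> R) (th : 'I_K -> 'cV[R]_K) (parcor : 'I_K -> 'I_K -> R).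
Hypothesis n_gt0 : (0 < n)%N.
Hypothesis parcor_def : forall (t : 'I_n) (a b : 'I_K), a != b ->
  is_partial_corr P (eta_coord M t) a b (parcor a b).
Hypothesis theta_def : forall a, is_regression_coef M a (th a).
Hypothesis var1 : forall (t : 'I_n) a, ('V_P[eta_coord M t a] = 1)%E.
Let t0 := Ordinal n_gt0.
Let meta k : measurable_fun setT (fun w => @Defs.eta R n M t0 w k 0).
Proof. exact: measurable_eta. Qed.
Let nrm := @eta_normal R n M t0.
Let sS := multinormal_sym nrm.
Let pS u := multinormal_ge0 nrm u.
Let uS := @Sigma_nonsingular R n M.

Lemma Sigma_diag k : Sigma M k k = 1.
Proof.
have := lin_comb_variance meta nrm (delta_mx k 0); rewrite lin_comb_delta.
rewrite [LHS](var1 t0 k) => -[->].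
by rewrite (bform_delta_r sS) -colE mxE.
Qed.

Lemma precision_diag_ge1 k : 1 <= D k k.
Proof. exact: (invmx_diag_ge1 sS pS uS (Sigma_diag k)). Qed.

Lemma precision_sym a b : D a b = D b a.
Proof. exact: (invmx_symE sS). Qed.

Lemma regression_residual_cov a c : c != a ->
  (Sigma M *m (delta_mx a 0 - th a)) c 0 = 0.
Proof.
move=> ca; have [tha ind] := theta_def a.
rewrite -(bform_delta_r sS); apply: (multinormal_indep_bform0 meta nrm) => A B mA mB.
set u := delta_mx a 0 - th a.
have E : (fun w => lin_comb (@Defs.eta R n M t0) u w - (u^T *m (design M *m beta M)) 0 0) =
   (fun w => @Defs.eta R n M t0 w a 0 - mu M a 0
     - \sum_(b | b != a) th a b 0 * (@Defs.eta R n M t0 w b 0 - mu M b 0)).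
  apply/funext => w.
  have -> : (u^T *m (design M *m beta M)) 0 0 = \sum_k u k 0 * mu M k 0.
    by rewrite mxE; apply: eq_bigr => k _; rewrite mxE.
  rewrite lin_combE -sumrB (bigD1 a)//= [u a 0]mxE [delta_mx a 0 a 0]mxE !eqxx mxE tha subr0 !mul1r.
  congr (_ + _); rewrite -sumrN; apply: eq_bigr => b ba.
  by rewrite [u b 0]mxE [delta_mx a 0 b 0]mxE (negbTE ba) [(- th a) b 0]mxE /= sub0r !mulNr mulrBr opprB opprK addrC.
rewrite E; apply: ind t0 _ _ _ _.
  by exists A => //; rewrite setTI.
exact: (@sigma_rv_preimage _ _ _ _ [set b | b != a] (eta_coord M t0) c).
Qed.

Lemma theta_normal_eq a b : b != a -> Sigma M b a = \sum_j Sigma M b j * th a j 0.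
Proof.
move=> ba; have := regression_residual_cov ba.
rewrite mulmxBr mxE [X in _ + X]mxE -colE [col _ _ _ _]mxE.
by move=> /eqP; rewrite subr_eq0 => /eqP ->; rewrite mxE.
Qed.

Lemma theta_precision a b : b != a -> th a b 0 = - (D a b / D a a).
Proof.
move=> ba; have [tha _] := theta_def a.
apply: (bform_regression sS uS _ tha) => //.
  by rewrite gt_eqF//; apply: lt_le_trans (precision_diag_ge1 a).
by move=> c ca; exact: regression_residual_cov.
Qed.

Lemma parcor_precision a b : a != b ->
  parcor a b ^+ 2 * (D a a * D b b) = D a b ^+ 2.
Proof.
move=> ab; apply: (multinormal_partial_corr meta nrm ab uS).
- by apply: lt_le_trans (precision_diag_ge1 a).
- by apply: lt_le_trans (precision_diag_ge1 b).
- exact: parcor_def.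
Qed.

Context (lmin T tn C : R).
Hypothesis D_row : max_row_sum D <= C.
Hypothesis lam_incr : forall a x y, 0 <= x -> x <= y -> lam a x <= lam a y.
Hypothesis lam_ge : forall a (x : 'cV[R]_K), x a 0 = 0 -> lmin <= lam a (norm1 x).
Hypothesis lmin_gt0 : 0 < lmin.

Lemma precision_row i : \sum_j `|D i j| <= C.
Proof.
apply: le_trans D_row; rewrite /max_row_sum.
exact: (le_bigmax _ (fun i => \sum_j `|D i j|) i).
Qed.

Lemma precision_abs_le i j : `|D i j| <= C.
Proof.
apply: le_trans (precision_row i); rewrite (bigD1 j)//= lerDl.
exact: sumr_ge0.
Qed.

Lemma precision_bound_ge1 (a : 'I_K) : 1 <= C.
Proof.
apply: le_trans (precision_diag_ge1 a) _; apply: le_trans (precision_abs_le a a).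
exact: ler_norm.
Qed.

(** The ratio |pi_ab|/|theta_b| is sqrt(D_aa/D_bb), at most C because D_bb >= 1 and D_aa <= C with C
    >= 1. The comparison is made between squares. *)
Lemma theta_lower_bound a b : a != b -> `|parcor a b| <= C * `|th a b 0|.
Proof.
move=> ab; have C1 := precision_bound_ge1 a.
have Da := precision_diag_ge1 a; have Db := precision_diag_ge1 b.
have DaC : D a a <= C by apply: le_trans (precision_abs_le a a); exact: ler_norm.
have thE : D a a * `|th a b 0| = `|D a b|.
  rewrite theta_precision 1?eq_sym// normrN normrM normfV.
  rewrite [`|D a a|]ger0_norm; last lra.
  by rewrite mulrC divfK// gt_eqF//; lra.
have C0 : 0 <= C * `|th a b 0| by rewrite mulr_ge0//; lra.
rewrite -(@ler_pXn2r _ 2)// ?nnegrE// real_normK ?num_real// exprMn.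
have h := parcor_precision ab.
have h2 : parcor a b ^+ 2 * (D a a * D b b) = D a a ^+ 2 * `|th a b 0| ^+ 2.
  by rewrite h -[LHS]real_normK ?num_real// -thE exprMn.
have h3 : parcor a b ^+ 2 * D b b = D a a * `|th a b 0| ^+ 2.
  have Da0 : D a a != 0 by rewrite gt_eqF//; lra.
  by apply: (mulfI Da0); rewrite [RHS]mulrA -expr2 -h2; ring.
have s1 : 0 <= parcor a b ^+ 2 by exact: sqr_ge0.
have s2 : 0 <= `|th a b 0| ^+ 2 by exact: sqr_ge0.
have h4 : parcor a b ^+ 2 <= parcor a b ^+ 2 * D b b by rewrite ler_peMr.
have h5 : D a a * `|th a b 0| ^+ 2 <= C ^+ 2 * `|th a b 0| ^+ 2.
  by rewrite ler_wpM2r//; nra.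
lra.
Qed.

Context (thh : 'I_K -> Omega M -> 'cV[R]_K).
Hypothesis mthh : forall a b, measurable_fun setT (fun w => thh a w b 0).
Hypothesis thh_sol : forall a w, is_dantzig M T lam a w (thh a w).
Context (V U x q y La pc : R).
Hypothesis V0 : 0 <= V.
Hypothesis x01 : 0 < x <= 1.
Hypothesis q01 : 0 < q <= 1 / 16.
Hypothesis y0 : 0 <= y.
Hypothesis m0 : (0 < block_pairs_min M)%N.
Hypothesis VU : V + mu_B M <= U.
Hypothesis UT : U <= T.
Hypothesis xU : 8 * x * expR U <= 1.
Hypothesis err_lmin :
  (8 * x * expR U * (2 * V + 1) + y / (2 * n%:R)) * (1 + C) <= lmin.
Hypothesis C_tn : 4 * C ^+ 2 <= tn.
Hypothesis La_lam : forall a, lam a (norm1 (th a)) <= La.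
Hypothesis beta_min : (4 * C ^+ 2 + tn) * La * C < pc.
Hypothesis pc_parcor : forall a b, (a, b) \in edges M -> pc <= `|parcor a b|.

Definition failure_bound : R :=
  n%:R * K%:R * (2 * expR (- (V ^+ 2 / 4))) +
  n%:R * K%:R * (2 * expR (- ((block_pairs_min M)%:R * x ^+ 2 / 4))) +
  2 * K%:R ^+ 2 * (2 * expR (- (q * y) + 64 * q ^+ 2 * n%:R)).

Lemma edge_recovery :
  `|1 - fine (P [set w | E_hat_and tn lam (thh ^~ w) = edges M])| <= failure_bound /\
  `|1 - fine (P [set w | E_hat_or tn lam (thh ^~ w) = edges M])| <= failure_bound.
Proof.
have [Bad [mBad PBad good]] :=
  concentration_event n_gt0 Sigma_diag y V0 x01 q01 m0.
have rec w : ~ Bad w -> E_hat_and tn lam (thh ^~ w) = edges M /\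
    E_hat_or tn lam (thh ^~ w) = edges M.
  move=> /good [g1 g2 g3].
  apply: E_hat_recovers => [a b|a]; first exact: precision_sym.
  have eU : forall t k, `|@Defs.eta R n M t w k 0| <= U.
    move=> t k; apply: le_trans VU.
    rewrite -[X in `|X|](subrK (mu M k 0)); apply: le_trans (ler_normD _ _) _.
    by apply: lerD => //; exact: (le_bigmax _ (fun k => `|mu M k 0|) k).
  have g4 t k : `|eta_hat T t w k - @Defs.eta R n M t w k 0| <= 8 * x * expR U.
    exact: eta_hat_close (g2 t k) (eU t k) UT xU.
  have [tha _] := theta_def a.
  have De0 : 0 <= 8 * x * expR U.
    by rewrite !mulr_ge0 ?expR_ge0//; have /andP[/ltW] := x01.
  pose r := 8 * x * expR U * (2 * V + 1) + y / (2 * n%:R).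
  have r0 : 0 <= r.
    rewrite addr_ge0// ?divr_ge0//; first by rewrite mulr_ge0// addr_ge0// mulr_ge0.
  have Sc i j : `|sample_cov T w i j - Sigma M i j| <= r.
    rewrite -(subrKA (latent_cov w i j)).
    apply: le_trans (ler_normD _ _) _; apply: lerD; last exact: g3.
    (* In the bound De (2 V + De) the last De is replaced by 1, which is the condition [xU]. *)
    apply: le_trans (sample_cov_close n_gt0 g1 g4 i j) _.
    by rewrite ler_wpM2l// lerD2l.
  apply: (ne_hat_recovers (thh := thh ^~ w) uS precision_row (precision_diag_ge1 a)
    r0 Sc tha (@theta_normal_eq a) (@theta_precision a) (@lam_incr a) (@lam_ge a)
    lmin_gt0 err_lmin C_tn) => // b.
  rewrite inE => /andP[ba Dab].
  have ab : a != b by rewrite eq_sym.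
  have e : (a, b) \in edges M by rewrite inE/= ab Dab.
  have C1 := precision_bound_ge1 a.
  rewrite -(@ltr_pM2l _ C); last lra.
  apply: lt_le_trans (theta_lower_bound ab); apply: lt_le_trans (pc_parcor e).
  apply: le_lt_trans beta_min; rewrite mulrC ler_pM2r; last lra.
  have C20 : 0 <= 4 * C ^+ 2 by apply: mulr_ge0 => //; exact: sqr_ge0.
  by rewrite ler_wpM2l// addr_ge0// (le_trans C20).
have fin (E : set (Omega M)) : measurable E -> (forall w, ~ Bad w -> E w) ->
    `|1 - fine (P E)| <= failure_bound.
  move=> mE BE.
  have fE : P E = (fine (P E))%:E by rewrite fineK// fin_num_measure.
  have E1 : (P E <= 1)%E by exact: probability_le1.
  have fB : P Bad = (fine (P Bad))%:E by rewrite fineK// fin_num_measure.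
  have hE : (P (~` Bad) <= P E)%E.
    by apply: le_measure; rewrite ?inE//; exact: measurableC.
  rewrite probability_setC// fE fB -EFinB lee_fin in hE.
  rewrite fE lee_fin in E1.
  move: PBad; rewrite fB lee_fin -/failure_bound => h.
  by rewrite ger0_norm; lra.
split; apply: fin.
- exact: (measurable_edge_set_eq tn lam_incr mthh andb (edges M)).
- by move=> w /rec[].
- exact: (measurable_edge_set_eq tn lam_incr mthh orb (edges M)).
- by move=> w /rec[].
Qed.

End edge_recovery.

(** * Asymptotics *)

Section growth.
Context (R : realType).
Implicit Types (s h L : R).

(** The cubic term (s L)^3/6 of the exponential series beats L^2, which gives the explicit threshold
    on L. *)
Lemma sqr_expRN_small s h : 0 < s -> 0 < h ->
  exists2 L0, 1 <= L0 & forall L, L0 <= L -> L ^+ 2 * expR (- (s * L)) <= h.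
Proof.
move=> s0 h0; have s30 : 0 < s ^+ 3 by rewrite exprn_gt0.
have den : 0 < s ^+ 3 * h by rewrite mulr_gt0.
exists (1 + 6 / (s ^+ 3 * h)) => [|L hL]; first by rewrite lerDl divr_ge0// ltW.
have d0 : 0 <= 6 / (s ^+ 3 * h) by rewrite divr_ge0// ltW.
have L1 : 1 <= L by lra.
have hL' : 6 <= L * (s ^+ 3 * h) by rewrite -ler_pdivrMr//; lra.
have sL : 0 <= s * L by rewrite mulr_ge0//; lra.
have e := expR_ge1Dxn 2 sL.
have fact3 : (3`!)%:R = 6 :> R by [].
rewrite fact3 in e.
have e0 := expR_gt0 (s * L).
rewrite expRN ler_pdivrMr//.
have e3 : (s * L) ^+ 3 / 6 <= expR (s * L) by apply: le_trans e; rewrite lerDr.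
apply: (@le_trans _ _ (h * ((s * L) ^+ 3 / 6))); last by rewrite ler_wpM2l// ltW.
have -> : h * ((s * L) ^+ 3 / 6) = L ^+ 2 * (L * (s ^+ 3 * h)) / 6 by field.
rewrite ler_pdivlMr// ler_wpM2l// sqr_ge0//.
Qed.

(** Here L = log n, V = de L, x = n^(-nu/2) L, q = n^(-1/2) and y = n^(1/2) L^2, so that m x^2 >=
    L^2/Cm, q y = L^2 and 64 q^2 n = 64, the source of exp 64. In each term half of the exponent
    absorbs the polynomial prefactor and the other half is at least c L^2. *)
Lemma tail_sum_le (L de g nu CK Cm n K m c : R) :
  0 < g -> 0 <= K -> n = expR L -> K <= CK * expR (g * L) ->
  0 < Cm -> expR (nu * L) / Cm <= m ->
  0 < L -> (1 + g) * 8 <= de ^+ 2 * L -> (1 + g) * (8 * Cm) <= L -> 4 * g <= L ->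
  c <= de ^+ 2 / 8 -> c <= (8 * Cm)^-1 -> c <= 1 / 2 ->
  n * K * (2 * expR (- ((de * L) ^+ 2 / 4))) +
  n * K * (2 * expR (- (m * (expR (- (nu / 2 * L)) * L) ^+ 2 / 4))) +
  2 * K ^+ 2 * (2 * expR (- (expR (- (L / 2)) * (expR (L / 2) * L ^+ 2)) +
    64 * expR (- (L / 2)) ^+ 2 * n)) <=
  (4 * CK + 4 * CK ^+ 2 * expR 64) * expR (- c * L ^+ 2).
Proof.
move=> g0 K0 nE KC Cm0 mC L0 h1 h2 h3 c1 c2 c3.
have L20 : 0 <= L ^+ 2 by exact: sqr_ge0.
have CK0 : 0 <= CK.
  by have := le_trans K0 KC; rewrite pmulr_lge0 ?expR_gt0.
have nK : n * K <= CK * expR ((1 + g) * L).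
  by rewrite nE mulrDl mul1r expRD mulrCA ler_wpM2l// expR_ge0.
have e0 := expR_ge0 (- c * L ^+ 2).
have t1 : n * K * (2 * expR (- ((de * L) ^+ 2 / 4))) <=
    2 * CK * expR (- c * L ^+ 2).
  apply: (@le_trans _ _ (CK * expR ((1 + g) * L) * (2 * expR (- ((de * L) ^+ 2 / 4))))).
    by rewrite ler_wpM2r// mulr_ge0 ?expR_ge0.
  rewrite mulrACA -expRD (mulrC CK) ler_wpM2l ?mulr_ge0// ler_expR.
  have a1 : (1 + g) * 8 * L <= de ^+ 2 * L * L by rewrite ler_wpM2r// ltW.
  have a2 : c * L ^+ 2 <= de ^+ 2 / 8 * L ^+ 2 by rewrite ler_wpM2r.
  lra.
have t2 : n * K * (2 * expR (- (m * (expR (- (nu / 2 * L)) * L) ^+ 2 / 4))) <=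
    2 * CK * expR (- c * L ^+ 2).
  apply: (@le_trans _ _ (CK * expR ((1 + g) * L) * (2 * expR (- (L ^+ 2 / (4 * Cm)))))).
    rewrite ler_pM ?mulr_ge0 ?expR_ge0//; first by rewrite nE expR_ge0.
    rewrite ler_wpM2l// ler_expR lerN2.
    have -> : (expR (- (nu / 2 * L)) * L) ^+ 2 = expR (- (nu * L)) * L ^+ 2.
      by rewrite exprMn -expRM_natr; congr (expR _ * _); field.
    have a1 : expR (nu * L) / Cm * expR (- (nu * L)) <= m * expR (- (nu * L)).
      by rewrite ler_wpM2r// expR_ge0.
    rewrite mulrAC -expRD subrr expR0 mul1r in a1.
    have a2 : Cm^-1 * L ^+ 2 <= m * expR (- (nu * L)) * L ^+ 2 by rewrite ler_wpM2r.
    rewrite invfM; lra.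
  rewrite mulrACA -expRD (mulrC CK) ler_wpM2l ?mulr_ge0// ler_expR.
  have a1 : (1 + g) * L <= (8 * Cm)^-1 * L * L.
    rewrite ler_wpM2r ?(ltW L0)// ler_pdivlMl ?mulr_gt0//; lra.
  have a2 : c * L ^+ 2 <= (8 * Cm)^-1 * L ^+ 2 by rewrite ler_wpM2r.
  have -> : L ^+ 2 / (4 * Cm) = 2 * ((8 * Cm)^-1 * L ^+ 2) by field; rewrite gt_eqF.
  lra.
have t3 : 2 * K ^+ 2 * (2 * expR (- (expR (- (L / 2)) * (expR (L / 2) * L ^+ 2)) +
    64 * expR (- (L / 2)) ^+ 2 * n)) <= 4 * CK ^+ 2 * expR 64 * expR (- c * L ^+ 2).
  have -> : expR (- (L / 2)) * (expR (L / 2) * L ^+ 2) = L ^+ 2.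
    by rewrite mulrA -expRD addNr expR0 mul1r.
  have -> : 64 * expR (- (L / 2)) ^+ 2 * n = 64.
    rewrite nE -mulrA -expRM_natr -expRD.
    by rewrite (_ : - (L / 2) * 2 + L = 0) ?expR0 ?mulr1//; field.
  have K2 : K ^+ 2 <= CK ^+ 2 * expR (2 * g * L).
    rewrite (_ : 2 * g * L = g * L * 2); last by ring.
    rewrite expRM_natr -exprMn; apply: lerXn2r => //; rewrite nnegrE//.
    exact: le_trans KC.
  apply: (@le_trans _ _ (2 * (CK ^+ 2 * expR (2 * g * L)) * (2 * expR (- L ^+ 2 + 64)))).
    by rewrite ler_wpM2r ?mulr_ge0 ?expR_ge0// ler_wpM2l.
  rewrite (_ : 2 * _ * _ = 4 * CK ^+ 2 * (expR (2 * g * L) * expR (- L ^+ 2 + 64))); last by ring.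
  rewrite -[leRHS]mulrA ler_wpM2l ?mulr_ge0 ?sqr_ge0// -!expRD ler_expR.
  have a1 : 4 * g * L <= L * L by rewrite ler_wpM2r// ltW.
  have a2 : c * L ^+ 2 <= 1 / 2 * L ^+ 2 by rewrite ler_wpM2r.
  lra.
by rewrite (mulrDl (4 * CK)); apply: lerD => //; lra.
Qed.

(** The slack exponents are [s1] for x exp U itself and [s2] for x exp U relative to n^(-(1-ep)/2),
    the order of the lower bound on lambda_n; the sampling error has slack ep/2. The constants [h2]
    and [h3] give each of the two errors half of the allowance. *)
Lemma growth_conditions (de nu ep C Cl : R) :
  0 < de -> 2 * de < nu / 2 -> 2 * de < (nu - 1 + ep) / 2 -> 0 < ep ->
  0 <= C -> 0 < Cl ->
  exists2 L0, 1 <= L0 & forall L, L0 <= L ->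
    let x := expR (- (nu / 2 * L)) * L in let U := 2 * de * L in
    let n := expR L in
    [/\ 0 < x <= 1, 8 * x * expR U <= 1 &
      (8 * x * expR U * (2 * (de * L) + 1) +
        expR (L / 2) * L ^+ 2 / (2 * n)) * (1 + C) <=
      expR (- ((1 - ep) / 2 * L)) / Cl].
Proof.
move=> de0 d1 d2 ep0 C0 Cl0.
pose s1 := nu / 2 - 2 * de; have s10 : 0 < s1 by rewrite subr_gt0.
pose s2 := (nu - 1 + ep) / 2 - 2 * de; have s20 : 0 < s2 by rewrite subr_gt0.
pose h2 := (2 * Cl * (8 * (2 * de + 1) * (1 + C)))^-1.
have h20 : 0 < h2 by rewrite invr_gt0 !mulr_gt0//; lra.
pose h3 := (Cl * (1 + C))^-1.
have h30 : 0 < h3 by rewrite invr_gt0 !mulr_gt0//; lra.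
have [L1 L11 H1] := @sqr_expRN_small s1 (1 / 8) s10 ltac:(lra).
have [L2 L21 H2] := @sqr_expRN_small s2 h2 s20 h20.
have [L3 L31 H3] := @sqr_expRN_small (ep / 2) h3 ltac:(lra) h30.
exists (L1 + L2 + L3) => [|L hL x U n]; first lra.
have {}H1 := H1 L ltac:(lra); have {}H2 := H2 L ltac:(lra).
have {}H3 := H3 L ltac:(lra).
have L1' : 1 <= L by lra.
have LL2 : L <= L ^+ 2 by rewrite expr2 ler_peMr; lra.
have x0 : 0 < x by rewrite mulr_gt0 ?expR_gt0; lra.
have xU : x * expR U = L * expR (- (s1 * L)).
  by rewrite /x mulrAC -expRD mulrC; congr (_ * expR _); rewrite /U /s1; field.
have xU8 : 8 * x * expR U <= 1.
  rewrite -mulrA xU.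
  have : L * expR (- (s1 * L)) <= L ^+ 2 * expR (- (s1 * L)) by rewrite ler_wpM2r ?expR_ge0.
  lra.
have U0 : 0 <= U by rewrite !mulr_ge0//; lra.
split=> //.
  rewrite x0/=; apply: (@le_trans _ _ (8 * x * expR U)) => //.
  have e1 : 1 <= expR U by rewrite -[leLHS]expR0 ler_expR.
  have : x * 1 <= x * expR U by rewrite ler_wpM2l// ltW.
  have : 0 <= x * expR U by rewrite mulr_ge0 ?expR_ge0 ?ltW.
  lra.
set E := expR (- ((1 - ep) / 2 * L)).
have E0 : 0 < E by exact: expR_gt0.
have y_n : expR (L / 2) * L ^+ 2 / (2 * n) = E * (L ^+ 2 * expR (- (ep / 2 * L))) / 2.
  rewrite invfM -expRN /E [X in _ = X / 2]mulrCA -expRD.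
  rewrite (_ : - ((1 - ep) / 2 * L) + - (ep / 2 * L) = L / 2 - L); last by field.
  rewrite expRD; ring.
have e1 : expR (- (s1 * L)) = E * expR (- (s2 * L)).
  by rewrite -expRD; congr expR; rewrite /s1 /s2; field.
have b1 : 8 * x * expR U * (2 * (de * L) + 1) <=
    E * (8 * (2 * de + 1) * (L ^+ 2 * expR (- (s2 * L)))).
  rewrite -(mulrA 8) xU e1.
  rewrite [leRHS](_ : _ = 8 * (L * (E * expR (- (s2 * L)))) * ((2 * de + 1) * L)); last by ring.
  rewrite ler_wpM2l ?mulr_ge0 ?expR_ge0//; lra.
have b2 : 8 * (2 * de + 1) * (L ^+ 2 * expR (- (s2 * L))) * (1 + C) <= (2 * Cl)^-1.
  have k : 0 < 8 * (2 * de + 1) * (1 + C) by rewrite !mulr_gt0//; lra.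
  have : 8 * (2 * de + 1) * (1 + C) * (L ^+ 2 * expR (- (s2 * L))) <=
      8 * (2 * de + 1) * (1 + C) * h2 by rewrite ler_wpM2l// ltW.
  have -> : 8 * (2 * de + 1) * (1 + C) * h2 = (2 * Cl)^-1.
    by rewrite /h2; field; rewrite !gt_eqF//; lra.
  by move=> h; apply: le_trans h; rewrite le_eqVlt; apply/orP; left; apply/eqP; ring.
have b3 : L ^+ 2 * expR (- (ep / 2 * L)) / 2 * (1 + C) <= (2 * Cl)^-1.
  have : (1 + C) * (L ^+ 2 * expR (- (ep / 2 * L))) <= (1 + C) * h3.
    by rewrite ler_wpM2l//; lra.
  have -> : (1 + C) * h3 = 2 * (2 * Cl)^-1.
    by rewrite /h3; field; rewrite !gt_eqF//; lra.
  lra.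
rewrite y_n.
apply: (@le_trans _ _ (E * (8 * (2 * de + 1) * (L ^+ 2 * expR (- (s2 * L)))) * (1 + C) +
   E * (L ^+ 2 * expR (- (ep / 2 * L))) / 2 * (1 + C))).
  by rewrite -mulrDl ler_wpM2r ?lerD2r//; lra.
have c1 := ler_wpM2l (ltW E0) b2; have c2 := ler_wpM2l (ltW E0) b3.
have -> : E / Cl = E * (2 * Cl)^-1 + E * (2 * Cl)^-1 by field; rewrite gt_eqF.
apply: lerD; first by rewrite -mulrA.
by apply: le_trans c2; rewrite !mulrA.
Qed.

(** The three bounds make x exp U vanish, keep the logit error below lambda_n, and keep 2 de log n
    below T_n. They leave room because nu > 0 and nu - 1 + ep > 2 kap >= 0. *)
Lemma rate_exists (nu ep kap xi rd : R) : 0 <= kap -> xi <= 1 ->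
  1 - xi + 2 * kap < nu -> 1 + 2 * kap - nu < ep -> 0 < rd ->
  exists2 de, 0 < de &
    [/\ 2 * de < nu / 2, 2 * de < (nu - 1 + ep) / 2 & 2 * de <= rd / 2].
Proof.
move=> k0 x1 n1 e1 rd0.
exists (Num.min (Num.min (nu / 8) ((nu - 1 + ep) / 8)) (rd / 4)).
  by rewrite !lt_min; apply/andP; split; [apply/andP; split|]; lra.
set de := Num.min _ _.
have de1 : de <= nu / 8 by rewrite !ge_min lexx.
have de2 : de <= (nu - 1 + ep) / 8 by rewrite !ge_min lexx orbT.
have de3 : de <= rd / 4 by rewrite !ge_min lexx orbT.
by split; lra.
Qed.

(** At L = 10 the bound exp(L/2) >= 1 + 5^3/6 already exceeds 16. *)
Lemma expRN_half_le L : 10 <= L -> 0 < expR (- (L / 2)) <= 1 / 16.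
Proof.
move=> L10; rewrite expR_gt0/= expRN -div1r ler_pdivrMr ?expR_gt0//.
have e := @expR_ge1Dxn R (L / 2) 2 ltac:(lra).
rewrite (_ : (3`!)%:R = 6 :> R)// in e.
have : 5 ^+ 3 <= (L / 2) ^+ 3.
  by apply: lerXn2r; rewrite ?nnegrE; lra.
by move: e; set z := (L / 2) ^+ 3 => e z125; lra.
Qed.

(** The factor L from t_n = O(log n) cancels the inverse logarithm in the rate of lambda at the true
    coefficients; the 2 in the constant leaves a strict gap. *)
Lemma threshold_gap (C Ct tn La c0 E L : R) :
  0 < C -> 0 < Ct -> 0 < tn -> tn <= Ct * L -> 1 <= L -> 0 <= La ->
  0 < c0 -> 0 < E -> La <= c0 / ((4 * C ^+ 2 + Ct) * C * 2) * (E / L) ->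
  (4 * C ^+ 2 + tn) * La * C < c0 * E.
Proof.
move=> C0 Ct0 tn0 tnL L1 La0 c00 E0 hLa.
have C2 : 0 < 4 * C ^+ 2 by rewrite mulr_gt0// exprn_gt0.
have L0 : 0 < L by lra.
have b1 : 4 * C ^+ 2 + tn <= (4 * C ^+ 2 + Ct) * L.
  have : 4 * C ^+ 2 * 1 <= 4 * C ^+ 2 * L by rewrite ler_wpM2l// ltW.
  lra.
have b2 := ler_pM (ltW (addr_gt0 C2 tn0)) La0 b1 hLa.
have b3 : (4 * C ^+ 2 + Ct) * L * (c0 / ((4 * C ^+ 2 + Ct) * C * 2) * (E / L)) * C
    = c0 * E / 2.
  by field; rewrite !gt_eqF// addr_gt0.
have b4 : (4 * C ^+ 2 + tn) * La * C <= c0 * E / 2.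
  by rewrite -b3 ler_wpM2r// ltW.
have : 0 < c0 * E by rewrite mulr_gt0.
lra.
Qed.

End growth.

Lemma near_ln_ge (R : realType) (L0 : R) : \forall n \near \oo, L0 <= ln (n%:R : R).
Proof.
near=> n; rewrite -[leLHS]expRK ler_ln ?posrE ?expR_gt0//.
  by near: n; exact: nbhs_infty_ger.
by rewrite ltr0n; near: n; exact: nbhs_infty_gt.
Unshelve. all: by end_near.
Qed.

Lemma powR_natE (R : realType) (n : nat) (a : R) : (0 < n)%N ->
  n%:R `^ a = expR (a * ln (n%:R : R)).
Proof. by move=> n0; rewrite /powR pnatr_eq0 gtn_eqF. Qed.

Unset Implicit Arguments.

Theorem theorem3p2 (R : realType)
  (M : forall n : nat, network_model R n)
  (gamma upsilon2 kappa c0 xi nu epsilon d_T : R)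
  (parcor : forall n, 'I_(blocks (M n)) -> 'I_(blocks (M n)) -> R)
  (theta : forall n, 'I_(blocks (M n)) -> 'cV[R]_(blocks (M n)))
  (lambda : forall n, 'I_(blocks (M n)) -> R -> R)
  (lambda_min T tn : nat -> R)
  (theta_tilde : forall n, 'I_(blocks (M n)) -> Omega (M n) ->
                           'cV[R]_(blocks (M n)))
  (parcor_def : forall n (t : 'I_n) (a b : 'I_(blocks (M n))), a != b ->
     is_partial_corr (Pr (M n)) (eta_coord (M n) t) a b (parcor n a b))
  (theta_def : forall n a, (0 < n)%N ->
     is_regression_coef (M n) a (theta n a))
  (gamma_gt0 : 0 < gamma)
  (B1_1 : (fun n => (blocks (M n))%:R : R) =O_\oo (fun n => n%:R `^ gamma : R))
  (B1_2_var : forall n (t : 'I_n) a,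
     ('V_(Pr (M n))[eta_coord (M n) t a] = 1)%E)
  (upsilon2_gt0 : 0 < upsilon2)
  (B1_2_cvar : forall n (t : 'I_n) (a : 'I_(blocks (M n))), exists V : Omega (M n) -> R,
     is_cond_var (Pr (M n))
       (sigma_rv [set b | b != a] (eta_coord (M n) t))
       (eta_coord (M n) t a) V /\
     {ae Pr (M n), forall w, upsilon2 <= V w})
  (kappa_itv : 0 <= kappa < 1 / 2)
  (B1_3a : (fun n => (\max_a #|neighbours (M n) a|)%N%:R : R) =O_\oo
           (fun n => n%:R `^ kappa : R))
  (B1_3b : (fun n => max_row_sum (precision (M n))) =O_\oo (fun n => 1 : R))
  (c0_gt0 : 0 < c0)
  (xi_itv : kappa < xi <= 1)
  (B1_4 : forall n (a b : 'I_(blocks (M n))), (0 < n)%N -> (a, b) \in edges (M n) ->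
     c0 * n%:R `^ (- ((1 - xi) / 2)) <= `|parcor n a b|)
  (B1_5 : (fun n => mu_B (M n)) =o_\oo (fun n => ln n%:R : R))
  (nu_gt : 1 - xi + 2 * kappa < nu)
  (B2_pos : \forall n \near \oo, (0 < block_pairs_min (M n))%N)
  (B2 : (fun n => ((block_pairs_min (M n))%:R^-1 : R)%R) =O_\oo
        (fun n => n%:R `^ (- nu) : R))
  (epsilon_gt0 : 0 < epsilon)
  (epsilon_itv : 1 + 2 * kappa - nu < epsilon < xi)
  (lambda_incr : forall n a, (0 < n)%N -> forall x y, 0 <= x -> x <= y ->
     lambda n a x <= lambda n a y)
  (lambda_min_gt0 : forall n, (0 < n)%N -> 0 < lambda_min n)
  (lambda_ge : forall n a (th : 'cV[R]_(blocks (M n))), (0 < n)%N ->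
     th a 0 = 0 -> lambda_min n <= lambda n a (norm1 th))
  (lambda_theta : (fun n => \big[Num.max/0]_a lambda n a (norm1 (theta n a)))
     =o_\oo (fun n => (n%:R `^ (- ((1 - xi) / 2)) * (ln n%:R)^-1 : R)%R))
  (tn_gt0 : \forall n \near \oo, 0 < tn n)
  (tn_infty : (fun n => ((tn n)^-1)%R) =o_\oo (fun n => 1 : R))
  (tn_O : tn =O_\oo (fun n => ln n%:R : R))
  (d_T_gt0 : 0 < d_T)
  (T_gt0 : forall n, (0 < n)%N -> 0 < T n)
  (T_sim : exists2 r : R, 0 < r &
     (fun n => T n / (d_T * ln n%:R)) @ \oo --> r)
  (lambda_min_O : (fun n => ((lambda_min n)^-1)%R) =O_\oo
                  (fun n => n%:R `^ ((1 - epsilon) / 2) : R))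
  (theta_tilde_meas : forall n a b, (0 < n)%N ->
     measurable_fun [set: Omega (M n)] (fun w => theta_tilde n a w b 0))
  (theta_tilde_sol : forall n a w, (0 < n)%N ->
     is_dantzig (M n) (T n) (lambda n) a w (theta_tilde n a w)) :
  exists2 c : R, 0 < c &
    (fun n => 1 - fine (Pr (M n) [set w |
        E_hat_and (tn n) (lambda n) (theta_tilde n ^~ w) = edges (M n)]))
      =O_\oo (fun n => expR (- c * ln n%:R ^+ 2) : R) /\
    (fun n => 1 - fine (Pr (M n) [set w |
        E_hat_or (tn n) (lambda n) (theta_tilde n ^~ w) = edges (M n)]))
      =O_\oo (fun n => expR (- c * ln n%:R ^+ 2) : R).
Proof.
have [CK CK0 nK] : exists2 k, 0 < k & \forall n \near \oo,
    `|(blocks (M n))%:R : R| <= k * `|n%:R `^ gamma| by exact/eqO_exP.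
have [C C0 nC] : exists2 k, 0 < k & \forall n \near \oo,
    `|max_row_sum (precision (M n)) : R| <= k * `|1 : R| by exact/eqO_exP.
have [Cm Cm0 nm] : exists2 k, 0 < k & \forall n \near \oo,
    `|((block_pairs_min (M n))%:R^-1 : R)%R| <= k * `|n%:R `^ (- nu)| by exact/eqO_exP.
have [Cl Cl0 nl] : exists2 k, 0 < k & \forall n \near \oo,
    `|((lambda_min n)^-1)%R| <= k * `|n%:R `^ ((1 - epsilon) / 2)| by exact/eqO_exP.
have [Ct Ct0 nt] : exists2 k, 0 < k & \forall n \near \oo,
    `|tn n| <= k * `|ln (n%:R : R)| by exact/eqO_exP.
have [r r0 nT] := T_sim.
move: kappa_itv xi_itv epsilon_itv => /andP[kap0 kap1] /andP[xi0 xi1] /andP[ep0 ep1].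
have rd0 : 0 < r * d_T by rewrite mulr_gt0.
have [de de0 [de1 de2 de3]] := rate_exists kap0 xi1 nu_gt ep0 rd0.
(* The three exponents belong to the Gaussian tails, the frequencies and the empirical
   covariance. *)
pose c := Num.min (Num.min (de ^+ 2 / 8) (8 * Cm)^-1) (1 / 2).
have c0' : 0 < c.
  by rewrite !lt_min !divr_gt0 ?exprn_gt0//= invr_gt0 mulr_gt0.
have c1 : c <= de ^+ 2 / 8 by rewrite !ge_min lexx.
have c2 : c <= (8 * Cm)^-1 by rewrite !ge_min lexx orbT.
have c3 : c <= 1 / 2 by rewrite !ge_min lexx orbT.
have [L1 L11 growth] := @growth_conditions R de nu epsilon C Cl de0
  de1 de2 epsilon_gt0 (ltW C0) Cl0.
pose h := c0 / ((4 * C ^+ 2 + Ct) * C * 2).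
have C20 : 0 < 4 * C ^+ 2 + Ct by rewrite addr_gt0// mulr_gt0// exprn_gt0.
have h0 : 0 < h by rewrite divr_gt0// !mulr_gt0.
have nmu : \forall n \near \oo, `|mu_B (M n)| <= de * `|ln (n%:R : R)|.
  by move/eqoP : B1_5; exact.
have nlam : \forall n \near \oo,
    `|\big[Num.max/0]_a lambda n a (norm1 (theta n a))| <=
    h * `|n%:R `^ (- ((1 - xi) / 2)) * (ln (n%:R : R))^-1|.
  by move/eqoP : lambda_theta; exact.
have ntn : \forall n \near \oo, `|((tn n)^-1)%R| <= (4 * C ^+ 2)^-1 * `|1 : R|.
  by move/eqoP : tn_infty; apply; rewrite invr_gt0 mulr_gt0// exprn_gt0.
(* Half of the limiting ratio suffices: T_n >= (r d_T/2) log n, which [de] was chosen to respect. *)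
have nT2 : \forall n \near \oo, r / 2 < T n / (d_T * ln (n%:R : R)).
  by apply: cvgr_gt nT _ _; rewrite ltr_pdivrMr// ltr_pMr// ltr1n.
pose Cst := 4 * CK + 4 * CK ^+ 2 * expR 64.
have Cst0 : 0 < Cst by rewrite addr_gt0// ?mulr_gt0 ?exprn_gt0 ?expR_gt0.
suff key : \forall n \near \oo,
    `|1 - fine (Pr (M n) [set w |
        E_hat_and (tn n) (lambda n) (theta_tilde n ^~ w) = edges (M n)])| <=
      Cst * expR (- c * ln n%:R ^+ 2) /\
    `|1 - fine (Pr (M n) [set w |
        E_hat_or (tn n) (lambda n) (theta_tilde n ^~ w) = edges (M n)])| <=
      Cst * expR (- c * ln n%:R ^+ 2).
  exists c => //; split; apply/eqO_exP; exists Cst => //; near=> n;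
    rewrite [`|expR _|]ger0_norm ?expR_ge0//; near: n;
    by apply: filterS key => n [].
near=> n.
have n0 : (0 < n)%N by near: n; exact: nbhs_infty_gt.
have L10 : 10 <= ln (n%:R : R) by near: n; exact: near_ln_ge.
have hL1 : L1 <= ln (n%:R : R) by near: n; exact: near_ln_ge.
have hL2 : (1 + gamma) * 8 / de ^+ 2 <= ln (n%:R : R).
  by near: n; exact: near_ln_ge.
have hL3 : (1 + gamma) * (8 * Cm) <= ln (n%:R : R) by near: n; exact: near_ln_ge.
have hL4 : 4 * gamma <= ln (n%:R : R) by near: n; exact: near_ln_ge.
set L := ln (n%:R : R) in L10 hL1 hL2 hL3 hL4 *.
have nE : n%:R = expR L by rewrite lnK// posrE ltr0n.
have pw a : n%:R `^ a = expR (a * L) by exact: powR_natE.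
have hL2' : (1 + gamma) * 8 <= de ^+ 2 * L.
  by move: hL2; rewrite ler_pdivrMr ?exprn_gt0// [L * _]mulrC.
have L0 : 0 < L by apply: lt_le_trans L10; rewrite ltr0n.
have [x01 xU8 err] := growth L hL1.
have hK : (blocks (M n))%:R <= CK * expR (gamma * L).
  have : `|(blocks (M n))%:R : R| <= CK * `|n%:R `^ gamma| by near: n.
  by rewrite pw !ger0_norm ?expR_ge0.
have hC : max_row_sum (precision (M n)) <= C.
  have : `|max_row_sum (precision (M n)) : R| <= C * `|1 : R| by near: n.
  by rewrite normr1 mulr1; apply: le_trans; exact: ler_norm.
have m0 : (0 < block_pairs_min (M n))%N by near: n.
have hm : expR (nu * L) / Cm <= (block_pairs_min (M n))%:R.
  have : `|((block_pairs_min (M n))%:R^-1 : R)%R| <= Cm * `|n%:R `^ (- nu)| by near: n.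
  have m0' : (0 : R) < (block_pairs_min (M n))%:R by rewrite ltr0n.
  rewrite pw !ger0_norm ?expR_ge0 ?invr_ge0// -div1r ler_pdivrMr// => hh.
  rewrite ler_pdivrMr//.
  have e0 := expR_gt0 (nu * L).
  have := ler_wpM2l (ltW e0) hh; rewrite mulr1 mulNr expRN.
  by move=> h1; apply: le_trans h1 _; rewrite le_eqVlt; apply/orP; left; apply/eqP; field; rewrite gt_eqF.
have lm0 := lambda_min_gt0 n n0.
have hl : expR (- ((1 - epsilon) / 2 * L)) / Cl <= lambda_min n.
  have : `|((lambda_min n)^-1)%R| <= Cl * `|n%:R `^ ((1 - epsilon) / 2)| by near: n.
  rewrite pw !ger0_norm ?expR_ge0 ?invr_ge0 ?(ltW lm0)// -div1r ler_pdivrMr// => hh.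
  rewrite ler_pdivrMr// expRN -div1r ler_pdivrMr ?expR_gt0//.
  by apply: le_trans hh _; rewrite le_eqVlt; apply/orP; left; apply/eqP; ring.
have tnp : 0 < tn n by near: n.
have ht1 : 4 * C ^+ 2 <= tn n.
  have : `|((tn n)^-1)%R| <= (4 * C ^+ 2)^-1 * `|1 : R| by near: n.
  rewrite normr1 mulr1 ger0_norm ?invr_ge0 ?(ltW tnp)// lef_pV2 ?posrE// mulr_gt0// exprn_gt0//.
have ht2 : tn n <= Ct * L.
  have : `|tn n| <= Ct * `|ln (n%:R : R)| by near: n.
  by rewrite -/L !ger0_norm ?(ltW tnp) ?(ltW L0).
have hmu : mu_B (M n) <= de * L.
  have : `|mu_B (M n)| <= de * `|ln (n%:R : R)| by near: n.
  rewrite -/L [X in _ <= _ * X]ger0_norm ?(ltW L0)//.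
  by apply: le_trans; exact: ler_norm.
have hT : 2 * de * L <= T n.
  have : r / 2 < T n / (d_T * ln (n%:R : R)) by near: n.
  rewrite -/L ltr_pdivlMr ?mulr_gt0// => hh.
  apply: le_trans (ltW hh).
  by rewrite mulrA ler_pM2r// mulrAC.
pose La := \big[Num.max/0]_a lambda n a (norm1 (theta n a)).
have La0 : 0 <= La by exact: bigmax_ge_id.
have hLa : La <= h * (expR (- ((1 - xi) / 2) * L) / L).
  have : `|La| <= h * `|n%:R `^ (- ((1 - xi) / 2)) * (ln (n%:R : R))^-1|.
    by rewrite /La; near: n.
  by rewrite pw -/L !ger0_norm// mulr_ge0 ?expR_ge0 ?invr_ge0 ?(ltW L0).
have L1' : 1 <= L by apply: le_trans L10; rewrite ler1n.
have bm : (4 * C ^+ 2 + tn n) * La * C < c0 * n%:R `^ (- ((1 - xi) / 2)).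
  by rewrite pw; apply: threshold_gap hLa => //; exact: expR_gt0.
have tail := @tail_sum_le R L de gamma nu CK Cm n%:R (blocks (M n))%:R
  (block_pairs_min (M n))%:R c gamma_gt0 (ler0n _ _) nE hK Cm0 hm L0 hL2' hL3 hL4 c1 c2 c3.
(* The bound U = 2 de L spends one de L on the centred logits and one on mu_B; the remaining
   parameters are those for which [growth] and [tail] were established. *)
have rec := @edge_recovery R n (M n) (lambda n) (theta n) (parcor n) n0
  (parcor_def n) (fun a => theta_def n a n0) (B1_2_var n)
  (lambda_min n) (T n) (tn n) C hC (fun a x y => lambda_incr n a n0 x y)
  (fun a x => lambda_ge n a x n0) lm0 (theta_tilde n)
  (fun a b => theta_tilde_meas n a b n0) (fun a w => theta_tilde_sol n a w n0)
  (de * L) (2 * de * L) (expR (- (nu / 2 * L)) * L) (expR (- (L / 2)))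
  (expR (L / 2) * L ^+ 2) La (c0 * n%:R `^ (- ((1 - xi) / 2))).
have [] := rec _ x01 (expRN_half_le L10) _ m0 _ hT xU8 _ ht1 _ bm _.
- by rewrite mulr_ge0 ?(ltW de0) ?(ltW L0).
- by rewrite mulr_ge0 ?expR_ge0 ?sqr_ge0.
- by rewrite -mulrA mulr_natl mulr2n lerD2l.
- by rewrite nE; apply: le_trans err _.
- by move=> a; exact: (le_bigmax _ (fun a => lambda n a (norm1 (theta n a))) a).
- by move=> a b ab; exact: B1_4.
by move=> r1 r2; split; [apply: le_trans r1 _|apply: le_trans r2 _]; exact: tail.
Unshelve. all: by end_near.
Qed.
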